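(* Consider the 2-user MISO broadcast channel with a random time-varying jammer described in the context, with jammer-state probabilities $\lambda_{00},\lambda_{01},\lambda_{10},\lambda_{11}$ and marginals $\lambda_1=\lambda_{00}+\lambda_{01}$, $\lambda_2=\lambda_{00}+\lambda_{10}$. For each of the three CSIT-JSIT configurations $\mathsf{PP}$, $\mathsf{PD}$ and $\mathsf{PN}$, the degrees-of-freedom region is the same, and it equals the set of pairs $(d_1,d_2)$ of non-negative real numbers satisfying $$d_1\le \lambda_1,\qquad d_2\le \lambda_2 .$$
   Context: **Channel.** A transmitter with 2 antennas sends independent, uniformly distributed messages $W_1,W_2$ to two single-antenna receivers. At time $t=1,2,\dots$ receiver $k\in\{1,2\}$ observes $$Y_k(t)=\mathbf H_k(t)\mathbf X(t)+S_k(t)\,\mathbf G_k(t)\mathbf J(t)+N_k(t),$$ where $\mathbf X(t)\in\mathbb C^{2}$ is the channel input, subject to $E|\mathbf X(t)|^2\le P_T$; $\mathbf H_k(t)\in\mathbb C^{1\times 2}$ is the channel from transmitter to receiver $k$; $\mathbf G_k(t)\in\mathbb C^{1\times 2}$ is the channel from the jammer to receiver $k$; $\mathbf J(t)\in\mathbb C^2$ is the jammer's signal; $N_k(t)\sim\mathcal{CN}(0,1)$ is noise, i.i.d. over time and independent across receivers. The vectors $\mathbf H_k(t)$, $\mathbf G_k(t)$ have continuous distributions (i.e. with a density) with identity covariance, not depending on $P_T$, are i.i.d. over time and independent across $k$. The entries of $\mathbf J(t)$ are i.i.d. $\mathcal{CN}(0,P_T)$, i.i.d. over time. The processes $\mathbf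 H$, $\mathbf G$, $\mathbf J$, $S$, $N$ and the messages are mutually independent. **Jammer state.** $S(t)=(S_1(t),S_2(t))\in\{0,1\}^2$ is i.i.d. over time; $S_k(t)=1$ means receiver $k$ is jammed at time $t$ and $S_k(t)=0$ means it is not. $\lambda_{ij}=\Pr(S(t)=(i,j))$, fixed, not depending on $P_T$. $\lambda_1=\lambda_{00}+\lambda_{01}$ and $\lambda_2=\lambda_{00}+\lambda_{10}$ are the probabilities that receivers 1 and 2, respectively, are not jammed. **Information at the terminals.** Write $\mathbf H(t)=(\mathbf H_1(t),\mathbf H_2(t))$, $\mathbf H^{t}=(\mathbf H(1),\dots,\mathbf H(t))$, $S^{t}=(S(1),\dots,S(t))$. Both receivers know $\mathbf H^n$ and $S^n$ (for the whole block of length $n$). Nobody knows $\mathbf G$. The transmitter always knows the statistics of $S(t)$. A CSIT-JSIT configuration is a pair of letters; the first describes the transmitter's knowledge of $\mathbf H$, the second its knowledge of $S$: $\mathsf P$ (perfect, instantaneous: at time $t$ the transmitter knows the process up to and including time $t$), $\mathsf D$ (delayed: it knows the process up to time $t-1$), $\mathsf N$ (none: it knows no realizations). Thus $\mathbf X(t)$ is a function of $(W_1,W_2)$ together with: $(\mathbf H^t,S^t)$ in $\mathsf{PP}$; $(\mathbf H^t,S^{t-1})$ in $\mathsf{PD}$; $\mathbf H^t$ in $\mathsf{PN}$. **DoF region.** For fixed $P_T$, a rate pair $(R_1,R_2)$, $R_k=\frac1n\log|W_k|$ ($|W_k|$ the number of values of message $W_k$), is achievable if there are encoders (respecting the configuration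 and the power constraint) and decoders $g_k^{(n)}(Y_k^n,\mathbf H^n,S^n)$ whose error probabilities $\Pr(W_k\ne g_k^{(n)})$ tend to $0$ as $n\to\infty$ for $k=1,2$. The degrees-of-freedom region is the set of all $(d_1,d_2)$ with $d_k=\lim_{P_T\to\infty}\frac{R_k}{\log P_T}$ for achievable rate pairs $(R_1,R_2)=(R_1(P_T),R_2(P_T))$. *)

(* Defs.v *)
From HB Require Import structures.
From mathcomp Require Import all_boot all_order all_algebra.
From mathcomp Require Import complex.
From mathcomp Require Import all_classical all_reals all_analysis.

Set Implicit Arguments.
Unset Strict Implicit.
Unset Printing Implicit Defensive.

Import Order.TTheory GRing.Theory Num.Theory.
Import numFieldNormedType.Exports.

Local Open Scope classical_set_scope.
Local Open Scope ring_scope.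
Local Open Scope complex_scope.

(* R[i] carries the sigma-algebra making z |-> (Re z, Im z) a measurable
   isomorphism onto R * R; message sets carry the discrete one. *)
Definition re_im (R : Type) (z : R[i]) : R * R := (complex.Re z, complex.Im z).

HB.instance Definition _ (R : realType) := isPointed.Build R[i] 0.
HB.instance Definition _ (R : realType) := Measurable.copy R[i]
  (g_sigma_algebra_preimageType (@re_im R : R[i] -> R * R)).

HB.instance Definition _ (m : nat) := isPointed.Build 'I_m.+1 ord0.
HB.instance Definition _ (m : nat) := @isMeasurable.Build default_measure_display
  'I_m.+1 (@discrete_measurable 'I_m.+1) (@discrete_measurable0 _)
  (@discrete_measurableC _) (@discrete_measurableU _).

(* Users and antennas are indexed by 'I_2. *)
Notation user := 'I_2 (only parsing).
Notation vec2 R := (2.-tuple R[i])%type.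
Notation csi R := (2.-tuple (vec2 R))%type.
Notation jsi := (2.-tuple bool)%type.

Definition dotC (R : realType) (h x : vec2 R) : R[i] :=
  \sum_(i < 2) tnth h i * tnth x i.

Definition sqmodC (R : realType) (z : R[i]) : R := complex.Re z ^+ 2 + complex.Im z ^+ 2.

Definition sqnormC (R : realType) (x : vec2 R) : R :=
  \sum_(i < 2) sqmodC (tnth x i).

Definition re_im2 (R : realType) (x : vec2 R) : (R * R) * (R * R) :=
  (re_im (tnth x ord0), re_im (tnth x ord_max)).

Section Laws.
Context d (T : measurableType d) (R : realType) (Pr : probability T R).

(* Meaningful when Re X and Im X are integrable. *)
Definition cexpectation (X : T -> R[i]) : R[i] :=
  fine 'E_Pr[(fun w => complex.Re (X w))] +i* fine 'E_Pr[(fun w => complex.Im (X w))].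

(* E[(X - EX)(X - EX)^dagger] = I; the mean is not assumed to vanish. *)
Definition identity_covariance (X : T -> vec2 R) : Prop :=
  (forall i, Pr.-integrable setT (fun w => (sqmodC (tnth (X w) i))%:E)) /\
  forall i j,
    let m l := cexpectation (fun w => tnth (X w) l) in
    cexpectation (fun w => (tnth (X w) i - m i) * conjc (tnth (X w) j - m j))
    = (i == j)%:R.

Definition has_density (X : T -> vec2 R) : Prop :=
  exists f : (R * R) * (R * R) -> R,
    [/\ measurable_fun setT f, (forall x, 0 <= f x) &
        forall A, measurable A ->
          Pr ((fun w => re_im2 (X w)) @^-1` A) =
          (\int[(lebesgue_measure \x lebesgue_measure) \x
                (lebesgue_measure \x lebesgue_measure)]_(x in A) (f x)%:E)%E].

(* CN(0, v): independent real and imaginary parts, each N(0, v / 2)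
   (normal_prob takes the standard deviation). *)
Definition circular_gaussian (v : R) (X : T -> R[i]) : Prop :=
  let g := normal_prob 0 (Num.sqrt (v / 2)) in
  forall A, measurable A -> Pr ((fun w => re_im (X w)) @^-1` A) = (g \x g)%E A.

Definition identically_distributed d' (U : measurableType d')
    (X : nat -> T -> U) : Prop :=
  forall t (B : set U), measurable B -> Pr (X t @^-1` B) = Pr (X 0 @^-1` B).

Definition mutually_independent (I : Type) (F : I -> set (set T)) : Prop :=
  forall (n : nat) (i : 'I_n -> I) (A : 'I_n -> set T),
    injective i -> (forall l, F (i l) (A l)) ->
    Pr (\bigcap_l A l) = (\prod_(l < n) Pr (A l))%E.

End Laws.

(* The elementary random variables of the model; time starts at 0. *)
Inductive source :=
  | SrcH of user & nat
  | SrcG of user & nat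
  | SrcJ of nat & 'I_2
  | SrcS of nat
  | SrcN of user & nat
  | SrcW of user.

(* [chJ P t] is the jammer's signal under power P, all other processes being
   independent of P. [chW k m] is the message of user k for a code with
   m.+1 values of that message. [lam i j] is the probability of jammer state
   (i, j), true meaning jammed.
   Joint independence of all sources is the same as independence of the
   processes H, G, J, S, N and of the messages together with independence
   within each process (over time, users and jammer antennas). *)
Record jammed_bc d (T : measurableType d) (R : realType)
    (Pr : probability T R) (lam : bool -> bool -> R) := JammedBC {
  chH : user -> nat -> {RV Pr >-> vec2 R} ;
  chG : user -> nat -> {RV Pr >-> vec2 R} ;
  chJ : R -> nat -> {RV Pr >-> vec2 R} ;
  chS : nat -> {RV Pr >-> jsi} ;
  chN : user -> nat -> {RV Pr >-> R[i]} ;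
  chW : forall (k : user) (m : nat), {RV Pr >-> 'I_m.+1} ;
  chH_id : forall k, identically_distributed Pr (chH k) ;
  chH_density : forall k t, has_density Pr (chH k t) ;
  chH_cov : forall k t, identity_covariance Pr (chH k t) ;
  chG_id : forall k, identically_distributed Pr (chG k) ;
  chG_density : forall k t, has_density Pr (chG k t) ;
  chG_cov : forall k t, identity_covariance Pr (chG k t) ;
  chJ_law : forall P t i, 0 < P ->
    circular_gaussian Pr P (fun w => tnth (chJ P t w) i) ;
  chS_law : forall t i j, Pr (chS t @^-1` [set [tuple i; j]]) = (lam i j)%:E ;
  chN_law : forall k t, circular_gaussian Pr 1 (chN k t) ;
  chW_law : forall k m w, Pr (chW k m @^-1` [set w]) = ((m.+1%:R)^-1)%:E ;
  ch_indep : forall (P : R) (m : user -> nat), 0 < P ->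
    mutually_independent Pr (fun s : source =>
      match s with
      | SrcH k t => preimage_set_system setT (chH k t) measurable
      | SrcG k t => preimage_set_system setT (chG k t) measurable
      | SrcJ t i => preimage_set_system setT
                      (fun w => tnth (chJ P t w) i) measurable
      | SrcS t => preimage_set_system setT (chS t) measurable
      | SrcN k t => preimage_set_system setT (chN k t) measurable
      | SrcW k => preimage_set_system setT (chW k (m k)) measurable
      end)
}.

Inductive knowledge := Perfect | Delayed | NoInfo.

(* Number of initial samples of a process known at (0-based) time t. *)
Definition known (c : knowledge) (t : nat) : nat :=
  match c with Perfect => t.+1 | Delayed => t | NoInfo => 0 end.

(* Block code of length n with (m k).+1 values of message k; [csit] and [jsit]
   describe the transmitter's knowledge of the channel and of the jammer state. *)
Record code (R : realType) (csit jsit : knowledge) (n : nat) (m : user -> nat) :=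
  Code {
  enc : forall (t : 'I_n) (w : forall k, 'I_(m k).+1),
    (known csit t).-tuple (csi R) -> (known jsit t).-tuple jsi -> vec2 R ;
  dec : forall k : user,
    n.-tuple R[i] -> n.-tuple (csi R) -> n.-tuple jsi -> 'I_(m k).+1 ;
  enc_measurable : forall (t : 'I_n) w, measurable_fun setT
    (fun hs : (known csit t).-tuple (csi R) * (known jsit t).-tuple jsi =>
       @enc t w hs.1 hs.2) ;
  dec_measurable : forall k, measurable_fun setT
    (fun yhs : n.-tuple R[i] * (n.-tuple (csi R) * n.-tuple jsi) =>
       @dec k yhs.1 yhs.2.1 yhs.2.2)
}.
Arguments enc {R csit jsit n m} c t w _ _ : rename.
Arguments dec {R csit jsit n m} c k _ _ _ : rename.

Section Region.
Context d (T : measurableType d) (R : realType) (Pr : probability T R)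
  (lam : bool -> bool -> R) (ch : jammed_bc Pr lam).

Definition Hhist (l : nat) (w : T) : l.-tuple (csi R) :=
  [tuple [tuple chH ch k t w | k < 2] | t < l].

Definition Shist (l : nat) (w : T) : l.-tuple jsi :=
  [tuple chS ch t w | t < l].

Section Code.
Variables (csit jsit : knowledge) (n : nat) (m : user -> nat).
Variables (P : R) (c : code R csit jsit n m).

Definition input (t : 'I_n) (w : T) : vec2 R :=
  enc c t (fun k => chW ch k (m k) w) (Hhist _ w) (Shist _ w).

Definition output (k : user) (t : 'I_n) (w : T) : R[i] :=
  dotC (chH ch k t w) (input t w)
  + (tnth (chS ch t w) k)%:R * dotC (chG ch k t w) (chJ ch P t w)
  + chN ch k t w.

Definition power_constraint : Prop :=
  forall t : 'I_n,
    ('E_Pr[(fun w => sqnormC (input t w))] <= P%:E)%E.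

Definition error_prob (k : user) : \bar R :=
  Pr [set w | dec c k [tuple output k t w | t < n] (Hhist n w) (Shist n w)
              <> chW ch k (m k) w].

End Code.

Definition achievable (csit jsit : knowledge) (P : R) (r : user -> R) : Prop :=
  exists (m : nat -> user -> nat) (c : forall n, code R csit jsit n (m n)),
    [/\ forall n, power_constraint P (c n),
        forall k, ln ((m n k).+1%:R) / n%:R @[n --> \oo] --> r k &
        forall k, error_prob P (c n) k @[n --> \oo] --> 0%E].

Definition dof_region (csit jsit : knowledge) : set (R * R) :=
  [set dd | exists r : R -> user -> R,
    [/\ forall P, 0 < P -> achievable csit jsit P (r P),
        r P ord0 / ln P @[P --> +oo] --> dd.1 &
        r P ord_max / ln P @[P --> +oo] --> dd.2]].

End Region.

(* Main.v *)
(* Converse. Condition on everything except the first jammer component (when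
   receiver k is jammed and its gain is not too small) or except the noise
   (otherwise): the output of receiver k then has a density at most
   1 / (pi c P), respectively 1 / pi. Compared with a fixed density q of scale
   sqrt P, an output thus costs a likelihood factor of order 1 when receiver k
   is jammed and of order P when it is not, so the logarithm of the total cost
   has mean at most n (lambda_k + e) ln P + O(n). If all outputs were drawn
   from q, they would carry no information on the message and the decoder could
   only guess; hence ln |W_k| <= n (lambda_k + e) ln P + O(n), whatever the
   transmitter knows.

   Achievability. The transmitter sends the symbol of user k orthogonally to
   the channel of the other user, which requires H(t) only. When unjammed,
   receiver k sees its symbol times the determinant of H(t), plus noise of
   bounded power; so symbols taken from a grid of about P points are
   distinguishable up to a small fraction of bad times. Codewords with pairwise
   agreement less than n (lambda_k - e) exist at rate close to lambda_k ln P
   (Gilbert's bound), and the decoder picks a word inconsistent with few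
   unjammed outputs. *)
Require Import Defs.
From HB Require Import structures.
From mathcomp Require Import all_boot all_order all_algebra.
From mathcomp Require Import complex.
From mathcomp Require Import all_classical all_reals all_analysis.
From mathcomp Require Import measurable_realfun.
From mathcomp Require Import ring lra zify.

Set Implicit Arguments.
Unset Strict Implicit.
Unset Printing Implicit Defensive.

Import Order.TTheory GRing.Theory Num.Theory.
Import numFieldNormedType.Exports.

(** * Codes with small pairwise agreement *)

(** No entropy appears: the converse is a change of measure followed by Markov's inequality, and it
    shows only that the error stays away from 0. Its obstacle is that the input may depend on [H]
    and [S] in any measurable way. Outputs need not be independent over time, and a product such as
    |H|^2 |X|^2 may have infinite mean. Two choices deal with this. The reference law q is of Cauchy
    type: its density decays polynomially, so minus its logarithm grows like a logarithm, which
    turns products into sums, and the separate second moments of H, X, G, J and N suffice. The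
    scales are such that every likelihood factor is at most 1, so the losses are nonnegative and the
    mean of their sum is enough, without concentration.

    On the other side, the region asks for one rate function defined at all positive powers. The
    margin below lambda_k must shrink as P grows, while the power that a given margin requires is
    not controlled; so the margin is taken nearly optimal at each P. *)

Lemma card_bigcup_le (T I : finType) (P : pred I) (F : I -> {set T}) :
  #|\bigcup_(i | P i) F i| <= \sum_(i | P i) #|F i|.
Proof.
elim/big_rec2: _ => [|i A s _ sA]; first by rewrite cards0.
by apply: leq_trans (leq_card_setU _ _) _; rewrite leq_add2l.
Qed.

Section Gilbert.
Variables (n Q : nat).
Local Notation word := {ffun 'I_n -> 'I_Q}.

Definition agreement (v w : word) : nat := #|[set t | v t == w t]|.

Lemma card_agree_on (w : word) (A : {set 'I_n}) :
  #|[set v : word | [forall t in A, w t == v t]]| = (Q ^ (n - #|A|))%N.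
Proof.
rewrite -(eq_card (A := family (fun t => if t \in A then pred1 (w t) else predT))); last first.
  move=> v; rewrite [RHS]inE; apply/familyP/forall_inP => [h t At|h t].
    by have := h t; rewrite At inE eq_sym.
  by case: ifP => // At; rewrite inE eq_sym h.
rewrite card_family foldrE big_map big_enum/=.
rewrite (bigID (mem A))/= big1 ?mul1n; last by move=> t /= ->; rewrite card1.
rewrite (eq_bigr (fun=> Q)); last by move=> t /negPf ->; rewrite card_ord.
have -> : n - #|A| = #|[predC A]| by have := cardC A; rewrite card_ord; lia.
by rewrite prod_nat_const; congr (Q ^ _); exact: eq_card.
Qed.

(** Union bound over the sets of agreement: there are at most [2 ^ n] of them, and a word that
    agrees with [w] on such a set is free only at the other positions. *)
Lemma card_close_words (w : word) K : 0 < Q ->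
  #|[set v | K <= agreement w v]| <= 2 ^ n * Q ^ (n - K).
Proof.
move=> Q0.
have sub : [set v | K <= agreement w v] \subset
    \bigcup_(A : {set 'I_n} | K <= #|A|) [set v : word | [forall t in A, w t == v t]].
  apply/fintype.subsetP => v; rewrite inE => Kv; apply/finset.bigcupP; exists [set t | w t == v t] => //.
  by rewrite inE; apply/forall_inP => t; rewrite inE.
apply: leq_trans (subset_leq_card sub) _; apply: leq_trans (card_bigcup_le _ _) _.
apply: (@leq_trans (\sum_(A : {set 'I_n} | K <= #|A|) Q ^ (n - K))).
  apply: leq_sum => A KA; rewrite card_agree_on leq_pexp2l// leq_sub2l//.
rewrite sum_nat_const leq_mul2r; apply/orP; right.
apply: leq_trans (max_card _) _.
by rewrite -cardsT -powersetT card_powerset cardsT card_ord.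
Qed.

(* Greedy choice: as long as the words already chosen exclude fewer than
   [Q ^ n] words, another one can be added. *)
Lemma gilbert_code K M : 0 < Q -> K <= n -> M * 2 ^ n <= Q ^ K ->
  exists f : nat -> word, forall i j, i < j < M -> agreement (f i) (f j) < K.
Proof.
move=> Q0 Kn; elim: M => [|M IH] MQ; first by exists (fun=> [ffun=> Ordinal Q0]) => i j; rewrite ltn0 andbF.
have [|f fP] := IH; first by rewrite (leq_trans _ MQ)// leq_mul2r leqnSn orbT.
have [w wP] : exists w, w \notin \bigcup_(i < M) [set v | K <= agreement (f i) v].
  apply/existsP; rewrite -negb_forall; apply/negP => /forallP all.
  have : #|word| <= M * (2 ^ n * Q ^ (n - K)).
    rewrite -cardsT; apply: (@leq_trans #|\bigcup_(i < M) [set v | K <= agreement (f i) v]|).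
      by apply: subset_leq_card; apply/fintype.subsetP => v _; exact: all.
    apply: leq_trans (card_bigcup_le _ _) _.
    rewrite -[M in M * _]card_ord -sum_nat_const; apply: leq_sum => i _.
    exact: card_close_words.
  rewrite card_ffun !card_ord -{1}(subnKC Kn) expnD.
  have Q1 : 0 < Q ^ (n - K) by rewrite expn_gt0 Q0.
  rewrite mulnA leq_pmul2r// leqNgt => /negP; apply.
  by apply: leq_trans MQ; rewrite ltn_pmul2r ?expn_gt0.
exists (fun i => if i < M then f i else w) => i j /andP[ij].
rewrite ltnS leq_eqVlt => /orP[/eqP jM|jM]; last first.
  by rewrite jM (ltn_trans ij jM) fP// ij jM.
move: ij; rewrite jM ltnn => iM; rewrite iM ltnNge; apply: contra wP => Kw.
by apply/finset.bigcupP; exists (Ordinal iM) => //; rewrite inE.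
Qed.

End Gilbert.

Local Open Scope classical_set_scope.
Local Open Scope ring_scope.

(** * Independence *)

Section Independence.
Context d (T : measurableType d) (R : realType) (Pr : probability T R).
Local Open Scope ereal_scope.

Definition independent_classes (F G : set (set T)) : Prop :=
  forall A B, F A -> G B -> Pr (A `&` B) = Pr A * Pr B.

Lemma independent_classesC (F G : set (set T)) :
  independent_classes F G -> independent_classes G F.
Proof. by move=> FG A B GA FB; rewrite setIC FG// muleC. Qed.

(** For [B] fixed, both sides are finite measures in [A]. They agree on the pi-system [F], which
    contains the whole space, so they agree on what it generates. *)
Lemma independent_classes_sigma (F G : set (set T)) :
  F `<=` measurable -> setI_closed F -> F setT -> G `<=` measurable ->
  independent_classes F G -> independent_classes <<s F >> G.
Proof.
move=> mF IF FT mG FG A B sA GB.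
have mB := mG _ GB.
pose m1 := mrestr Pr mB.
pose b := NngNum (fine_ge0 (measure_ge0 Pr B)).
pose m2 := mscale b Pr.
have bE : (b%:num)%:E = Pr B.
  by rewrite /b/= fineK// fin_num_measure.
have -> : Pr (A `&` B) = m1 A by [].
have -> : Pr A * Pr B = m2 A by rewrite /m2 /mscale/= -bE muleC.
apply: (@g_sigma_algebra_measure_unique _ _ _ F mF (fun=> setT) _ _ m1 m2) => //.
- by rewrite bigcup_const.
- move=> C FC; change (Pr (C `&` B) = (b%:num)%:E * Pr C).
  by rewrite (FG C B)// bE muleC.
- move=> _; change (Pr (setT `&` B) < +oo); rewrite setTI.
  exact: le_lt_trans (probability_le1 _ mB) (ltry _).
Qed.

Variables (I : choiceType) (F : I -> set (set T)).
Hypothesis mF : forall i, F i `<=` measurable.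
Hypothesis FI : forall i, setI_closed (F i).
Hypothesis FT : forall i, F i setT.
Hypothesis indF : mutually_independent Pr F.

(** The pi-system used for [joint_sigma]. The family [A] is total, so that two such intersections
    can be merged over the union of their index lists. *)
Definition finite_intersections (J : set I) : set (set T) :=
  [set X | exists (s : seq I) (A : I -> set T),
     [/\ uniq s, forall i, i \in s -> J i, forall i, F i (A i) &
         X = \bigcap_(i in [set` s]) A i]].

Lemma prob_bigcap_seq (s : seq I) (A : I -> set T) : uniq s ->
  (forall i, i \in s -> F i (A i)) ->
  Pr (\bigcap_(i in [set` s]) A i) = \prod_(i <- s) Pr (A i).
Proof.
move=> us FA.
have := @indF (size s) (tnth (in_tuple s)) (fun l => A (tnth (in_tuple s) l)).
rewrite (_ : \bigcap_l _ = \bigcap_(i in [set` s]) A i); last first.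
  apply/seteqP; split => x /= xA.
    move=> i /= si; have /tnthP[l ->] : i \in in_tuple s by [].
    exact: xA.
  by move=> l _; apply: xA; exact: mem_tnth.
move=> ->; first by rewrite [RHS]big_tnth.
- by apply/injectiveP; rewrite /injectiveb/dinjectiveb map_tnth_enum.
- by move=> l; apply: FA; exact: mem_tnth.
Qed.

Lemma measurable_finite_intersections J :
  finite_intersections J `<=` measurable.
Proof.
move=> _ [s [A [_ _ FA ->]]]; apply: fin_bigcap_measurable => // i _.
exact: mF (FA i).
Qed.

Lemma setI_closed_finite_intersections J :
  setI_closed (finite_intersections J).
Proof.
move=> _ _ [s [A [us sJ FA ->]]] [s' [A' [us' sJ' FA' ->]]].
pose B i := (if i \in s then A i else setT) `&` (if i \in s' then A' i else setT).
exists (undup (s ++ s')), B; split.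
- exact: undup_uniq.
- by move=> i; rewrite mem_undup mem_cat => /orP[/sJ|/sJ'].
- by move=> i; apply: FI; case: ifP.
apply/seteqP; split => [x [xA xA'] i /= _|x xB].
  by split; case: ifPn => // si; [exact: xA|exact: xA'].
split => i /= si.
  by have := xB i; rewrite /= mem_undup mem_cat si => /(_ isT)[]; rewrite si.
have := xB i; rewrite /= mem_undup mem_cat si orbT => /(_ isT)[_].
by rewrite si.
Qed.

Lemma finite_intersectionsT J : finite_intersections J setT.
Proof.
by exists [::], (fun=> setT); split => //; rewrite set_nil bigcap_set0.
Qed.

Lemma independent_finite_intersections J K : [disjoint J & K] ->
  independent_classes (finite_intersections J) (finite_intersections K).
Proof.
move=> JK _ _ [s [A [us sJ FA ->]]] [s' [A' [us' sK FA' ->]]].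
pose B i := if i \in s then A i else A' i.
have ss' i : i \in s' -> i \in s = false.
  move=> si'; apply/negP => si.
  by have := JK => /disj_set2P/seteqP[+ _] => /(_ i); apply; split; [exact: sJ|exact: sK].
rewrite (_ : _ `&` _ = \bigcap_(i in [set` s ++ s']) B i); last first.
  apply/seteqP; split => [x [xA xA'] i /=|x xB].
    by rewrite mem_cat /B; case: ifPn => [si _|_ /= si]; [exact: xA|exact: xA'].
  split => i /= si.
    by have := xB i; rewrite /= mem_cat si => /(_ isT); rewrite /B si.
  by have := xB i; rewrite /= mem_cat si orbT => /(_ isT); rewrite /B ss'.
rewrite !prob_bigcap_seq//; last 2 first.
- rewrite cat_uniq us us' andbT/=; apply/hasPn => i si'.
  by rewrite ss'.
- by move=> i _; rewrite /B; case: ifP.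
rewrite big_cat/=; congr (_ * _).
  by rewrite !big_seq; apply: eq_bigr => i si; rewrite /B si.
by rewrite !big_seq; apply: eq_bigr => i si; rewrite /B ss'.
Qed.

Definition joint_sigma (J : set I) : set (set T) := <<s \bigcup_(i in J) F i >>.

Lemma joint_sigma_finite_intersections J :
  joint_sigma J `<=` <<s finite_intersections J >>.
Proof.
apply: smallest_sub; first exact: smallest_sigma_algebra.
move=> A [i Ji FiA]; apply: sub_sigma_algebra.
exists [:: i], (fun j => if pselect (j = i) is left _ then A else setT); split => //.
- by move=> j; rewrite inE => /eqP ->.
- by move=> j; case: pselect => [->|].
apply/seteqP; split => [x Ax j /=|x]; first by rewrite inE; case: pselect.
by move=> /(_ i); rewrite /= mem_head => /(_ isT); case: pselect.
Qed.

(** Uniqueness of measures enlarges one class at a time: the class over [K] is generated first, and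
    symmetry then allows the same for [J]. *)
Lemma independent_joint_sigma J K : [disjoint J & K] ->
  independent_classes (joint_sigma J) (joint_sigma K).
Proof.
move=> JK A B /joint_sigma_finite_intersections sA
  /joint_sigma_finite_intersections sB.
have mfi := measurable_finite_intersections.
apply: (independent_classes_sigma (G := <<s finite_intersections K >>)) sA sB.
- exact: mfi.
- exact: setI_closed_finite_intersections.
- exact: finite_intersectionsT.
- apply: smallest_sub; [exact: sigma_algebra_measurable|exact: mfi].
apply: independent_classesC; apply: independent_classes_sigma.
- exact: mfi.
- exact: setI_closed_finite_intersections.
- exact: finite_intersectionsT.
- exact: mfi.
apply: independent_classesC; exact: independent_finite_intersections.
Qed.

Lemma joint_sigma_measurable J : joint_sigma J `<=` measurable.
Proof.
apply: smallest_sub; first exact: sigma_algebra_measurable.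
by move=> A [i _ FiA]; exact: mF FiA.
Qed.

End Independence.

Section JointLaw.
Context d (T : measurableType d) (R : realType) (Pr : probability T R).
Context d1 (U : measurableType d1) d2 (V : measurableType d2).
Local Open Scope ereal_scope.

(** Independence makes the joint law a product measure, to which Tonelli applies. The outer integral
    stays on the sample space, so that the result reads as conditioning on [f]. *)
Lemma ge0_integral_independent (f : {RV Pr >-> U}) (g : {RV Pr >-> V})
    (F : U * V -> \bar R) :
  (forall A B, measurable A -> measurable B ->
     Pr (f @^-1` A `&` g @^-1` B) = Pr (f @^-1` A) * Pr (g @^-1` B)) ->
  measurable_fun setT F -> (forall x, 0 <= F x) ->
  \int[Pr]_w F (f w, g w) =
  \int[Pr]_w \int[distribution Pr g]_v F (f w, v).
Proof.
move=> fg mF F0.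
have mfg : measurable_fun setT (fun w => (f w, g w)).
  by apply: measurable_fun_pair.
pose H : {mfun T >-> (U * V)%type} := HB.pack (fun w => (f w, g w))
  (isMeasurableFun.Build _ _ _ _ _ mfg).
have E A : measurable A ->
    (distribution Pr f \x distribution Pr g) A = distribution Pr H A.
  apply: product_measure_unique => A' B mA mB /=.
  by rewrite -fg//.
transitivity (\int[distribution Pr H]_z F z).
  by rewrite ge0_integral_distribution.
rewrite (eq_measure_integral (distribution Pr f \x distribution Pr g)%E); last first.
  by move=> A mA _; exact/esym/E.
rewrite fubini_tonelli1//.
rewrite /fubini_F ge0_integral_distribution//.
- exact: measurable_fun_fubini_tonelli_F.
- by move=> y; apply: integral_ge0.
Qed.

End JointLaw.

Local Open Scope complex_scope.

(** * Complex random variables *)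

Section ComplexMeasurable.
Context (R : realType).

Lemma measurable_re_im : measurable_fun [set: R[i]] (@re_im R).
Proof. by move=> _ B mB; exists B. Qed.

Lemma measurable_Re : measurable_fun [set: R[i]] (@complex.Re R).
Proof. by apply: (measurableT_comp (f := fst)) measurable_re_im. Qed.

Lemma measurable_Im : measurable_fun [set: R[i]] (@complex.Im R).
Proof. by apply: (measurableT_comp (f := snd)) measurable_re_im. Qed.

Context d (T : measurableType d).
Implicit Types f g : T -> R[i].

Lemma measurable_fun_complex f :
  measurable_fun setT (fun w => complex.Re (f w)) ->
  measurable_fun setT (fun w => complex.Im (f w)) ->
  measurable_fun setT f.
Proof.
move=> mr mi _ _ [B mB <-].
have mf : measurable_fun setT (fun w => re_im (f w)) by exact: measurable_fun_pair.
rewrite setTI.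
rewrite (_ : _ @^-1` _ = (fun w => re_im (f w)) @^-1` B); last first.
  by apply/seteqP; split => w /=; [case|].
by rewrite -[X in measurable X]setTI; exact: mf.
Qed.

Lemma measurable_fun_Re f : measurable_fun setT f ->
  measurable_fun setT (fun w => complex.Re (f w)).
Proof. by move=> mf; exact: (measurableT_comp measurable_Re mf). Qed.

Lemma measurable_fun_Im f : measurable_fun setT f ->
  measurable_fun setT (fun w => complex.Im (f w)).
Proof. by move=> mf; exact: (measurableT_comp measurable_Im mf). Qed.

Lemma ReD (x y : R[i]) : complex.Re (x + y) = complex.Re x + complex.Re y.
Proof. by case: x => a b; case: y. Qed.

Lemma ImD (x y : R[i]) : complex.Im (x + y) = complex.Im x + complex.Im y.
Proof. by case: x => a b; case: y. Qed.

Lemma ReM (x y : R[i]) : complex.Re (x * y) =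
  complex.Re x * complex.Re y - complex.Im x * complex.Im y.
Proof. by case: x => a b; case: y. Qed.

Lemma ImM (x y : R[i]) : complex.Im (x * y) =
  complex.Re x * complex.Im y + complex.Im x * complex.Re y.
Proof. by case: x => a b; case: y. Qed.

Lemma measurable_funDC f g : measurable_fun setT f -> measurable_fun setT g ->
  measurable_fun setT (fun w => f w + g w).
Proof.
move=> mf mg; apply: measurable_fun_complex.
  under eq_fun do rewrite ReD.
  by apply: measurable_funD; exact: measurable_fun_Re.
under eq_fun do rewrite ImD.
by apply: measurable_funD; exact: measurable_fun_Im.
Qed.

Lemma measurable_funMC f g : measurable_fun setT f -> measurable_fun setT g ->
  measurable_fun setT (fun w => f w * g w).
Proof.
move=> mf mg; apply: measurable_fun_complex.
  under eq_fun do rewrite ReM.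
  apply: measurable_funB; apply: measurable_funM;
    by [exact: measurable_fun_Re|exact: measurable_fun_Im].
under eq_fun do rewrite ImM.
apply: measurable_funD; apply: measurable_funM;
  by [exact: measurable_fun_Re|exact: measurable_fun_Im].
Qed.

Lemma measurable_funNC f : measurable_fun setT f ->
  measurable_fun setT (fun w => - f w).
Proof.
move=> mf; under eq_fun do rewrite -mulN1r.
exact: measurable_funMC.
Qed.

Lemma measurable_sqmodC f : measurable_fun setT f ->
  measurable_fun setT (fun w => sqmodC (f w)).
Proof.
move=> mf; apply: measurable_funD; apply: measurable_funX.
  exact: measurable_fun_Re.
exact: measurable_fun_Im.
Qed.

Lemma measurable_tnthC d' (U : measurableType d') n (i : 'I_n)
    (f : T -> n.-tuple U) :
  measurable_fun setT f -> measurable_fun setT (fun w => tnth (f w) i).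
Proof. by move=> /measurable_fun_tnthP mf; exact: mf. Qed.

Lemma measurable_dotC (f g : T -> vec2 R) :
  measurable_fun setT f -> measurable_fun setT g ->
  measurable_fun setT (fun w => dotC (f w) (g w)).
Proof.
move=> mf mg; rewrite /dotC; under eq_fun do rewrite !big_ord_recl big_ord0 addr0.
by apply: measurable_funDC; apply: measurable_funMC; exact: measurable_tnthC.
Qed.

Lemma measurable_sqnormC (f : T -> vec2 R) :
  measurable_fun setT f -> measurable_fun setT (fun w => sqnormC (f w)).
Proof.
move=> mf; apply: measurable_sum => i.
by apply: measurable_sqmodC; exact: measurable_tnthC.
Qed.

End ComplexMeasurable.

(** * Affine substitution on the real line *)

Section AffineLebesgue.
Context (R : realType).
Local Notation mu := (@lebesgue_measure R).
Local Notation mR := (measurableTypeR R).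
Local Open Scope ereal_scope.

Lemma measurable_affine (a b : R) :
  measurable_fun [set: R] (fun x : R => (a * x + b)%R).
Proof. by apply: measurable_funD => //; exact: measurable_funM. Qed.

Lemma measurable_affineR (a b : R) :
  measurable_fun [set: mR] (fun x : mR => (a * x + b)%R : mR).
Proof. exact: measurable_affine. Qed.

(** The rescaled image measure gives half-open intervals their length, which characterizes Lebesgue
    measure. A negative slope moves the closed end of the interval, hence the two cases. *)
Lemma lebesgue_measure_affine (a b : R) : a != 0%R ->
  forall A, measurable A ->
  mu A = `|a|%:E * mu ((fun x => (a * x + b)%R) @^-1` A).
Proof.
move=> a0.
pose k := NngNum (normr_ge0 a).
pose m := mscale k
  (measure_function_pushforward__canonical__measure_function_Measure
     mu (measurable_affineR a b)).
have na : (0 < `|a|)%R by rewrite normr_gt0.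
apply: (@lebesgue_measure_unique _ m) => X /ocitvP[->|[[x y] /= xy ->]].
  by rewrite !measure0.
rewrite /m /mscale/= /pushforward/=.
rewrite lebesgue_measure_itv/= lte_fin xy.
case: (ltrgt0P a) a0 => // a0 _.
  rewrite (_ : _ @^-1` _ = [set` `](x - b) / a, (y - b) / a]%R])%classic; last first.
    apply/seteqP; split => z /=; rewrite !in_itv/= ltr_pdivrMr// ler_pdivlMr//;
      lra.
  rewrite lebesgue_measure_itv/= lte_fin ltr_pM2r ?invr_gt0// ltrD2r xy.
  rewrite -!EFinB -EFinM; congr EFin; field; lra.
rewrite (_ : _ @^-1` _ = [set` `[(y - b) / a, (x - b) / a[%R])%classic; last first.
  by apply/seteqP; split => z /=; rewrite !in_itv/= ltr_ndivlMr// ler_ndivrMr//;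
    lra.
rewrite lebesgue_measure_itv/= lte_fin ltr_nM2r ?invr_lt0// ltrD2r xy.
rewrite -!EFinB -EFinM; congr EFin; field; lra.
Qed.

Lemma ge0_integral_affine (a b : R) (F : R -> \bar R) : a != 0%R ->
  measurable_fun setT F -> (forall x, 0 <= F x) ->
  \int[mu]_x F (a * x + b)%R = `|a|^-1%:E * \int[mu]_x F x.
Proof.
move=> a0 mF F0.
pose k := NngNum (normr_ge0 a).
pose m := mscale k
  (measure_function_pushforward__canonical__measure_function_Measure
     mu (measurable_affineR a b)).
have -> : \int[mu]_x F x = \int[m]_x F x.
  by apply: eq_measure_integral => A mA _; exact: lebesgue_measure_affine.
rewrite ge0_integral_mscale// ge0_integral_pushforward//=.
  by rewrite muleA -EFinM mulVf ?normr_eq0// mul1e.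
exact: measurable_affineR.
Qed.

End AffineLebesgue.

(** * Integration over the complex plane *)

Section ComplexLebesgue.
Context (R : realType).
Local Notation mu := (@lebesgue_measure R).
Local Notation mR := (measurableTypeR R).
Local Open Scope ereal_scope.

(** Planar Lebesgue integral, written as an iterated integral so that one-dimensional substitutions
    apply to each coordinate. *)
Definition integralC (F : R[i] -> \bar R) : \bar R :=
  \int[mu]_x \int[mu]_y F (x +i* y).

Lemma measurable_Complex d (T : measurableType d) (f g : T -> R) :
  measurable_fun setT f -> measurable_fun setT g ->
  measurable_fun setT (fun w => f w +i* g w).
Proof. by move=> mf mg; exact: measurable_fun_complex. Qed.

Section Change.
Variable F : R[i] -> \bar R.
Hypothesis mF : measurable_fun setT F.
Hypothesis F0 : forall z, 0 <= F z.

Let mF2 d (T : measurableType d) (f g : T -> R) :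
  measurable_fun setT f -> measurable_fun setT g ->
  measurable_fun setT (fun w => F (f w +i* g w)).
Proof.
by move=> mf mg; apply: (measurableT_comp mF); exact: measurable_Complex.
Qed.

Lemma integralC_swap :
  integralC F = \int[mu]_y \int[mu]_x F (x +i* y).
Proof.
rewrite /integralC.
by apply: (@fubini_tonelli _ _ mR mR R mu mu (fun p => F (p.1 +i* p.2))) => // ; exact: mF2.
Qed.

Lemma measurable_int_im d (T : measurableType d) (f : T -> R) :
  measurable_fun setT f ->
  measurable_fun setT (fun w => \int[mu]_y F (f w +i* y)).
Proof.
move=> mf.
apply: (@measurable_fun_fubini_tonelli_F _ _ T mR R mu (fun p => F (f p.1 +i* p.2))) => //.
apply: mF2 => //.
exact: measurableT_comp.
Qed.

(* The map (x, y) |-> (a x - b y, b x + a y) is a shear in x followed by a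
   shear and scalings in each coordinate. *)
Lemma integralC_affine_Re (a b c e : R) : a != 0%R ->
  \int[mu]_y \int[mu]_x F ((a * x - b * y + c) +i* (b * x + a * y + e))%R
  = (a ^+ 2 + b ^+ 2)^-1%:E * integralC F.
Proof.
move=> a0.
have ab0 : (0 < a ^+ 2 + b ^+ 2)%R.
  by rewrite ltr_pwDl ?sqr_ge0// exprn_even_gt0.
(* Taking x - (b / a) y as new variable removes y from the real part and leaves it with coefficient
   [D] in the imaginary part; a * D is the determinant. *)
pose D := ((a ^+ 2 + b ^+ 2) / a)%R.
have D0 : D != 0%R by rewrite mulf_neq0 ?invr_eq0// gt_eqF.
transitivity (\int[mu]_y \int[mu]_x F ((a * x + c) +i* (b * x + e + D * y))%R).
  apply: eq_integral => y _.
  pose G x := F ((a * x + c) +i* (b * x + e + D * y))%R.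
  transitivity (\int[mu]_x G (1 * x + (- (b / a * y)))%R).
    apply: eq_integral => x _; rewrite /G /D; congr F; congr (_ +i* _);
      by field.
  have mG : measurable_fun setT G.
    by apply: mF2; repeat (apply: measurable_funD => //); apply: measurable_funM.
  by rewrite (ge0_integral_affine _ (oner_neq0 _) mG (fun=> F0 _)) normr1 invr1 mul1e.
rewrite -(@fubini_tonelli _ _ mR mR R mu mu (fun p => F ((a * p.1 + c) +i* (b * p.1 + e + D * p.2))%R))//=; last first.
  by apply: mF2; repeat (apply: measurable_funD => //); apply: measurable_funM.
transitivity (\int[mu]_x (`|D|^-1%:E * \int[mu]_y F ((a * x + c)%R +i* y))).
  apply: eq_integral => x _.
  rewrite -(@ge0_integral_affine _ D (b * x + e)%R (fun y => F (_ +i* y)))//.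
    by apply: eq_integral => y _; congr F; congr (_ +i* _); rewrite addrC.
  exact: mF2.
pose H x := \int[mu]_y F (x +i* y).
have mH : measurable_fun [set: mR] H by exact: measurable_int_im.
have H0 x : 0 <= H x by apply: integral_ge0 => y _; exact: F0.
under eq_integral do rewrite -/(H _).
rewrite ge0_integralZl.
- rewrite (ge0_integral_affine _ a0 mH H0) muleA -EFinM; congr (_%:E * _).
  rewrite /D normrM normfV invfM invrK ger0_norm ?ltW//.
  by rewrite -mulrA divff ?normr_eq0// mulr1.
- exact: measurableT.
- by apply: (measurableT_comp mH); exact: measurable_affineR.
- by move=> x _; exact: H0.
- by rewrite lee_fin invr_ge0.
Qed.

End Change.

(** Multiplication by [a] has Jacobian |a|^2. The decomposition into shears divides by the real part
    of [a]; when that part vanishes, the map exchanges the two coordinates up to scaling and is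
    treated directly. *)
Lemma integralC_affine (F : R[i] -> \bar R) (a b : R[i]) :
  measurable_fun setT F -> (forall z, 0 <= F z) -> a != 0%R ->
  integralC (fun z => F (a * z + b)%R) = (sqmodC a)^-1%:E * integralC F.
Proof.
move=> mF F0 a0.
have mG : measurable_fun setT (fun z => F (a * z + b)%R).
  apply: measurableT_comp; first exact: mF.
  by apply: measurable_funDC => //; exact: measurable_funMC.
have E x y : F (a * (x +i* y) + b)%R =
    F ((complex.Re a * x - complex.Im a * y + complex.Re b) +i*
       (complex.Im a * x + complex.Re a * y + complex.Im b))%R.
  congr F; apply/eqP; rewrite eq_complex !ReD !ReM !ImD !ImM/=.
  by apply/andP; split; apply/eqP; ring.
have [ra|ra] := eqVneq (complex.Re a) 0%R; last first.
  rewrite (integralC_swap mG (fun=> F0 _)).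
  rewrite -(integralC_affine_Re mF F0 (complex.Im a) (complex.Re b) (complex.Im b) ra).
  by apply: eq_integral => y _; apply: eq_integral => x _; exact: E.
have ia : complex.Im a != 0%R.
  by apply: contra a0 => /eqP ia; rewrite eq_complex ra ia/= !eqxx.
have ia' : (- complex.Im a)%R != 0%R by rewrite oppr_eq0.
pose H x := \int[mu]_y F (y +i* x).
have mH : measurable_fun [set: mR] H.
  apply: (@measurable_fun_fubini_tonelli_F _ _ mR mR R mu (fun p => F (p.2 +i* p.1))).
    by apply: (measurableT_comp mF); apply: measurable_Complex.
  by move=> ?; exact: F0.
have H0 x : 0 <= H x by apply: integral_ge0 => y _; exact: F0.
transitivity (\int[mu]_x (`|complex.Im a|^-1%:E * H (complex.Im a * x + complex.Im b)%R)).
  apply: eq_integral => x _.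
  have mK : measurable_fun setT (fun y => F (y +i* (complex.Im a * x + complex.Im b)%R)).
    by apply: (measurableT_comp mF); apply: measurable_Complex.
  rewrite -normrN /H -(ge0_integral_affine (complex.Re b) ia' mK (fun=> F0 _)).
  by apply: eq_integral => y _; rewrite E ra !mul0r addr0 mulNr add0r.
rewrite ge0_integralZl.
- rewrite (ge0_integral_affine _ ia mH H0).
  rewrite -(integralC_swap mF F0) muleA -EFinM; congr (_%:E * _).
  by rewrite /sqmodC ra expr0n/= add0r -invfM -expr2 real_normK// num_real.
- exact: measurableT.
- by apply: (measurableT_comp mH); exact: measurable_affineR.
- by move=> x _; exact: H0.
- by rewrite lee_fin invr_ge0.
Qed.

End ComplexLebesgue.

(** * Bounds on Gaussian densities and moments *)

Section GaussianDensity.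
Context (R : realType).
Local Notation mu := (@lebesgue_measure R).
Local Notation mR := (measurableTypeR R).
Local Open Scope ereal_scope.

Lemma normal_prob_le (s : R) (A : set R) : s != 0%R -> measurable A ->
  normal_prob 0 s A <= (normal_peak s)%:E * mu A.
Proof.
move=> s0 mA; rewrite /normal_prob -integral_cst//.
apply: ge0_le_integral => //.
- by move=> x _; rewrite lee_fin normal_pdf_ge0.
- by apply/measurable_funTS/measurable_EFinP; exact: measurable_normal_pdf.
- by move=> x _; rewrite lee_fin normal_pdf_ub.
Qed.

Lemma ge0_integral_normal_le (s : R) (F : R -> \bar R) : s != 0%R ->
  measurable_fun setT F -> (forall x, 0 <= F x) ->
  \int[normal_prob 0 s]_x F x <= (normal_peak s)%:E * \int[mu]_x F x.
Proof.
move=> s0 mF F0.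
pose k := NngNum (normal_peak_ge0 s).
rewrite -(ge0_integral_mscale mu measurableT k)//.
apply: ge0_le_measure_integral => // A mA.
exact: normal_prob_le.
Qed.

Context d (T : measurableType d) (Pr : probability T R).

Lemma circular_gaussian_integral (v : R) (X : {RV Pr >-> R[i]})
    (F : R[i] -> \bar R) :
  circular_gaussian Pr v X ->
  measurable_fun setT F -> (forall z, 0 <= F z) ->
  \int[Pr]_w F (X w) = \int[normal_prob 0 (Num.sqrt (v / 2))]_x
     \int[normal_prob 0 (Num.sqrt (v / 2))]_y F (x +i* y).
Proof.
move=> gX mF F0.
pose g := normal_prob 0 (Num.sqrt (v / 2)).
have mre : measurable_fun setT (fun w => re_im (X w)).
  by apply: measurableT_comp => //; exact: measurable_re_im.
pose H : {mfun T >-> (mR * mR)%type} := HB.pack (fun w => re_im (X w))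
  (isMeasurableFun.Build _ _ _ (mR * mR)%type _ mre).
have mF2 : measurable_fun setT (fun p : mR * mR => F (p.1 +i* p.2)).
  by apply: (measurableT_comp mF); apply: measurable_Complex.
transitivity (\int[distribution Pr H]_p F (p.1 +i* p.2)).
  rewrite ge0_integral_distribution//.
  by apply: eq_integral => w _ /=; case: (X w).
rewrite (eq_measure_integral (g \x g)%E); last by move=> A mA _; exact: gX.
by rewrite (@fubini_tonelli1 _ _ mR mR R _ _ (fun p => F (p.1 +i* p.2))).
Qed.

(** The density is at most the product of the peaks of two normal laws of variance v / 2, which is 1
    / (pi v). *)
Lemma circular_gaussian_le (v : R) (X : {RV Pr >-> R[i]}) (F : R[i] -> \bar R) :
  circular_gaussian Pr v X -> (0 < v)%R ->
  measurable_fun setT F -> (forall z, 0 <= F z) ->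
  \int[Pr]_w F (X w) <= (pi * v)^-1%:E * integralC F.
Proof.
move=> gX v0 mF F0; rewrite (circular_gaussian_integral gX)//.
set s := Num.sqrt (v / 2).
have s0 : s != 0%R by rewrite gt_eqF// sqrtr_gt0 divr_gt0.
have mi : measurable_fun setT (fun x => \int[mu]_y F (x +i* y)).
  exact: measurable_int_im.
apply: (@le_trans _ _ (\int[normal_prob 0 s]_x ((normal_peak s)%:E * \int[mu]_y F (x +i* y)))).
  apply: ge0_le_integral => //.
  - by move=> x _; exact: integral_ge0.
  - apply: (@measurable_fun_fubini_tonelli_F _ _ mR mR R _ (fun p => F (p.1 +i* p.2))) => //.
    by apply: (measurableT_comp mF); apply: measurable_Complex.
  - exact: measurable_funeM.
  - move=> x _; apply: ge0_integral_normal_le => //.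
    by apply: (measurableT_comp mF); apply: measurable_Complex.
rewrite ge0_integralZl//; last 2 first.
- by move=> x _; exact: integral_ge0.
- by rewrite lee_fin normal_peak_ge0.
apply: (@le_trans _ _ ((normal_peak s)%:E * ((normal_peak s)%:E * integralC F))).
  apply: lee_pmul => //.
  - by rewrite lee_fin normal_peak_ge0.
  - by apply: integral_ge0 => x _; exact: integral_ge0.
  - by apply: ge0_integral_normal_le => // x; exact: integral_ge0.
rewrite muleA -EFinM le_eqVlt; apply/orP; left; apply/eqP; congr (_%:E * _).
rewrite /normal_peak -invfM -expr2 sqr_sqrtr; last first.
  by rewrite mulrn_wge0// mulr_ge0 ?sqr_ge0 ?pi_ge0.
congr (_^-1)%R; rewrite /s sqr_sqrtr ?divr_ge0 ?ltW//.
by rewrite -mulr_natr; field.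
Qed.

Lemma circular_gaussian_affine_le (v : R) (X : {RV Pr >-> R[i]})
    (F : R[i] -> \bar R) (a b : R[i]) :
  circular_gaussian Pr v X -> (0 < v)%R -> a != 0%R ->
  measurable_fun setT F -> (forall z, 0 <= F z) ->
  \int[Pr]_w F (a * X w + b)%R <= (pi * v * sqmodC a)^-1%:E * integralC F.
Proof.
move=> gX v0 a0 mF F0.
rewrite invfM EFinM -muleA -(integralC_affine b)//.
apply: (circular_gaussian_le (F := fun z => F (a * z + b)%R) gX) => //.
apply: (measurableT_comp mF); apply: measurable_funDC => //.
exact: measurable_funMC.
Qed.

End GaussianDensity.

Section GaussianMoment.
Context (R : realType).
Local Notation mu := (@lebesgue_measure R).
Local Notation mR := (measurableTypeR R).
Local Open Scope ereal_scope.

Lemma ge0_integral_normal_prob (m s : R) (F : R -> \bar R) :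
  measurable_fun setT F -> (forall x, 0 <= F x) ->
  \int[normal_prob m s]_x F x = \int[mu]_x (F x * (normal_pdf m s x)%:E).
Proof.
move=> mF F0.
have dom := normal_prob_dominates m s.
have mp : measurable_fun [set: mR] (fun x => (normal_pdf m s x)%:E).
  by apply/measurable_EFinP; exact: measurable_normal_pdf.
have fint := @Radon_Nikodym_SigmaFinite.f_integrable _ mR R
  (normal_prob m s) mu dom.
rewrite -(@Radon_Nikodym_SigmaFinite.change_of_variables _ mR R
  (normal_prob m s) mu dom F setT F0 measurableT)//.
apply: ae_eq_integral => //.
- by apply: emeasurable_funM => //; exact: measurable_int fint.
- exact: emeasurable_funM.
- apply: ae_eqe_mul2l; apply: integral_ae_eq => // A _ mA.
  by rewrite -Radon_Nikodym_SigmaFinite.f_integral.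
Qed.

(** With u = x^2 / (4 s^2), the bound u exp(-u) <= 1 trades the factor x^2 for a doubling of the
    variance: x^2 times the density of variance s^2 is at most 8 s^2 times the density of variance 2
    s^2. The constant 8 is crude and recurs in all later moment bounds. *)
Lemma integral_normal_sqr_le (s : R) : s != 0%R ->
  \int[normal_prob 0 s]_x (x ^+ 2)%:E <= (8 * s ^+ 2)%:E.
Proof.
move=> s0.
have s2 : (0 < s ^+ 2)%R by rewrite exprn_even_gt0.
have mx2 : measurable_fun [set: R] (fun x : R => (x ^+ 2)%:E).
  by apply/measurable_EFinP; exact: measurable_funX.
rewrite ge0_integral_normal_prob//; last first.
  by move=> x; rewrite lee_fin sqr_ge0.
pose r := (Num.sqrt 2 * s)%R.
have r2 : (r ^+ 2 = 2 * s ^+ 2)%R by rewrite /r exprMn sqr_sqrtr.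
have r0 : r != 0%R by rewrite mulf_neq0// gt_eqF// sqrtr_gt0.
have sq2 : (Num.sqrt 2 <= 2 :> R)%R.
  by rewrite -[leRHS](ger0_norm (ler0n _ 2)) -sqrtr_sqr ler_sqrt; lra.
apply: (@le_trans _ _ (\int[mu]_x ((8 * s ^+ 2)%:E * (normal_pdf 0 r x)%:E))).
  apply: ge0_le_integral => //.
  - by move=> x _; rewrite mule_ge0// lee_fin ?sqr_ge0// normal_pdf_ge0.
  - apply: emeasurable_funM; first exact: mx2.
    by apply/measurable_EFinP; exact: measurable_normal_pdf.
  - apply: measurable_funeM.
    by apply/measurable_EFinP; exact: measurable_normal_pdf.
  - move=> x _; rewrite -!EFinM lee_fin !normal_pdfE// /normal_fun !subr0.
    have pk : normal_peak s = (Num.sqrt 2 * normal_peak r)%R.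
      rewrite /normal_peak r2.
      have -> : (2 * s ^+ 2 * pi *+ 2 = 2 * (s ^+ 2 * pi *+ 2))%R.
        by rewrite -mulrA mulrnAr.
      by rewrite sqrtrM// invfM mulrA divff ?mul1r// gt_eqF// sqrtr_gt0.
    rewrite pk r2.
    pose u := (x ^+ 2 / (4 * s ^+ 2))%R.
    have -> : (- x ^+ 2 / (s ^+ 2 *+ 2) = - u - u)%R.
      by rewrite /u -mulr_natr; field.
    have -> : (- x ^+ 2 / (2 * s ^+ 2 *+ 2) = - u)%R.
      by rewrite /u -mulr_natr; field.
    have -> : (x ^+ 2 = 4 * s ^+ 2 * u)%R by rewrite /u; field.
    have u0 : (0 <= u)%R by rewrite divr_ge0 ?sqr_ge0// mulr_ge0// ltW.
    rewrite expRD.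
    have ueu : (u * expR (- u) <= 1)%R.
      rewrite expRN ler_pdivrMr ?expR_gt0// mul1r.
      by apply: le_trans (expR_ge1Dx u); lra.
    set w := expR (- u) in ueu *.
    have w0 : (0 <= w)%R by exact: expR_ge0.
    have p0 := normal_peak_ge0 r.
    rewrite [leLHS](_ : _ = (4 * s ^+ 2) * Num.sqrt 2 * (u * w) * (normal_peak r * w))%R; last by ring.
    rewrite ler_wpM2r ?mulr_ge0//.
    have sq0 : (0 <= Num.sqrt 2 :> R)%R by exact: sqrtr_ge0.
    apply: (@le_trans _ _ ((4 * s ^+ 2) * Num.sqrt 2 * 1)%R).
      by rewrite ler_wpM2l// mulr_ge0// mulr_ge0// ltW.
    nra.
rewrite ge0_integralZl.
- by rewrite integral_normal_pdf mule1.
- exact: measurableT.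
- by apply/measurable_EFinP; exact: measurable_normal_pdf.
- by move=> x _; rewrite lee_fin normal_pdf_ge0.
- by rewrite lee_fin mulr_ge0// ltW.
Qed.

Context d (T : measurableType d) (Pr : probability T R).

Lemma circular_gaussian_sqmod_le (v : R) (X : {RV Pr >-> R[i]}) :
  circular_gaussian Pr v X -> (0 < v)%R ->
  \int[Pr]_w (sqmodC (X w))%:E <= (8 * v)%:E.
Proof.
move=> gX v0.
rewrite (circular_gaussian_integral (F := fun z => (sqmodC z)%:E) gX); last 2 first.
- by apply/measurable_EFinP; exact: measurable_sqmodC.
- by move=> z; rewrite lee_fin addr_ge0 ?sqr_ge0.
rewrite /sqmodC/=.
set s := Num.sqrt (v / 2).
have s0 : s != 0%R by rewrite gt_eqF// sqrtr_gt0 divr_gt0.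
have mx2 : measurable_fun [set: mR] (fun x : mR => (x ^+ 2)%:E : \bar R).
  by apply/measurable_EFinP; exact: measurable_funX.
have x20 (x : R) : 0 <= (x ^+ 2)%:E by rewrite lee_fin sqr_ge0.
have le2 := integral_normal_sqr_le s0.
have E x : \int[normal_prob 0 s]_y (x ^+ 2 + y ^+ 2)%:E <= (x ^+ 2)%:E + (8 * s ^+ 2)%:E.
  under eq_integral do rewrite EFinD.
  rewrite ge0_integralD//.
  rewrite (integral_cst _ measurableT (x ^+ 2)%:E) [X in _ * X](probability_setT (normal_prob 0 s)) mule1.
  by rewrite leeD2l.
apply: (@le_trans _ _ (\int[normal_prob 0 s]_x ((x ^+ 2)%:E + (8 * s ^+ 2)%:E))).
  apply: ge0_le_integral => //.
  - by move=> x _; apply: integral_ge0 => y _; rewrite EFinD adde_ge0.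
  - apply: (@measurable_fun_fubini_tonelli_F _ _ mR mR R _ (fun p => (p.1 ^+ 2 + p.2 ^+ 2)%:E)).
      apply/measurable_EFinP; apply: measurable_funD; apply: measurable_funX; [exact: measurable_fst|exact: measurable_snd].
    by move=> x /=; rewrite EFinD adde_ge0.
  - by apply: emeasurable_funD.
rewrite ge0_integralD//; last by move=> x _; rewrite lee_fin mulr_ge0 ?sqr_ge0.
rewrite (integral_cst _ measurableT (8 * s ^+ 2)%:E) [X in _ * X](probability_setT (normal_prob 0 s)) mule1.
apply: (le_trans (leeD2r _ le2)).
rewrite -EFinD lee_fin /s sqr_sqrtr; last by rewrite divr_ge0 ?(ltW v0).
lra.
Qed.

End GaussianMoment.

(** * The Cauchy reference law *)

Section Cauchy.
Context (R : realType).
Local Notation mu := (@lebesgue_measure R).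
Local Notation mR := (measurableTypeR R).
Local Open Scope ereal_scope.

Lemma measurable_oneDsqrV : measurable_fun [set: R] (fun x : R => (oneDsqr x)^-1%R).
Proof. by apply: continuous_measurable_fun; exact: continuous_oneDsqrV. Qed.

Lemma integral_oneDsqrV_le : \int[mu]_x (oneDsqr x)^-1%:E <= pi%:E.
Proof.
have m1 (D : set mR) : measurable_fun D (fun x : R => (oneDsqr x)^-1%:E).
  by apply/measurable_funTS/measurable_EFinP; exact: measurable_oneDsqrV.
have p0 (x : R) : 0 <= (oneDsqr x)^-1%:E.
  by rewrite lee_fin invr_ge0 addr_ge0// sqr_ge0.
rewrite -(setUv `[0%R, +oo[%classic) ge0_integral_setU//=; last 2 first.
- exact: measurableC.
- by apply/disj_set2P; rewrite setICr.
rewrite integral0y_oneDsqr setCitvr.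
have : \int[mu]_(x in `]-oo, 0%R[) (oneDsqr x)^-1%:E <= (pi / 2)%:E.
  apply: (@le_trans _ _ (\int[mu]_(x in `]-oo, 0%R]) (oneDsqr x)^-1%:E)).
    apply: ge0_subset_integral => //.
    by move=> x /=; rewrite !in_itv/=; exact: ltW.
  rewrite -integral0y_oneDsqr ge0_integration_by_substitution0//.
    rewrite le_eqVlt; apply/orP; left; apply/eqP; apply: eq_integral => x _.
    by rewrite /oneDsqr sqrrN.
  exact: (m1 setT).
move=> h; apply: (le_trans (leeD2l _ h)).
by rewrite -EFinD lee_fin; lra.
Qed.

(* Density of the product of two centered Cauchy laws of scale sqrt P. *)
Definition cauchy_density (P : R) (z : R[i]) : R :=
  ((pi ^+ 2 * P) * (1 + complex.Re z ^+ 2 / P) * (1 + complex.Im z ^+ 2 / P))^-1.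

Lemma cauchy_density_gt0 (P : R) z : (0 < P)%R -> (0 < cauchy_density P z)%R.
Proof.
move=> P0; rewrite invr_gt0 !mulr_gt0 ?exprn_gt0 ?pi_gt0//.
  by rewrite ltr_pwDl// divr_ge0 ?sqr_ge0// ltW.
by rewrite ltr_pwDl// divr_ge0 ?sqr_ge0// ltW.
Qed.

Lemma measurable_cauchy_density (P : R) : (0 < P)%R ->
  measurable_fun [set: R[i]] (cauchy_density P).
Proof.
move=> P0.
have sP0 : (Num.sqrt P != 0)%R by rewrite gt_eqF// sqrtr_gt0.
rewrite (_ : cauchy_density P = fun z : R[i] => ((pi ^+ 2 * P)^-1 *
  (oneDsqr (complex.Re z / Num.sqrt P))^-1 * (oneDsqr (complex.Im z / Num.sqrt P))^-1)%R); last first.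
  apply/funext => z; rewrite /cauchy_density /oneDsqr !invfM !exprMn exprVn.
  by rewrite sqr_sqrtr// ltW.
apply: measurable_funM; first apply: measurable_funM => //.
  apply: (measurableT_comp measurable_oneDsqrV).
  by apply: measurable_funM => //; exact: measurable_Re.
apply: (measurableT_comp measurable_oneDsqrV).
by apply: measurable_funM => //; exact: measurable_Im.
Qed.

Lemma integralC_cauchy_density_le (P : R) : (0 < P)%R ->
  integralC (fun z => (cauchy_density P z)%:E) <= 1.
Proof.
move=> P0; rewrite /integralC.
have sP0 : (0 < Num.sqrt P)%R by rewrite sqrtr_gt0.
have sP0' : (Num.sqrt P)^-1%R != 0%R by rewrite invr_neq0// gt_eqF.
pose F (x : R) := (oneDsqr x)^-1%:E.
have mF : measurable_fun setT F by apply/measurable_EFinP; exact: measurable_oneDsqrV.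
have F0 (x : R) : 0 <= F x by rewrite lee_fin invr_ge0 addr_ge0// sqr_ge0.
pose G (x : mR) := F ((Num.sqrt P)^-1 * x + 0)%R.
have mG : measurable_fun [set: mR] G.
  by apply: measurableT_comp => //; exact: measurable_affineR.
have G0 x : 0 <= G x by exact: F0.
have IG : \int[mu]_x G x <= (Num.sqrt P * pi)%:E.
  rewrite (ge0_integral_affine 0%R sP0' mF F0).
  rewrite normfV invrK ger0_norm ?sqrtr_ge0// EFinM lee_pmul2l//.
  exact: integral_oneDsqrV_le.
pose k := (pi ^+ 2 * P)^-1%:E : \bar R.
have k0 : 0 <= k by rewrite lee_fin invr_ge0 mulr_ge0 ?sqr_ge0// ltW.
rewrite (eq_integral (fun x => (k * \int[mu]_y G y) * G x)); last first.
  move=> x _; rewrite (eq_integral (fun y => (k * G x) * G y)); last first.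
    move=> y _; rewrite /cauchy_density /k /G /F /oneDsqr/= !addr0 -!EFinM; congr EFin.
    rewrite !invfM !exprMn exprVn sqr_sqrtr ?(ltW P0)//.
    by congr (_ * (1 + _)^-1 * (1 + _)^-1)%R; rewrite mulrC.
  rewrite ge0_integralZl//; last by rewrite mule_ge0.
  by rewrite muleAC.
rewrite ge0_integralZl//; last by rewrite mule_ge0// integral_ge0.
rewrite -muleA.
apply: (@le_trans _ _ (k * ((Num.sqrt P * pi)%:E * (Num.sqrt P * pi)%:E))).
  by rewrite lee_wpmul2l// lee_pmul// integral_ge0.
rewrite /k -!EFinM lee_fin le_eqVlt; apply/orP; left; apply/eqP.
rewrite mulrACA -!expr2 sqr_sqrtr ?(ltW P0)//.
by rewrite [(P * _)%R]mulrC mulVf// gt_eqF// mulr_gt0// exprn_gt0// pi_gt0.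
Qed.

End Cauchy.

(** * Sources *)

HB.instance Definition _ := gen_eqMixin source.
HB.instance Definition _ := gen_choiceMixin source.

Section Sources.
Context d (T : measurableType d) (R : realType) (Pr : probability T R)
  (lam : bool -> bool -> R) (ch : jammed_bc Pr lam).
Variables (P : R) (P0 : 0 < P) (m : user -> nat).

(** The family of [ch_indep] under a name of its own, convertible with it. *)
Definition source_class (s : source) : set (set T) :=
  match s with
  | SrcH k t => preimage_set_system setT (chH ch k t) measurable
  | SrcG k t => preimage_set_system setT (chG ch k t) measurable
  | SrcJ t i => preimage_set_system setT (fun w => tnth (chJ ch P t w) i) measurable
  | SrcS t => preimage_set_system setT (chS ch t) measurable
  | SrcN k t => preimage_set_system setT (chN ch k t) measurable
  | SrcW k => preimage_set_system setT (chW ch k (m k)) measurable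
  end.

Lemma preimage_class_measurable d' (U : measurableType d') (f : T -> U) :
  measurable_fun setT f ->
  preimage_set_system setT f measurable `<=` measurable.
Proof. by move=> mf _ [B mB <-]; exact: mf. Qed.

Lemma preimage_class_setI d' (U : measurableType d') (f : T -> U) :
  setI_closed (preimage_set_system setT f measurable).
Proof.
move=> _ _ [A mA <-] [B mB <-]; exists (A `&` B); first exact: measurableI.
by rewrite !setTI preimage_setI.
Qed.

Lemma preimage_class_setT d' (U : measurableType d') (f : T -> U) :
  preimage_set_system setT f measurable setT.
Proof. by exists setT => //; rewrite preimage_setT setIT. Qed.

Lemma measurable_chJ t i : measurable_fun setT (fun w => tnth (chJ ch P t w) i).
Proof. exact: measurable_tnthC. Qed.

Lemma source_class_measurable s : source_class s `<=` measurable.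
Proof.
by case: s => *; apply: preimage_class_measurable => //; exact: measurable_chJ.
Qed.

Lemma source_class_setI s : setI_closed (source_class s).
Proof. by case: s => *; exact: preimage_class_setI. Qed.

Lemma source_class_setT s : source_class s setT.
Proof. by case: s => *; exact: preimage_class_setT. Qed.

Lemma source_class_independent : mutually_independent Pr source_class.
Proof. exact: ch_indep. Qed.

(* A synonym of T: a function measurable on [known_sources J] is one that is
   determined by the sources in J. *)
Definition known_sources (J : set source) : Type :=
  g_sigma_algebraType (\bigcup_(s in J) source_class s).
HB.instance Definition _ J := Measurable.on (known_sources J).

Lemma measurable_known J : measurable_fun setT (id : T -> known_sources J).
Proof.
move=> _ A sA; rewrite setTI.
exact: joint_sigma_measurable source_class_measurable _ _ sA.
Qed.

Lemma measurable_known_sub d' (U : measurableType d') (J K : set source)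
    (f : T -> U) : J `<=` K ->
  measurable_fun (setT : set (known_sources J)) f ->
  measurable_fun (setT : set (known_sources K)) f.
Proof.
move=> JK mf mT B mB; have := mf measurableT _ mB.
apply: sub_smallest2r; first exact: smallest_sigma_algebra.
by move=> A [s Js sA]; exists s => //; exact: JK.
Qed.

Lemma measurable_from_known d' (U : measurableType d') (J : set source)
    (f : T -> U) :
  measurable_fun (setT : set (known_sources J)) f -> measurable_fun setT f.
Proof. by move=> mf; exact: (measurableT_comp mf (@measurable_known J)). Qed.

Lemma measurable_known_source d' (U : measurableType d') (J : set source) s
    (f : T -> U) : J s ->
  preimage_set_system setT f measurable `<=` source_class s ->
  measurable_fun (setT : set (known_sources J)) f.
Proof.
move=> Js fs mT B mB; apply: sub_sigma_algebra; exists s => //.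
by apply: fs; exists B.
Qed.

Lemma measurable_known_chH J k t : J (SrcH k t) ->
  measurable_fun (setT : set (known_sources J)) (chH ch k t).
Proof. by move=> Js; apply: measurable_known_source Js _. Qed.

Lemma measurable_known_chG J k t : J (SrcG k t) ->
  measurable_fun (setT : set (known_sources J)) (chG ch k t).
Proof. by move=> Js; apply: measurable_known_source Js _. Qed.

Lemma measurable_known_chS J t : J (SrcS t) ->
  measurable_fun (setT : set (known_sources J)) (chS ch t).
Proof. by move=> Js; apply: measurable_known_source Js _. Qed.

Lemma measurable_known_chN J k t : J (SrcN k t) ->
  measurable_fun (setT : set (known_sources J)) (chN ch k t).
Proof. by move=> Js; apply: measurable_known_source Js _. Qed.

Lemma measurable_known_chJ J t i : J (SrcJ t i) ->
  measurable_fun (setT : set (known_sources J)) (fun w => tnth (chJ ch P t w) i).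
Proof. by move=> Js; apply: measurable_known_source Js _. Qed.

Lemma measurable_known_chW J k : J (SrcW k) ->
  measurable_fun (setT : set (known_sources J)) (chW ch k (m k)).
Proof. by move=> Js; apply: measurable_known_source Js _. Qed.

Lemma independent_known_sources (J K : set source) (A B : set T) :
  [disjoint J & K] ->
  measurable (A : set (known_sources J)) ->
  measurable (B : set (known_sources K)) ->
  (Pr (A `&` B) = Pr A * Pr B)%E.
Proof.
move=> JK mA mB.
exact: (independent_joint_sigma source_class_measurable source_class_setI
  source_class_setT source_class_independent JK).
Qed.

(** Conditioning on the sources in [J]: since [F] sees the sample point only through them, [X] may
    be replaced by an independent copy. The first random variable is the identity from [T] to
    [known_sources J]. *)
Lemma ge0_integral_known d' (U : measurableType d') (X : {RV Pr >-> U})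
    (J : set source) s (F : known_sources J * U -> \bar R) :
  preimage_set_system setT X measurable `<=` source_class s -> ~ J s ->
  measurable_fun setT F -> (forall x, 0 <= F x)%E ->
  (\int[Pr]_w F (w, X w) = \int[Pr]_w \int[Pr]_v F (w, X v))%E.
Proof.
move=> Xs Js mF F0.
pose V : {mfun T >-> known_sources J} :=
  HB.pack (id : T -> known_sources J) (isMeasurableFun.Build _ _ _ _ _ (@measurable_known J)).
rewrite (ge0_integral_independent (f := V) (g := X) (F := F))//.
  apply: eq_integral => w _; rewrite ge0_integral_distribution//.
  by apply: (measurableT_comp mF); exact: measurable_fun_pair.
move=> A B mA mB.
apply: (@independent_known_sources J [set s]) => //.
  by apply/disj_set2P; apply/seteqP; split => x //= [Jx xs]; apply: Js; rewrite -xs.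
apply: sub_sigma_algebra; exists s => //; apply: Xs.
by exists B => //; rewrite setTI.
Qed.

End Sources.

(** * Change of measure *)

Lemma measurable_comp2 d (T : measurableType d) d1 (U : measurableType d1)
    d2 (V : measurableType d2) d3 (W : measurableType d3) (F : U -> V -> W)
    (f : T -> U) (g : T -> V) :
  measurable_fun setT (fun p : U * V => F p.1 p.2) ->
  measurable_fun setT f -> measurable_fun setT g ->
  measurable_fun setT (fun w => F (f w) (g w)).
Proof.
move=> mF mf mg.
exact: (measurableT_comp mF (measurable_fun_pair mf mg)).
Qed.

Section IntegralCMeasurable.
Context d (T : measurableType d) (R : realType).
Local Notation mu := (@lebesgue_measure R).
Local Notation mR := (measurableTypeR R).

Lemma measurable_integralC (F : T -> R[i] -> \bar R) :
  measurable_fun setT (fun p : T * R[i] => F p.1 p.2) ->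
  (forall w z, 0 <= F w z)%E ->
  measurable_fun setT (fun w => integralC (F w)).
Proof.
move=> mF F0.
apply: (@measurable_fun_fubini_tonelli_F _ _ T mR R mu
  (fun p => \int[mu]_y F p.1 (p.2 +i* y))%E); last first.
  by move=> p; apply: integral_ge0.
apply: (@measurable_fun_fubini_tonelli_F _ _ (T * mR)%type mR R mu
  (fun p => F p.1.1 (p.1.2 +i* p.2))%E) => //.
apply: (measurable_comp2 mF); first exact: measurableT_comp.
apply: measurable_fun_complex => /=.
  exact: (measurableT_comp measurable_snd measurable_fst).
exact: measurable_snd.
Qed.

Lemma integralC_tonelli (Pr : probability T R) (F : T -> R[i] -> \bar R) :
  measurable_fun setT (fun p : T * R[i] => F p.1 p.2) ->
  (forall w z, 0 <= F w z)%E ->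
  (\int[Pr]_w integralC (F w) = integralC (fun z => \int[Pr]_w F w z))%E.
Proof.
move=> mF F0; rewrite /integralC.
have mF3 : measurable_fun [set: T * mR * mR] (fun p => F p.1.1 (p.1.2 +i* p.2)).
  apply: (measurable_comp2 mF); first exact: measurableT_comp.
  apply: measurable_fun_complex => /=.
    exact: (measurableT_comp measurable_snd measurable_fst).
  exact: measurable_snd.
rewrite (@fubini_tonelli _ _ T mR R Pr mu (fun p => \int[mu]_y F p.1 (p.2 +i* y))%E); last 2 first.
- exact: (@measurable_fun_fubini_tonelli_F _ _ (T * mR)%type mR R mu
    (fun p => F p.1.1 (p.1.2 +i* p.2))%E).
- by move=> p; exact: integral_ge0.
apply: eq_integral => x _.
rewrite (@fubini_tonelli _ _ T mR R Pr mu (fun p => F p.1 (x +i* p.2))%E)//.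
apply: (measurable_comp2 mF) => //.
by apply: measurable_fun_complex => //=; exact: measurable_snd.
Qed.

End IntegralCMeasurable.

(** * Conditional density of one output *)

Section DensityStep.
Context d (T : measurableType d) (R : realType) (Pr : probability T R)
  (lam : bool -> bool -> R) (ch : jammed_bc Pr lam).
Variables (P : R) (P0 : 0 < P) (m : user -> nat).
Local Notation known := (known_sources ch P m).
Local Open Scope ereal_scope.

(** Given the sources in [J], only [X] is random, and on [B] the variable [a * X + b] has density at
    most 1 / (pi v |a|^2), hence at most 1 / [kappa]. The event [B] has to be decided by [J] for
    this conditioning to make sense. *)
Lemma density_step (J : set source) s (X : {RV Pr >-> R[i]}) (v : R)
    (a b : T -> R[i]) (B : T -> bool) (kappa : R) (F : T -> R[i] -> \bar R) :
  preimage_set_system setT X measurable `<=` source_class ch P m s -> ~ J s ->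
  circular_gaussian Pr v X -> (0 < v)%R ->
  measurable_fun (setT : set (known J)) a ->
  measurable_fun (setT : set (known J)) b ->
  measurable_fun (setT : set (known J)) B ->
  measurable_fun setT (fun p : known J * R[i] => F p.1 p.2) ->
  (forall w z, 0 <= F w z) -> (0 <= kappa)%R ->
  (forall w, B w -> a w != 0 /\ kappa <= pi * v * sqmodC (a w))%R ->
  \int[Pr]_w (if B w then kappa%:E * F w (a w * X w + b w)%R else 0) <=
  \int[Pr]_w (if B w then integralC (F w) else 0).
Proof.
move=> Xs Js gX v0 ma mb mB mF F0 k0 Ba.
pose G (p : known J * R[i]) : \bar R :=
  if B p.1 then kappa%:E * F p.1 (a p.1 * p.2 + b p.1)%R else 0.
have G0 p : 0 <= G p by rewrite /G; case: ifP => // _; rewrite mule_ge0.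
have mG : measurable_fun setT G.
  apply: measurable_fun_ifT => //; first exact: (measurableT_comp mB).
  apply: measurable_funeM; apply: (measurable_comp2 mF) => //.
  apply: measurable_funDC.
    by apply: measurable_funMC => //; exact: (measurableT_comp ma).
  exact: (measurableT_comp mb).
rewrite (ge0_integral_known P0 Xs Js mG)//.
apply: ge0_le_integral => //.
- by move=> w _; exact: integral_ge0.
- apply: (@measurable_from_known _ _ _ _ _ ch P m _ _ J).
  rewrite (_ : (fun _ => _) = fun w => \int[distribution Pr X]_v G (w, v)).
    exact: measurable_fun_fubini_tonelli_F.
  apply/funext => w; rewrite ge0_integral_distribution//.
  by apply: (measurableT_comp mG); exact: measurable_fun_pair.
- apply: (@measurable_from_known _ _ _ _ _ ch P m _ _ J).
  by apply: measurable_fun_ifT => //; exact: measurable_integralC.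
- move=> w _; rewrite /G/=; case: ifPn => [Bw|_]; last by rewrite integral0.
  have [aw0 kw] := Ba _ Bw.
  have mFw : measurable_fun setT (F w).
    exact: (measurable_comp2 (U := known J) (f := fun=> w) mF).
  have mFX : measurable_fun setT (fun x => F w (a w * X x + b w)%R).
    apply: (measurableT_comp mFw); apply: measurable_funDC => //.
    exact: measurable_funMC.
  rewrite ge0_integralZl//.
  have := circular_gaussian_affine_le (b w) gX v0 aw0 mFw (F0 w).
  have sq0 : (0 < pi * v * sqmodC (a w))%R.
    rewrite !mulr_gt0 ?pi_gt0// lt_neqAle addr_ge0 ?sqr_ge0// andbT.
    apply: contra aw0 => /eqP/esym/eqP; rewrite /sqmodC paddr_eq0 ?sqr_ge0//.
    by rewrite !sqrf_eq0 eq_complex.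
  rewrite lee_pdivlMl//.
  apply: le_trans; apply: lee_wpmul2r; last by rewrite lee_fin.
  exact: integral_ge0.
Qed.

End DensityStep.

Lemma dotCE (R : realType) (h x : vec2 R) :
  dotC h x = tnth h ord0 * tnth x ord0 + tnth h ord_max * tnth x ord_max.
Proof.
rewrite /dotC !big_ord_recl big_ord0 addr0.
by rewrite (_ : lift ord0 ord0 = ord_max)//; exact/val_inj.
Qed.

Lemma measurable_natC d (T : measurableType d) (R : realType) (b : T -> bool) :
  measurable_fun setT b -> measurable_fun setT (fun w => (b w)%:R : R[i]).
Proof.
move=> mb; rewrite (_ : (fun _ => _) = fun w => if b w then 1 else 0 : R[i]).
  exact: measurable_fun_ifT.
by apply/funext => w; case: (b w).
Qed.

Lemma measurable_dotC_tnth d (T : measurableType d) (R : realType)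
    (f g : T -> vec2 R) :
  (forall i, measurable_fun setT (fun w => tnth (f w) i)) ->
  (forall i, measurable_fun setT (fun w => tnth (g w) i)) ->
  measurable_fun setT (fun w => dotC (f w) (g w)).
Proof.
move=> mf mg; under eq_fun do rewrite dotCE.
by apply: measurable_funDC; exact: measurable_funMC.
Qed.

Lemma measurable_mktuple d (T : measurableType d) d' (U : measurableType d')
    n (f : 'I_n -> T -> U) :
  (forall i, measurable_fun setT (f i)) ->
  measurable_fun setT (fun w => [tuple f i w | i < n]).
Proof.
move=> mf; apply/measurable_fun_tnthP => i.
by rewrite (_ : _ \o _ = f i)//; apply/funext => w; rewrite /= tnth_mktuple.
Qed.

Section IntegralCTheory.
Context (R : realType).
Local Notation mu := (@lebesgue_measure R).
Local Open Scope ereal_scope.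
Implicit Types F G : R[i] -> \bar R.

Let measurable_line F (x : R) : measurable_fun setT F ->
  measurable_fun setT (fun y : measurableTypeR R => F (x +i* y)).
Proof.
by move=> mF; apply: (measurableT_comp mF); apply: measurable_Complex.
Qed.

Lemma integralC_le F G : measurable_fun setT F -> (forall z, 0 <= F z) ->
  measurable_fun setT G -> (forall z, F z <= G z) ->
  integralC F <= integralC G.
Proof.
move=> mF F0 mG FG.
have G0 z : 0 <= G z by exact: le_trans (FG z).
apply: ge0_le_integral => //.
- by move=> x _; exact: integral_ge0.
- exact: measurable_int_im.
- exact: measurable_int_im.
- move=> x _; apply: ge0_le_integral => //; exact: measurable_line.
Qed.

Lemma integralCZl (r : R) F : measurable_fun setT F -> (forall z, 0 <= F z) ->
  (0 <= r)%R -> integralC (fun z => r%:E * F z) = r%:E * integralC F.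
Proof.
move=> mF F0 r0; rewrite /integralC -ge0_integralZl//.
- apply: eq_integral => x _; rewrite ge0_integralZl//; exact: measurable_line.
- exact: measurable_int_im.
- by move=> x _; exact: integral_ge0.
Qed.

End IntegralCTheory.

(** * Exchanging the outputs one at a time *)

Section Hybrid.
Context d (T : measurableType d) (R : realType) (Pr : probability T R)
  (lam : bool -> bool -> R) (ch : jammed_bc Pr lam).
Variables (P : R) (P0 : 0 < P) (m : user -> nat).
Local Notation known := (known_sources ch P m).

(** An upper bound on the transmitter's knowledge that covers every configuration: the whole of [H]
    and [S], future included, and the messages. *)
Definition transmitter_sources : set source :=
  [set s | match s with SrcH _ _ | SrcS _ | SrcW _ => True | _ => False end].

Lemma measurable_known_id (J K : set source) : J `<=` K ->
  measurable_fun setT (id : known K -> known J).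
Proof.
move=> JK _ A; rewrite setTI; move: A.
apply: sub_smallest2r; first exact: smallest_sigma_algebra.
by move=> A [s Js sA]; exists s => //; exact: JK.
Qed.

Lemma measurable_known_fst (J : set source) d' (U : measurableType d') :
  measurable_fun setT (fst : T * U -> known J).
Proof.
have mf : measurable_fun setT (fst : T * U -> T) by exact: measurable_fst.
exact: (measurableT_comp (@measurable_known _ T R Pr lam ch P m J) mf).
Qed.

Variables (k : user) (c : R) (c0 : 0 < c) (n : nat) (x : 'I_n -> T -> vec2 R).
Hypothesis mx : forall t,
  measurable_fun (setT : set (known transmitter_sources)) (x t).

Definition strongly_jammed (t : nat) (w : T) : bool :=
  tnth (chS ch t w) k && (c <= sqmodC (tnth (chG ch k t w) ord0)).

Definition received (t : 'I_n) (w : T) : R[i] :=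
  dotC (chH ch k t w) (x t w)
  + (tnth (chS ch t w) k)%:R * dotC (chG ch k t w) (chJ ch P t w)
  + chN ch k t w.

(* Reciprocal of an upper bound on the conditional density of the output. *)
Definition spread (t : nat) (w : T) : R :=
  if strongly_jammed t w then pi * c * P else pi.

(** A lower bound on the likelihood ratio of q to the true conditional law of the output, taken at
    the received value. *)
Definition density_ratio (t : 'I_n) (w : T) : R :=
  cauchy_density P (received t w) * spread t w.

Lemma spread_gt0 t w : 0 < spread t w.
Proof. by rewrite /spread; case: ifP => _; rewrite ?mulr_gt0 ?pi_gt0. Qed.

Lemma density_ratio_gt0 t w : 0 < density_ratio t w.
Proof. by rewrite mulr_gt0 ?cauchy_density_gt0 ?spread_gt0. Qed.

Section KnownMeasurable.
Variable J : set source.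
Hypothesis KJ : transmitter_sources `<=` J.

Let mx' t : measurable_fun (setT : set (known J)) (x t).
Proof. exact: measurable_known_sub (mx t). Qed.

Lemma measurable_known_jam t :
  measurable_fun (setT : set (known J)) (fun w => tnth (chS ch t w) k).
Proof.
by apply: measurable_tnthC; apply: measurable_known_chS; exact: KJ.
Qed.

Lemma measurable_known_hx (t : 'I_n) : measurable_fun (setT : set (known J))
  (fun w => dotC (chH ch k t w) (x t w)).
Proof.
by apply: measurable_dotC => //; apply: measurable_known_chH; exact: KJ.
Qed.

Hypothesis GJ : forall t, J (SrcG k t).

Lemma measurable_known_tnthG t i : measurable_fun (setT : set (known J))
  (fun w => tnth (chG ch k t w) i).
Proof. by apply: measurable_tnthC; exact: measurable_known_chG. Qed.

Lemma measurable_strongly_jammed t :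
  measurable_fun (setT : set (known J)) (strongly_jammed t).
Proof.
apply: measurable_and; first exact: measurable_known_jam.
by apply: measurable_fun_ler => //; apply: measurable_sqmodC; exact: measurable_known_tnthG.
Qed.

Lemma measurable_spread t : measurable_fun (setT : set (known J)) (spread t).
Proof. by apply: measurable_fun_ifT => //; exact: measurable_strongly_jammed. Qed.

Lemma measurable_received (t : 'I_n) :
  (forall i, J (SrcJ t i)) -> J (SrcN k t) ->
  measurable_fun (setT : set (known J)) (received t).
Proof.
move=> JJ JN; apply: measurable_funDC; first apply: measurable_funDC.
- exact: measurable_known_hx.
- apply: measurable_funMC; first by apply: measurable_natC; exact: measurable_known_jam.
  by apply: measurable_dotC_tnth => i;
    [exact: measurable_known_tnthG|exact: measurable_known_chJ].
- exact: measurable_known_chN.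
Qed.

Lemma measurable_density_ratio (t : 'I_n) :
  (forall i, J (SrcJ t i)) -> J (SrcN k t) ->
  measurable_fun (setT : set (known J)) (density_ratio t).
Proof.
move=> JJ JN; apply: measurable_funM; last exact: measurable_spread.
apply: (measurableT_comp (measurable_cauchy_density P0)).
exact: measurable_received.
Qed.

End KnownMeasurable.

Local Open Scope ereal_scope.

Let sJ (t : nat) := SrcJ t ord0.
Let sN (t : nat) := SrcN k t.

(** Strong jamming is decided by [S] and [G], which both conditionings retain. Where it holds, the
    output is affine in the first jammer component with coefficient [a]; elsewhere it is affine in
    the noise with coefficient 1. Hence [F] has to be independent of either source at time [t]. *)
Lemma received_step (t : 'I_n) (F : T -> R[i] -> \bar R) :
  measurable_fun setT (fun p : known [set~ sJ t] * R[i] => F p.1 p.2) ->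
  measurable_fun setT (fun p : known [set~ sN t] * R[i] => F p.1 p.2) ->
  (forall w z, 0 <= F w z) ->
  \int[Pr]_w ((spread t w)%:E * F w (received t w)) <=
  \int[Pr]_w integralC (F w).
Proof.
move=> mFJ mFN F0.
have KJ : transmitter_sources `<=` [set~ sJ t] by case.
have KN : transmitter_sources `<=` [set~ sN t] by case.
pose B w := strongly_jammed t w.
have mBJ : measurable_fun (setT : set (known [set~ sJ t])) B.
  exact: measurable_strongly_jammed.
have mBN : measurable_fun (setT : set (known [set~ sN t])) B.
  exact: measurable_strongly_jammed.
pose s w : R[i] := (tnth (chS ch t w) k)%:R.
pose g i w := tnth (chG ch k t w) i.
pose j i w := tnth (chJ ch P t w) i.
pose a w := (s w * g ord0 w)%R.
pose b w := (dotC (chH ch k t w) (x t w) + s w * (g ord_max w * j ord_max w) + chN ch k t w)%R.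
pose b' w := (dotC (chH ch k t w) (x t w) + s w * dotC (chG ch k t w) (chJ ch P t w))%R.
have YJ w : received t w = (a w * j ord0 w + b w)%R.
  have E (u s' g0 j0 g1 j1 v : R[i]) :
    (u + s' * (g0 * j0 + g1 * j1) + v = s' * g0 * j0 + (u + s' * (g1 * j1) + v))%R.
    by ring.
  by rewrite /received [dotC (chG _ _ _ _) _]dotCE; exact: E.
have YN w : received t w = (1 * chN ch k t w + b' w)%R.
  by rewrite mul1r addrC.
pose XJ : {RV Pr >-> R[i]} := HB.pack (j ord0)
  (isMeasurableFun.Build _ _ _ _ _ (@measurable_chJ _ T R Pr lam ch P t ord0)).
have ms J : transmitter_sources `<=` J -> measurable_fun (setT : set (known J)) s.
  by move=> ?; apply: measurable_natC; exact: measurable_known_jam.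
have stepJ : \int[Pr]_w (if B w then (pi * c * P)%:E * F w (received t w) else 0) <=
  \int[Pr]_w (if B w then integralC (F w) else 0).
  under eq_integral do rewrite YJ.
  apply: (@density_step _ T R Pr lam ch P P0 m [set~ sJ t] (sJ t) XJ P a b B (pi * c * P)%R F) => //.
  - by apply.
  - exact: chJ_law.
  - by apply: measurable_funMC; [exact: ms|exact: measurable_known_tnthG].
  - apply: measurable_funDC; first apply: measurable_funDC.
    + exact: measurable_known_hx.
    + apply: measurable_funMC; first exact: ms.
      apply: measurable_funMC; first exact: measurable_known_tnthG.
      by apply: measurable_known_chJ => -[].
    + exact: measurable_known_chN.
  - by rewrite !mulr_ge0 ?pi_ge0// ltW.
  - move=> w /andP[sw cg]; rewrite /a /s sw mul1r; split.
      apply/negP => /eqP gw; move: cg; rewrite -/(g ord0 w) gw.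
      by rewrite /sqmodC/= expr0n/= addr0 leNgt c0.
    by rewrite mulrAC ler_pM2l// mulr_gt0// pi_gt0.
have stepN : \int[Pr]_w (if ~~ B w then pi%:E * F w (received t w) else 0) <=
  \int[Pr]_w (if ~~ B w then integralC (F w) else 0).
  under eq_integral do rewrite YN.
  apply: (@density_step _ T R Pr lam ch P P0 m [set~ sN t] (sN t) (chN ch k t) 1%R (fun=> 1%R) b' (fun w => ~~ B w) pi F) => //.
  - by apply.
  - exact: chN_law.
  - apply: measurable_funDC; first exact: measurable_known_hx.
    apply: measurable_funMC; first exact: ms.
    by apply: measurable_dotC_tnth => i;
      [exact: measurable_known_tnthG|exact: measurable_known_chJ].
  - exact: measurable_neg.
  - by rewrite pi_ge0.
  - by move=> w _; rewrite oner_neq0 /sqmodC/= expr1n expr0n addr0 !mulr1.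
have mB := measurable_from_known mBJ.
have mFT : measurable_fun setT (fun p : T * R[i] => F p.1 p.2).
  apply: (measurable_comp2 mFJ) => //.
  exact: measurable_known_fst.
have mY : measurable_fun setT (received t).
  apply: (measurable_from_known (ch := ch) (P := P) (m := m) (J := setT)).
  exact: measurable_received.
have mI : measurable_fun setT (fun w => integralC (F w)) by exact: measurable_integralC.
have mFY : measurable_fun setT (fun w => F w (received t w)) by exact: (measurable_comp2 mFT).
have I0 w : 0 <= integralC (F w) by apply: integral_ge0 => ? _; exact: integral_ge0.
have p0 : 0 <= (pi * c * P)%:E by rewrite lee_fin !mulr_ge0 ?pi_ge0// ltW.
have q0 : 0 <= (pi : R)%:E by rewrite lee_fin pi_ge0.
rewrite (eq_integral (fun w => (if B w then (pi * c * P)%:E * F w (received t w) else 0) +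
    (if ~~ B w then pi%:E * F w (received t w) else 0))); last first.
  by move=> w _; rewrite /spread -/(B w); case: (B w); rewrite /= ?adde0 ?add0e.
rewrite ge0_integralD//; last 4 first.
- by move=> w _; case: ifP => // _; rewrite mule_ge0.
- by apply: measurable_fun_ifT => //; exact: measurable_funeM.
- by move=> w _; case: ifP => // _; rewrite mule_ge0.
- by apply: measurable_fun_ifT => //; [exact: measurable_neg|exact: measurable_funeM].
apply: (le_trans (leeD stepJ stepN)).
rewrite -ge0_integralD//; last 4 first.
- by move=> w _; case: ifP.
- exact: measurable_fun_ifT.
- by move=> w _; case: ifP.
- by apply: measurable_fun_ifT => //; exact: measurable_neg.
rewrite le_eqVlt; apply/orP; left; apply/eqP; apply: eq_integral => w _.
by case: (B w); rewrite /= ?adde0 ?add0e.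
Qed.

Definition replace_outputs (j : nat) (y : n.-tuple R[i]) (w : T) : n.-tuple R[i] :=
  [tuple (if (i < j)%N then received i w else tnth y i) | i < n].

(* Arbitrary outputs are exchanged for the received ones one at a time, each
   costing one density ratio. *)
Lemma replace_outputs_le (F : T -> n.-tuple R[i] -> \bar R) (e : R) :
  measurable_fun setT
    (fun p : known transmitter_sources * n.-tuple R[i] => F p.1 p.2) ->
  (forall w y, 0 <= F w y) -> (0 <= e)%R ->
  (forall y, \int[Pr]_w F w y <= e%:E) ->
  forall j, (j <= n)%N -> forall y,
  \int[Pr]_w (F w (replace_outputs j y w) *
    (\prod_(i < n | (i < j)%N) density_ratio i w)%:E) <= e%:E.
Proof.
move=> mF F0 e0 Fe; elim=> [_ y|j IH jn y].
  apply: le_trans (Fe y); rewrite le_eqVlt; apply/orP; left; apply/eqP.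
  apply: eq_integral => w _; rewrite big_pred0// mule1; congr F.
  by apply: eq_from_tnth => i; rewrite tnth_mktuple.
pose t := Ordinal jn.
pose upd (z : R[i]) := [tuple (if i == t then z else tnth y i) | i < n].
pose D w := (\prod_(i < n | (i < j)%N) density_ratio i w)%R.
have D0 w : (0 <= D w)%R by apply: prodr_ge0 => i _; rewrite ltW// density_ratio_gt0.
(* The integrand as a function of the output [z] at time [t], without the factor [spread], which
   [received_step] consumes. What remains is an integral of [z] against q, and for each [z] the
   induction hypothesis applies with [upd z] as the arbitrary outputs. *)
pose G w z := F w (replace_outputs j (upd z) w) * (D w)%:E * (cauchy_density P z)%:E.
have q0 z : 0 <= (cauchy_density P z)%:E by rewrite lee_fin ltW// cauchy_density_gt0.
have FD0 w z : 0 <= F w (replace_outputs j (upd z) w) * (D w)%:E.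
  by rewrite mule_ge0// lee_fin.
have G0 w z : 0 <= G w z by rewrite mule_ge0.
(* The outputs already exchanged and their ratios involve noise and jammer at times before [t] only,
   so all of this is still known when one source at time [t] is left out. *)
have mFD (J : set source) : transmitter_sources `<=` J ->
    (forall i, J (SrcG k i)) ->
    (forall i : nat, i != t -> J (sN i) /\ forall l, J (SrcJ i l)) ->
    measurable_fun setT (fun p : known J * R[i] =>
      F p.1 (replace_outputs j (upd p.2) p.1) * (D p.1)%:E).
  move=> KJ GJ NJ.
  have it (i : 'I_n) : (i < j)%N -> i != t :> nat by move=> ij; rewrite neq_ltn ij.
  apply: emeasurable_funM.
    apply: (measurable_comp2 mF).
      have mf : measurable_fun setT (fst : known J * R[i] -> known J).
        exact: measurable_fst.
      exact: (measurableT_comp (measurable_known_id KJ) mf).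
    apply: measurable_mktuple => i.
    case ij: (i < j)%N.
      have [iN iJ] := NJ _ (it _ ij).
      have mYi : measurable_fun (setT : set (known J)) (received i).
        exact: measurable_received.
      exact: (measurableT_comp mYi (measurable_fst (T1 := known J))).
    suff mupd : measurable_fun setT (fun p : known J * R[i] => upd p.2).
      exact: measurable_tnthC.
    apply: measurable_mktuple => l; case: (l == t) => //.
    exact: measurable_snd.
  apply/measurable_EFinP.
  suff mD : measurable_fun (setT : set (known J)) D.
    exact: (measurableT_comp mD (measurable_fst (T1 := known J))).
  have -> : D = fun w => (\prod_(i < n) if (i < j)%N then density_ratio i w else 1)%R.
    by apply/funext => w; rewrite /D big_mkcond.
  apply: measurable_prod => i _; case ij: (i < j)%N => //.
  have [iN iJ] := NJ _ (it _ ij).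
  exact: measurable_density_ratio.
have mG (J : set source) : transmitter_sources `<=` J ->
    (forall i, J (SrcG k i)) ->
    (forall i : nat, i != t -> J (sN i) /\ forall l, J (SrcJ i l)) ->
    measurable_fun setT (fun p : known J * R[i] => G p.1 p.2).
  move=> KJ GJ NJ; apply: emeasurable_funM; first exact: mFD.
  apply/measurable_EFinP; apply: (measurableT_comp (measurable_cauchy_density P0)).
  exact: measurable_snd.
have mGJ : measurable_fun setT (fun p : known [set~ sJ t] * R[i] => G p.1 p.2).
  apply: mG => //; first by case.
  move=> i it; split => // l /=; apply/eqP; apply: contra it.
  by rewrite /sJ => /eqP[->].
have mGN : measurable_fun setT (fun p : known [set~ sN t] * R[i] => G p.1 p.2).
  apply: mG => //; first by case.
  move=> i it; split => //=; apply/eqP; apply: contra it.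
  by rewrite /sN => /eqP[->].
have mGT (H : T -> R[i] -> \bar R) :
   measurable_fun setT (fun p : known [set~ sJ t] * R[i] => H p.1 p.2) ->
   measurable_fun setT (fun p : T * R[i] => H p.1 p.2).
  move=> mH; apply: (measurable_comp2 mH) => //.
  exact: measurable_known_fst.
rewrite (eq_integral (fun w => (spread t w)%:E * G w (received t w))); last first.
  move=> w _; rewrite /G (bigD1 t)/= ?ltnSn//.
  rewrite (eq_bigl (fun i : 'I_n => i < j)%N); last first.
    by move=> i; rewrite ltnS ltn_neqAle andbC.
  rewrite -/(D w) (_ : replace_outputs j.+1 y w = replace_outputs j (upd (received t w)) w).
    rewrite /density_ratio !EFinM.
    rewrite [RHS]muleC -!muleA; congr (_ * _).
    by rewrite muleA muleC.
  apply: eq_from_tnth => i; rewrite !tnth_mktuple.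
  have [ij|ji|ij] := ltngtP i j.
  - by rewrite ltnS ltnW.
  - by rewrite ltnS leqNgt ji/= ifF//; apply/negbTE; rewrite -val_eqE/= gtn_eqF.
  - have -> : i = t by exact/val_inj.
    by rewrite ltnSn eqxx.
apply: (le_trans (received_step mGJ mGN G0)).
rewrite integralC_tonelli//; last exact: mGT.
have mq := measurable_cauchy_density P0.
apply: (@le_trans _ _ (integralC (fun z => e%:E * (cauchy_density P z)%:E))).
  apply: integralC_le => //.
  - apply: (@measurable_fun_fubini_tonelli_G _ _ T R[i] R Pr (fun p => G p.1 p.2)) => //.
      exact: mGT.
  - by move=> z; exact: integral_ge0.
  - by apply: measurable_funeM; exact/measurable_EFinP.
  - move=> z; rewrite ge0_integralZr//; last first.
      have mFDT : measurable_fun setT (fun p : T * R[i] =>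
          F p.1 (replace_outputs j (upd p.2) p.1) * (D p.1)%:E).
        apply: (mGT (fun w z => F w (replace_outputs j (upd z) w) * (D w)%:E)).
        apply: mFD => //; first by case.
        move=> i it; split => // l /=; apply/eqP; apply: contra it.
        by rewrite /sJ => /eqP[->].
      exact: (measurable_comp2 (F := fun w z => F w (replace_outputs j (upd z) w) * (D w)%:E) mFDT).
    by rewrite lee_wpmul2r// IH// ltnW.
rewrite integralCZl//; last exact/measurable_EFinP.
by rewrite -[leRHS]mule1 lee_wpmul2l// integralC_cauchy_density_le.
Qed.

End Hybrid.

(** * Change of measure for a block code *)

Section DiscreteMeasurable.
Context d (T : measurableType d).

Lemma measurable_eq_ord M (f g : T -> 'I_M.+1) :
  measurable_fun setT f -> measurable_fun setT g ->
  measurable_fun setT (fun w => f w == g w).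
Proof.
move=> mf mg; apply: (measurable_fun_bool true) => //.
rewrite (_ : _ `&` _ =
  \bigcup_(i in [set: 'I_M.+1]) (f @^-1` [set i] `&` g @^-1` [set i])).
  apply: fin_bigcup_measurable => // i _; apply: measurableI.
    by rewrite -[X in measurable X]setTI; exact: mf.
  by rewrite -[X in measurable X]setTI; exact: mg.
apply/seteqP; split => w /=; first by move=> [_ /eqP fg]; exists (f w).
by case=> i _ [] /= fi gi; split => //; rewrite fi gi eqxx.
Qed.

(** The pair of messages takes finitely many values, so a preimage is a finite union over them.
    Dependent finite functions are used to enumerate the values. *)
Lemma measurable_messages d' (U : measurableType d') (m : user -> nat)
    (W : forall k, T -> 'I_(m k).+1) (g : (forall k, 'I_(m k).+1) -> T -> U) :
  (forall k, measurable_fun setT (W k)) ->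
  (forall a, measurable_fun setT (g a)) ->
  measurable_fun setT (fun w => g (fun k => W k w) w).
Proof.
move=> mW mg _ B mB; rewrite setTI.
pose A (a : {dffun forall k : 'I_2, 'I_(m k).+1}) : set T :=
  (\bigcap_(k in [set: 'I_2]) W k @^-1` [set a k]) `&` g a @^-1` B.
rewrite (_ : _ @^-1` _ = \bigcup_(a in setT) A a).
  apply: fin_bigcup_measurable; first exact: finite_finset.
  move=> a _; apply: measurableI.
    apply: fin_bigcap_measurable => // k _.
    by rewrite -[X in measurable X]setTI; exact: mW.
  by rewrite -[X in measurable X]setTI; exact: mg.
have E w : (fun k => W k w) = (finfun (fun k => W k w) : {dffun forall k : 'I_2, 'I_(m k).+1}).
  by apply: functional_extensionality_dep => k; rewrite ffunE.
apply/seteqP; split => w /=.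
  move=> Bw; exists [ffun k => W k w] => //; split => /=; last by rewrite -E.
  by move=> k _ /=; rewrite ffunE.
move=> [a _ [Wa ga]].
rewrite (_ : (fun k => W k w) = a)//.
by apply: functional_extensionality_dep => k; exact: Wa.
Qed.

End DiscreteMeasurable.

Section CodeConverse.
Context d (T : measurableType d) (R : realType) (Pr : probability T R)
  (lam : bool -> bool -> R) (ch : jammed_bc Pr lam).
Variables (P : R) (P0 : 0 < P) (csit jsit : knowledge) (n : nat) (m : user -> nat)
  (cd : Defs.code R csit jsit n m).
Local Notation known := (known_sources ch P m).

Lemma measurable_Hhist (J : set source) l : (forall k t, J (SrcH k t)) ->
  measurable_fun (setT : set (known J)) (Hhist ch l).
Proof.
move=> JH; apply: measurable_mktuple => t; apply: measurable_mktuple => k.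
exact: measurable_known_chH.
Qed.

Lemma measurable_Shist (J : set source) l : (forall t, J (SrcS t)) ->
  measurable_fun (setT : set (known J)) (Shist ch l).
Proof.
by move=> JS; apply: measurable_mktuple => t; exact: measurable_known_chS.
Qed.

Lemma measurable_input t :
  measurable_fun (setT : set (known transmitter_sources)) (input ch cd t).
Proof.
apply: (@measurable_messages _ (known transmitter_sources) _ _ m
  (fun k => chW ch k (m k))
  (fun a w => enc cd t a (Hhist ch _ w) (Shist ch _ w))).
  by move=> k; exact: measurable_known_chW.
move=> a; apply: (measurable_comp2 (@enc_measurable _ _ _ _ _ cd t a)).
  exact: measurable_Hhist.
exact: measurable_Shist.
Qed.

Lemma measurable_dec_known (J : set source) d' (U : measurableType d') k
    (y : U -> n.-tuple R[i]) :
  (forall k t, J (SrcH k t)) -> (forall t, J (SrcS t)) ->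
  measurable_fun setT y ->
  measurable_fun setT (fun p : known J * U =>
    dec cd k (y p.2) (Hhist ch n p.1) (Shist ch n p.1)).
Proof.
move=> JH JS my.
apply: (measurable_comp2 (F := fun y hs => dec cd k y hs.1 hs.2) (@dec_measurable _ _ _ _ _ cd k)
  (f := fun p : known J * U => y p.2)
  (g := fun p : known J * U => (Hhist ch n p.1, Shist ch n p.1))).
  by apply: (measurableT_comp my); exact: measurable_snd.
have mf : measurable_fun setT (fst : known J * U -> known J) by exact: measurable_fst.
apply: measurable_fun_pair.
  exact: (measurableT_comp (@measurable_Hhist J n JH) mf).
exact: (measurableT_comp (@measurable_Shist J n JS) mf).
Qed.

Variable k : user.

Definition correct_decision (w : T) (y : n.-tuple R[i]) : bool :=
  dec cd k y (Hhist ch n w) (Shist ch n w) == chW ch k (m k) w.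

Lemma measurable_correct_decision :
  measurable_fun setT (fun p : known transmitter_sources * n.-tuple R[i] =>
    correct_decision p.1 p.2).
Proof.
apply: measurable_eq_ord.
  exact: (measurable_dec_known (y := id)).
have mW : measurable_fun (setT : set (known transmitter_sources)) (chW ch k (m k)).
  exact: measurable_known_chW.
exact: (measurableT_comp mW measurable_fst).
Qed.

Local Open Scope ereal_scope.

(** With the outputs frozen, the decision depends on [H] and [S] alone and is independent of the
    uniform message. *)
Lemma guess_prob_le (y : n.-tuple R[i]) :
  \int[Pr]_w (correct_decision w y)%:R%:E <= ((m k).+1%:R^-1)%:E.
Proof.
pose J : set source := [set s | match s with SrcH _ _ | SrcS _ => True | _ => False end].
pose dc w := dec cd k y (Hhist ch n w) (Shist ch n w).
pose F (p : known J * 'I_(m k).+1) : \bar R := (dc p.1 == p.2)%:R%:E.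
have mdc : measurable_fun (setT : set (known J)) dc.
  have mD := @measurable_dec_known J _ T k (fun=> y) (fun _ _ => I) (fun _ => I) (@measurable_cst _ _ _ _ _ _).
  have mp : measurable_fun setT (fun w : known J => (w, point : T)) by exact: measurable_fun_pair.
  exact: (measurableT_comp mD mp).
have mF : measurable_fun setT F.
  apply/measurable_EFinP.
  rewrite (_ : (fun _ => _) = fun p => if dc p.1 == p.2 then 1%R else 0%R); last first.
    by apply/funext => p; case: eqP.
  apply: measurable_fun_ifT => //; apply: measurable_eq_ord => //.
  exact: (measurableT_comp mdc measurable_fst).
rewrite (_ : \int[Pr]_w _ = \int[Pr]_w F (w, chW ch k (m k) w))//.
rewrite (ge0_integral_known P0 (s := SrcW k) (J := J))//.
rewrite (eq_integral (fun=> ((m k).+1%:R^-1)%:E)); last first.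
  move=> w _; rewrite -(@chW_law _ _ _ _ _ ch k (m k) (dc w)).
  rewrite /F/= -[X in Pr X]setIT -integral_indic//.
    apply: eq_integral => v _; congr (_%:E); rewrite indicE; congr (_%:R : R).
    by congr nat_of_bool; apply/eqP/idP => [->|]; rewrite ?inE.
  by rewrite -[X in measurable X]setTI; exact: measurable_funPT.
rewrite (integral_cst _ measurableT (((m k).+1%:R^-1)%:E)).
  by rewrite [X in _ * X]probability_setT mule1.
by move=> x; rewrite lee_fin.
Qed.

Variables (c : R) (c0 : (0 < c)%R).

Local Notation Y t := (received ch P k (input ch cd) t).
Local Notation ratio t := (density_ratio ch P k c (input ch cd) t).

Lemma measurable_from_setT d' (U : measurableType d') (f : T -> U) :
  measurable_fun (setT : set (known setT)) f -> measurable_fun setT f.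
Proof. exact: measurable_from_known. Qed.

Let mY t : measurable_fun setT (Y t).
Proof.
apply: measurable_from_setT; apply: measurable_received => //.
exact: measurable_input.
Qed.

Let mratio t : measurable_fun setT (ratio t).
Proof.
apply: measurable_from_setT; apply: measurable_density_ratio => //.
exact: measurable_input.
Qed.

Definition decided_correctly (w : T) : bool :=
  correct_decision w [tuple Y t w | t < n].

Lemma measurable_decided_correctly : measurable_fun setT decided_correctly.
Proof.
have mKT : measurable_fun setT (id : T -> known transmitter_sources).
  exact: measurable_known.
rewrite /decided_correctly.
have mt : measurable_fun setT (fun w => [tuple Y t w | t < n]).
  exact: measurable_mktuple.
have mp : measurable_fun setT
    (fun w => (w, [tuple Y t w | t < n]) : known transmitter_sources * n.-tuple R[i]).
  exact: measurable_fun_pair mKT mt.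
exact: (measurableT_comp measurable_correct_decision mp).
Qed.

(** All [n] outputs are exchanged starting from a blind guess; the zero outputs put in at the start
    are all overwritten. *)
Lemma correct_ratio_le :
  \int[Pr]_w ((decided_correctly w)%:R%:E * (\prod_(t < n) ratio t w)%:E) <=
  ((m k).+1%:R^-1)%:E.
Proof.
pose F w y : \bar R := (correct_decision w y)%:R%:E.
have mF : measurable_fun setT (fun p : known transmitter_sources * n.-tuple R[i] => F p.1 p.2).
  apply/measurable_EFinP.
  rewrite (_ : (fun _ => _) = fun p : known transmitter_sources * n.-tuple R[i] =>
    if correct_decision p.1 p.2 then 1%R else 0%R); last first.
    by apply/funext => p; case: correct_decision.
  by apply: measurable_fun_ifT => //; exact: measurable_correct_decision.
have M0 : (0 <= ((m k).+1%:R^-1) :> R)%R by rewrite invr_ge0.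
have F0 w y : 0 <= F w y by rewrite lee_fin.
have := replace_outputs_le P0 k c0 measurable_input mF F0 M0 guess_prob_le (leqnn n)
  [tuple 0%R | t < n].
apply: le_trans; rewrite le_eqVlt; apply/orP; left; apply/eqP.
apply: eq_integral => w _; congr (_ * _%:E).
  rewrite /F /decided_correctly; congr (correct_decision _ _)%:R%:E.
  by apply: eq_from_tnth => t; rewrite !tnth_mktuple ltn_ord.
by apply: eq_bigl => t; rewrite ltn_ord.
Qed.

(* Change of measure followed by Markov's inequality. *)
Lemma correct_prob_le (theta : R) : (0 < theta)%R ->
  Pr [set w | decided_correctly w] <=
  (theta / (m k).+1%:R)%:E + Pr [set w | (\prod_(t < n) ratio t w < theta^-1)%R].
Proof.
move=> th0.
have mprod : measurable_fun setT (fun w => \prod_(t < n) ratio t w)%R.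
  by apply: measurable_prod.
have mlt : measurable [set w | (\prod_(t < n) ratio t w < theta^-1)%R].
  rewrite -[X in measurable X]setTI.
  have := @measurable_fun_ltr _ T R setT _ (fun=> theta^-1%R) mprod (measurable_cst _).
  by move=> /(_ measurableT [set true]); apply.
have mc : measurable [set w | decided_correctly w].
  rewrite -[X in measurable X]setTI.
  exact: (measurable_decided_correctly measurableT (Y := [set true])).
have prod0 w : (0 <= \prod_(t < n) ratio t w)%R.
  by apply: prodr_ge0 => t _; rewrite ltW// density_ratio_gt0.
set A := [set w | decided_correctly w]; set B := [set w | _ < _]%R.
apply: (@le_trans _ _ (Pr (A `\` B) + Pr B)).
  rewrite -measureU//; last 2 first.
  - exact: measurableD.
  - by rewrite setDE -setIA setICl setI0.
  apply: le_measure; rewrite ?inE//.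
    by apply: measurableU => //; exact: measurableD.
  by move=> w Aw; have [Bw|Bw] := pselect (B w); [right|left].
rewrite leeD2r//.
apply: (@le_trans _ _ (theta%:E * \int[Pr]_w ((decided_correctly w)%:R%:E * (\prod_(t < n) ratio t w)%:E))); last first.
  rewrite EFinM; apply: lee_wpmul2l; first by rewrite lee_fin ltW.
  exact: correct_ratio_le.
have mi : measurable_fun setT (fun w => (decided_correctly w)%:R%:E * (\prod_(t < n) ratio t w)%:E).
  apply: emeasurable_funM; last exact/measurable_EFinP.
  apply/measurable_EFinP.
  rewrite (_ : (fun _ => _) = fun w => if decided_correctly w then 1%R else 0%R); last first.
    by apply/funext => p; case: decided_correctly.
  by apply: measurable_fun_ifT => //; exact: measurable_decided_correctly.
rewrite -ge0_integralZl//; last 2 first.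
- by move=> w _; rewrite mule_ge0// lee_fin.
- by rewrite lee_fin ltW.
rewrite -[X in Pr X]setIT -integral_indic//; last exact: measurableD.
apply: ge0_le_integral => //.
- by apply/measurable_EFinP; apply: measurable_indic; exact: measurableD.
- exact: measurable_funeM.
- move=> w _; rewrite -!EFinM lee_fin indicE.
  have [|_] := boolP (w \in A `\` B); last by rewrite !mulr_ge0// ltW.
  rewrite inE => -[Aw /negP]; rewrite -leNgt => Bw.
  have -> : decided_correctly w = true by [].
  by rewrite mul1r mulrC -ler_pdivrMr// mul1r.
Qed.

End CodeConverse.

(** * Converse *)

Lemma measurable_bool_set d (T : measurableType d) (b : T -> bool) :
  measurable_fun setT b -> measurable [set w | b w].
Proof.
by move=> mb; rewrite -[X in measurable X]setTI; exact: (mb measurableT [set true]).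
Qed.

(** * Inequalities for complex vectors *)

Section ComplexInequalities.
Context (R : realType).
Implicit Types (x y z : R[i]) (h v : vec2 R).

Lemma sqmodC_ge0 x : 0 <= sqmodC x.
Proof. by rewrite addr_ge0 ?sqr_ge0. Qed.

Lemma sqnormC_ge0 v : 0 <= sqnormC v.
Proof. by apply: sumr_ge0 => i _; exact: sqmodC_ge0. Qed.

Lemma sqmodCM x y : sqmodC (x * y) = sqmodC x * sqmodC y.
Proof. by rewrite /sqmodC ReM ImM; ring. Qed.

Lemma sqmodCD3 x y z :
  sqmodC (x + y + z) <= 3 * (sqmodC x + sqmodC y + sqmodC z).
Proof.
rewrite /sqmodC !ReD !ImD.
set a := complex.Re x; set b := complex.Re y; set c := complex.Re z.
set a' := complex.Im x; set b' := complex.Im y; set c' := complex.Im z.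
have := sqr_ge0 (a - b); have := sqr_ge0 (a - c); have := sqr_ge0 (b - c).
have := sqr_ge0 (a' - b'); have := sqr_ge0 (a' - c'); have := sqr_ge0 (b' - c').
nra.
Qed.

Lemma sqnormCE v : sqnormC v = sqmodC (tnth v ord0) + sqmodC (tnth v ord_max).
Proof.
rewrite /sqnormC !big_ord_recl big_ord0 addr0.
by rewrite (_ : lift ord0 ord0 = ord_max)//; exact/val_inj.
Qed.

(** Cauchy-Schwarz by Lagrange's identity: the defect is the squared modulus of h_0 conj(v_1) - h_1
    conj(v_0), whose real and imaginary parts are the two squares in the proof. *)
Lemma sqmodC_dotC_le h v : sqmodC (dotC h v) <= sqnormC h * sqnormC v.
Proof.
rewrite dotCE !sqnormCE /sqmodC !ReD !ImD !ReM !ImM.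
set a := complex.Re (tnth h ord0); set b := complex.Im (tnth h ord0).
set c := complex.Re (tnth h ord_max); set e := complex.Im (tnth h ord_max).
set p := complex.Re (tnth v ord0); set q := complex.Im (tnth v ord0).
set r := complex.Re (tnth v ord_max); set s := complex.Im (tnth v ord_max).
rewrite -subr_ge0.
rewrite (_ : _ - _ = (a * r + b * s - c * p - e * q) ^+ 2 +
  (b * r - a * s - e * p + c * q) ^+ 2); last by ring.
by rewrite addr_ge0// sqr_ge0.
Qed.

End ComplexInequalities.

(** * Bounds on expectations *)

Section MeanLe.
Context d (T : measurableType d) (R : realType) (Pr : probability T R).
Implicit Types (f g : T -> R) (a b : R).

(** Measurability and sign are bundled with the bound so that estimates can be added and scaled
    without further side conditions. *)
Definition mean_le f a : Prop :=
  [/\ measurable_fun setT f, (forall w, 0 <= f w) &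
      (\int[Pr]_w (f w)%:E <= a%:E)%E].

Lemma mean_le_ge0 f a : mean_le f a -> 0 <= a.
Proof.
move=> [_ f0 fa]; rewrite -lee_fin; apply: le_trans fa.
by apply: integral_ge0 => w _; rewrite lee_fin.
Qed.

Lemma mean_leW f g a : measurable_fun setT f -> (forall w, 0 <= f w <= g w) ->
  mean_le g a -> mean_le f a.
Proof.
move=> mf fg [mg g0 ga]; split => // [w|]; first by case/andP: (fg w).
apply: le_trans ga; apply: ge0_le_integral => //.
- by move=> w _; rewrite lee_fin; case/andP: (fg w).
- exact/measurable_EFinP.
- exact/measurable_EFinP.
- by move=> w _; rewrite lee_fin; case/andP: (fg w).
Qed.

Lemma mean_le_cst a : 0 <= a -> mean_le (fun=> a) a.
Proof.
move=> a0; split => //; rewrite (integral_cst _ measurableT a%:E).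
by rewrite [X in (_ * X)%E]probability_setT mule1.
Qed.

Lemma mean_leD f g a b : mean_le f a -> mean_le g b ->
  mean_le (fun w => f w + g w) (a + b).
Proof.
move=> [mf f0 fa] [mg g0 gb]; split => [|w|]; first exact: measurable_funD.
  exact: addr_ge0.
under eq_integral do rewrite EFinD.
rewrite ge0_integralD//.
- by rewrite EFinD; exact: leeD.
- by move=> w _; rewrite lee_fin.
- exact/measurable_EFinP.
- by move=> w _; rewrite lee_fin.
- exact/measurable_EFinP.
Qed.

Lemma mean_leZ r f a : 0 <= r -> mean_le f a ->
  mean_le (fun w => r * f w) (r * a).
Proof.
move=> r0 [mf f0 fa]; split => [|w|]; first exact: measurable_funM.
  exact: mulr_ge0.
under eq_integral do rewrite EFinM.
rewrite ge0_integralZl//.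
- by rewrite EFinM; apply: lee_wpmul2l => //; rewrite lee_fin.
- exact/measurable_EFinP.
- by move=> w _; rewrite lee_fin.
Qed.

Lemma mean_le_sum (n : nat) (f : 'I_n -> T -> R) a :
  (forall t, mean_le (f t) a) -> mean_le (fun w => \sum_(t < n) f t w) (n%:R * a).
Proof.
elim: n f => [|n IH] f fa.
  rewrite (_ : (fun _ => _) = fun=> 0) ?mul0r; first exact: mean_le_cst.
  by apply/funext => w; rewrite big_ord0.
rewrite (_ : (fun _ => _) = fun w => \sum_(t < n) f (widen_ord (leqnSn n) t) w + f ord_max w).
  by rewrite -natr1 mulrDl mul1r; apply: mean_leD => //; exact: IH.
by apply/funext => w; rewrite big_ord_recr.
Qed.

Lemma mean_le_indic (A : set T) a : measurable A -> (Pr A <= a%:E)%E ->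
  mean_le \1_A a.
Proof.
move=> mA Aa; split => [|w|]; [exact: measurable_indic|by []|].
by rewrite integral_indic// setIT.
Qed.

Lemma mean_le_markov f a s : mean_le f a -> 0 < s ->
  (Pr [set w | (s <= f w)%R] <= (a / s)%:E)%E.
Proof.
move=> [mf f0 fa] s0.
have mA : measurable [set w | s <= f w].
  by apply: measurable_bool_set; exact: measurable_fun_ler.
rewrite mulrC EFinM lee_pdivlMl//.
apply: le_trans fa.
set A := [set w | (s <= f w)%R] in mA *.
have -> : (s%:E * Pr A = \int[Pr]_w (s%:E * (\1_A w)%:E))%E.
  rewrite ge0_integralZl//.
  - by rewrite integral_indic// setIT.
  - by apply/measurable_EFinP; exact: measurable_indic.
  - by rewrite lee_fin ltW.
apply: ge0_le_integral => //.
- by move=> w _; rewrite -EFinM lee_fin mulr_ge0// ltW.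
- by apply: measurable_funeM; apply/measurable_EFinP; exact: measurable_indic.
- exact/measurable_EFinP.
- move=> w _; rewrite -EFinM lee_fin indicE.
  have [|_] := boolP (w \in _); last by rewrite mulr0.
  by rewrite inE /A/= mulr1.
Qed.

End MeanLe.

Section Moments.
Context d (T : measurableType d) (R : realType) (Pr : probability T R).

(** The bound is the second moment at time 0, finite by the integrability in [identity_covariance];
    identical distribution makes it uniform in time. *)
Lemma sqnorm_moment (X : nat -> {RV Pr >-> vec2 R}) :
  identically_distributed Pr X -> identity_covariance Pr (X 0) ->
  exists M : R, forall t, mean_le Pr (fun w => sqnormC (X t w)) M.
Proof.
move=> idX [iX _].
have mn : measurable_fun setT (fun v : vec2 R => (sqnormC v)%:E).
  by apply/measurable_EFinP; exact: measurable_sqnormC.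
have n0 (v : vec2 R) : (0 <= (sqnormC v)%:E)%E by rewrite lee_fin sqnormC_ge0.
have mX t : measurable_fun setT (fun w => sqnormC (X t w)) by exact: measurable_sqnormC.
have E t : (\int[Pr]_w (sqnormC (X t w))%:E = \int[Pr]_w (sqnormC (X 0 w))%:E)%E.
  rewrite -(ge0_integral_distribution (X t) mn n0) -(ge0_integral_distribution (X 0) mn n0).
  by apply: eq_measure_integral => A mA _; exact: idX.
exists (fine (\int[Pr]_w (sqnormC (X 0 w))%:E)%E) => t.
split => [//|w|]; first exact: sqnormC_ge0.
rewrite E fineK//.
have : Pr.-integrable setT (fun w => (sqnormC (X 0 w))%:E).
  under eq_fun do rewrite sqnormCE EFinD.
  exact: integrableD.
move=> /integrableP[_]; under eq_integral do rewrite gee0_abs//.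
by move=> ?; rewrite ge0_fin_numE// integral_ge0.
Qed.

End Moments.

(** * The logarithmic cost of one output and its mean *)

Section Loss.
Context d (T : measurableType d) (R : realType) (Pr : probability T R)
  (lam : bool -> bool -> R) (ch : jammed_bc Pr lam).
Variables (P : R) (P1 : 1 <= P) (csit jsit : knowledge) (n : nat) (m : user -> nat)
  (cd : Defs.code R csit jsit n m).
Variables (k : user) (c : R) (c0 : 0 < c) (c1 : c <= 1).

Let P0 : 0 < P. Proof. exact: lt_le_trans P1. Qed.

Local Notation Y t := (received ch P k (input ch cd) t).
Local Notation ratio t := (density_ratio ch P k c (input ch cd) t).

Lemma pi_ge1 : 1 <= pi :> R.
Proof. by apply: le_trans (pi_ge2 R); rewrite ler1n. Qed.

(** The reference density is at most 1 / (pi P), and [spread] is at most pi P because c <= 1 <= P.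
    Nonnegative losses are what lets Markov's inequality act on their sum. *)
Lemma density_ratio_le1 (t : 'I_n) w : ratio t w <= 1.
Proof.
have pi0 := pi_gt0 R; have pi1 := pi_ge1.
have q : cauchy_density P (Y t w) <= (pi * P)^-1.
  rewrite /cauchy_density lef_pV2 ?posrE ?mulr_gt0//; last 2 first.
  - by rewrite ltr_pwDl// divr_ge0 ?sqr_ge0// ltW.
  - by rewrite ltr_pwDl// divr_ge0 ?sqr_ge0// ltW.
  have a1 u : 1 <= 1 + u ^+ 2 / P by rewrite lerDl divr_ge0 ?sqr_ge0// ltW.
  rewrite -mulrA; apply: (@le_trans _ _ (pi ^+ 2 * P * 1)).
    by rewrite mulr1 ler_wpM2r ?(ltW P0)// expr2 ler_peMr// ltW.
  rewrite ler_wpM2l ?mulr_ge0 ?sqr_ge0 ?(ltW P0) ?(ltW pi0)//.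
  by apply: (le_trans (a1 (complex.Re (Y t w)))); rewrite ler_peMr// (le_trans _ (a1 _)).
have s : spread ch P k c t w <= pi * P.
  rewrite /spread; case: ifP => _.
    by rewrite ler_wpM2r ?(ltW P0)// ler_piMr// ltW.
  by rewrite ler_peMr// ltW.
apply: (@le_trans _ _ ((pi * P)^-1 * (pi * P))).
  apply: ler_pM => //; first exact/ltW/cauchy_density_gt0.
  exact/ltW/spread_gt0.
by rewrite mulVf// gt_eqF// mulr_gt0.
Qed.

Definition loss (t : 'I_n) (w : T) : R := - ln (ratio t w).

Lemma loss_ge0 t w : 0 <= loss t w.
Proof. by rewrite oppr_ge0 ln_le0// density_ratio_le1. Qed.

(** The input may depend on the channel, so the mean of |H|^2 |X|^2 is out of reach. The logarithm
    of the Cauchy density splits such products into sums, and ln (1 + u) <= u leaves one squared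
    norm per term. Only the term of the indicator grows with [P]. *)
Lemma loss_le (t : 'I_n) w :
  loss t w <= ln (pi / c) + ln (pi * P) * \1_(~` [set w | strongly_jammed ch k c t w]) w
    + 2 * (ln 3 + (sqnormC (chH ch k t w) + P^-1 * sqnormC (input ch cd t w)
    + (sqnormC (chG ch k t w) + P^-1 * sqnormC (chJ ch P t w))
    + sqmodC (chN ch k t w))).
Proof.
set h := sqnormC (chH ch k t w). set x := sqnormC (input ch cd t w).
set g := sqnormC (chG ch k t w). set j := sqnormC (chJ ch P t w).
set z := sqmodC (chN ch k t w).
have pi0 := pi_gt0 R; have pi1 := pi_ge1.
have h0 : 0 <= h by exact: sqnormC_ge0.
have x0 : 0 <= x by exact: sqnormC_ge0.
have g0 : 0 <= g by exact: sqnormC_ge0.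
have j0 : 0 <= j by exact: sqnormC_ge0.
have z0 : 0 <= z by exact: sqmodC_ge0.
set A := \1_ _ w.
have PV0 : 0 < P^-1 by rewrite invr_gt0.
have PV1 : P^-1 <= 1 by rewrite invf_le1.
(* Dominates each of the two Cauchy factors, whence the square of [U] below and the factor 2 in the
   statement. *)
pose U := 1 + sqmodC (Y t w) / P.
have U0 : 0 < U by rewrite ltr_pwDl// divr_ge0 ?sqmodC_ge0// ltW.
pose B := if strongly_jammed ch k c t w then 1 else pi * P.
have B0 : 0 < B by rewrite /B; case: ifP => // _; exact: mulr_gt0.
have lnB : ln B = ln (pi * P) * A.
  rewrite /B /A indicE; have [sj|sj] := boolP (strongly_jammed _ _ _ _ _).
    by rewrite memNset ?mulr0 ?ln1//=; apply.
  by rewrite mem_set ?mulr1//= => ?; move/negP: sj.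
have ratio_ge : (pi / c * B * (U * U))^-1 <= ratio t w.
  rewrite /density_ratio /cauchy_density -[X in _ <= _ * X]invrK -invfM.
  have s0 := spread_gt0 ch P0 k c0 t w.
  have re0 u : 0 < 1 + u ^+ 2 / P by rewrite ltr_pwDl// divr_ge0 ?sqr_ge0// ltW.
  rewrite lef_pV2 ?posrE ?mulr_gt0 ?invr_gt0 ?re0//.
  have piP : pi ^+ 2 * P * (spread ch P k c t w)^-1 <= pi / c * B.
    rewrite /spread /B; case: ifP => _.
      rewrite mulr1 (_ : pi ^+ 2 * P / (pi * c * P) = pi / c)//.
      have E (p q r : R) : p != 0 -> q != 0 -> r != 0 -> p ^+ 2 * q / (p * r * q) = p / r.
        by move=> p0 q0 r0; field; rewrite p0 q0 r0.
      by apply: E; rewrite gt_eqF.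
    rewrite (_ : pi ^+ 2 * P / pi = pi * P); last first.
      by rewrite expr2 mulrAC -[X in X * _]mulrA divff ?mulr1// gt_eqF.
    rewrite ler_peMl ?mulr_ge0 ?(ltW P0) ?(ltW pi0)//.
    by rewrite ler_pdivlMr// mul1r (le_trans c1).
  rewrite mulrAC -[X in X * _ <= _]mulrA [X in X <= _](_ : _ =
    (pi ^+ 2 * P * (spread ch P k c t w)^-1) *
    ((1 + complex.Re (Y t w) ^+ 2 / P) * (1 + complex.Im (Y t w) ^+ 2 / P))); last by ring.
  apply: ler_pM => //.
  - by apply: divr_ge0; [apply: mulr_ge0; [exact: sqr_ge0|exact: ltW]|exact: ltW].
  - by rewrite mulr_ge0 ?(ltW (re0 _)).
  - apply: ler_pM; rewrite ?(ltW (re0 _))//.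
      by rewrite lerD2l ler_wpM2r ?(ltW PV0)// lerDl sqr_ge0.
    by rewrite lerD2l ler_wpM2r ?(ltW PV0)// lerDr sqr_ge0.
have lnU : ln U <= ln 3 + (h + P^-1 * x + (g + P^-1 * j) + z).
  rewrite -[X in _ <= _ + X]expRK -lnM ?posrE ?expR_gt0//.
  rewrite ler_ln ?posrE ?mulr_gt0 ?expR_gt0//.
  have Yle : sqmodC (Y t w) <= 3 * (h * x + g * j + z).
    apply: le_trans (sqmodCD3 _ _ _) _.
    rewrite ler_wpM2l// lerD2r; apply: lerD; first exact: sqmodC_dotC_le.
    rewrite sqmodCM; apply: le_trans (sqmodC_dotC_le _ _).
    rewrite ler_piMl ?sqmodC_ge0// /sqmodC.
    by case: (tnth _ _); rewrite /= ?expr1n ?expr0n/= ?addr0.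
  clearbody h x g j z.
  have x'0 : 0 <= P^-1 * x by rewrite mulr_ge0// ltW.
  have j'0 : 0 <= P^-1 * j by rewrite mulr_ge0// ltW.
  (* In product form each factor 1 + u can be bounded by [expR u]. *)
  apply: (@le_trans _ _ (3 * ((1 + h) * (1 + P^-1 * x) * ((1 + g) * (1 + P^-1 * j)) * (1 + z)))).
    have : U <= 1 + 3 * (h * (P^-1 * x) + g * (P^-1 * j) + z).
      rewrite lerD2l ler_pdivrMr//; apply: le_trans Yle _.
      rewrite -mulrA ler_wpM2l//.
      have Pn : P != 0 by rewrite gt_eqF.
      have -> : (h * (P^-1 * x) + g * (P^-1 * j) + z) * P = h * x + g * j + z * P.
        by field.
      by rewrite lerD2l ler_peMr.
    move/le_trans; apply.
    set a := P^-1 * x in x'0 *; set b := P^-1 * j in j'0 *.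
    have ha : 0 <= h * a by exact: mulr_ge0.
    have gb : 0 <= g * b by exact: mulr_ge0.
    have A1 : 1 + h * a <= (1 + h) * (1 + a) by nra.
    have A2 : 1 + g * b <= (1 + g) * (1 + b) by nra.
    have A3 : (1 + h * a) * (1 + g * b) * (1 + z) <= (1 + h) * (1 + a) * ((1 + g) * (1 + b)) * (1 + z).
      apply: ler_wpM2r; first exact: addr_ge0.
      by apply: ler_pM => //; exact: addr_ge0.
    have A4 : h * a + g * b + z + 1 <= (1 + h * a) * (1 + g * b) * (1 + z).
      have : 0 <= h * a * (g * b) by exact: mulr_ge0.
      have : 0 <= h * a * z by exact: mulr_ge0.
      have : 0 <= g * b * z by exact: mulr_ge0.
      have : 0 <= h * a * (g * b) * z by rewrite mulr_ge0// mulr_ge0.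
      nra.
    lra.
  rewrite ler_wpM2l// !expRD.
  by repeat (apply: ler_pM); rewrite ?mulr_ge0 ?addr_ge0 ?expR_ge1Dx.
rewrite /loss.
have r0 : 0 < ratio t w by exact: density_ratio_gt0.
have pc0 : 0 < pi / c by exact: divr_gt0.
have pcB0 : 0 < pi / c * B by exact: mulr_gt0.
have UU0 : 0 < U * U by exact: mulr_gt0.
have K0 : 0 < pi / c * B * (U * U) by exact: mulr_gt0.
have : ln (pi / c * B * (U * U))^-1 <= ln (ratio t w).
  by rewrite ler_ln// posrE invr_gt0.
rewrite lnV ?posrE// (@lnM _ (pi / c * B) (U * U)) ?posrE//.
rewrite (@lnM _ (pi / c) B) ?posrE// (@lnM _ U U) ?posrE// lnB => h1.
lra.
Qed.

Lemma measurable_loss t : measurable_fun setT (loss t).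
Proof.
apply: measurableT_comp => //.
apply: measurableT_comp; first exact: measurable_ln.
apply: (measurable_from_known (ch := ch) (P := P) (m := m) (J := setT)).
apply: measurable_density_ratio => //; exact: measurable_input.
Qed.

Variables (Mh Mg pb : R).
Hypothesis Hh : forall t, mean_le Pr (fun w => sqnormC (chH ch k t w)) Mh.
Hypothesis Hg : forall t, mean_le Pr (fun w => sqnormC (chG ch k t w)) Mg.
Hypothesis Hpb : forall t,
  (Pr (~` [set w | strongly_jammed ch k c t w]) <= pb%:E)%E.
Hypothesis Hpow : power_constraint ch P cd.

(** In the last bracket, 1 is the input power divided by [P], 16 comes from the two jammer
    components at 8 each, again divided by [P], and 8 from the noise. *)
Definition loss_bound : R :=
  ln (pi / c) + ln (pi * P) * pb + 2 * (ln 3 + (Mh + 1 + (Mg + 16) + 8)).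

Lemma mean_loss t : mean_le Pr (loss t) loss_bound.
Proof.
have pi1 := pi_ge1; have pi0 := pi_gt0 R.
apply: (mean_leW (measurable_loss t)) => [w|].
  by rewrite loss_ge0; exact: loss_le.
have lc : 0 <= ln (pi / c) by rewrite ln_ge0// ler_pdivlMr// mul1r (le_trans c1).
have lP : 0 <= ln (pi * P) by rewrite ln_ge0// (le_trans pi1)// ler_peMr// ltW.
have l3 : 0 <= ln 3 :> R by rewrite ln_ge0// ler1n.
apply: mean_leD; first apply: mean_leD; first exact: mean_le_cst.
  apply: mean_leZ => //; apply: mean_le_indic => //; apply: measurableC.
  apply: measurable_bool_set.
  have mB : measurable_fun setT (strongly_jammed ch k c t).
    apply: (measurable_from_known (ch := ch) (P := P) (m := m) (J := setT)).
    exact: measurable_strongly_jammed.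
  exact: mB.
apply: mean_leZ => //; apply: mean_leD; first exact: mean_le_cst.
apply: mean_leD; first apply: mean_leD; first apply: mean_leD => //.
- rewrite (_ : 1 = P^-1 * P); last by rewrite mulVf// gt_eqF.
  apply: mean_leZ; first by rewrite invr_ge0 ltW.
  split => [|w|]; last by have := Hpow t; rewrite unlock.
    apply: measurable_sqnormC.
    apply: (measurable_from_known (ch := ch) (P := P) (m := m) (J := transmitter_sources)).
    exact: measurable_input.
  exact: sqnormC_ge0.
- apply: mean_leD => //.
  rewrite (_ : 16 = P^-1 * (8 * P + 8 * P)); last by field; rewrite gt_eqF.
  apply: mean_leZ; first by rewrite invr_ge0 ltW.
  have mJ i : mean_le Pr (fun w => sqmodC (tnth (chJ ch P t w) i)) (8 * P).
    split => [|w|]; last first.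
    - pose XJ : {RV Pr >-> R[i]} := HB.pack (fun w => tnth (chJ ch P t w) i)
        (isMeasurableFun.Build _ _ _ _ _ (@measurable_chJ _ T R Pr lam ch P t i)).
      by apply: (@circular_gaussian_sqmod_le _ _ T Pr P XJ) => //; exact: chJ_law.
    - exact: sqmodC_ge0.
    - by apply: measurable_sqmodC; exact: measurable_chJ.
  under eq_fun do rewrite sqnormCE.
  exact: mean_leD.
- split => [|w|]; first exact: measurable_sqmodC.
    exact: sqmodC_ge0.
  rewrite -[8]mulr1; apply: circular_gaussian_sqmod_le => //; exact: chN_law.
Qed.

(* Markov's inequality for the total loss bounds the probability that the
   change of measure costs a factor of more than [expR (n * gamma)]. *)
Lemma error_prob_ge (gamma : R) : 0 < gamma -> (0 < n)%N ->
  (1 <= error_prob ch P cd k + (expR (n%:R * gamma) / (m k).+1%:R)%:E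
        + (loss_bound / gamma)%:E)%E.
Proof.
move=> ga0 n0.
have th0 : 0 < expR (n%:R * gamma) by exact: expR_gt0.
have mc : measurable [set w | decided_correctly ch P cd k w].
  exact/measurable_bool_set/measurable_decided_correctly.
have -> : error_prob ch P cd k = Pr (~` [set w | decided_correctly ch P cd k w]).
  congr (Pr _); apply/seteqP; split => w /=.
    by move=> ne /eqP.
  by move=> ne e; apply: ne; apply/eqP.
rewrite probability_setC//.
have := @correct_prob_le _ T R Pr lam ch P P0 _ _ n m cd k c c0 _ th0.
have : (Pr [set w | (\prod_(t < n) ratio t w < (expR (n%:R * gamma))^-1)%R] <=
   (loss_bound / gamma)%:E)%E.
  have sl := mean_le_sum mean_loss.
  have ng : 0 < n%:R * gamma by rewrite mulr_gt0// ltr0n.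
  have := mean_le_markov sl ng.
  rewrite -mulf_div divff ?mul1r ?pnatr_eq0 -?lt0n//.
  apply: le_trans; apply: le_measure.
  - rewrite inE; apply: measurable_bool_set.
    have mp : measurable_fun setT (fun w => \prod_(t < n) ratio t w).
      apply: measurable_prod => t _.
      apply: (measurable_from_known (ch := ch) (P := P) (m := m) (J := setT)).
      apply: measurable_density_ratio => //; exact: measurable_input.
    exact: measurable_fun_ltr.
  - rewrite inE; apply: measurable_bool_set.
    by have [ms _ _] := sl; exact: measurable_fun_ler.
  - move=> w /=; rewrite -expRN.
    have -> : \prod_(t < n) ratio t w = expR (- \sum_(t < n) loss t w).
      rewrite -sumrN expR_sum; apply: eq_bigr => t _.
      by rewrite opprK lnK// posrE density_ratio_gt0.
    by rewrite ltr_expR ltrN2 => /ltW.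
move=> hB hA.
have fA : Pr [set w | decided_correctly ch P cd k w] \is a fin_num by exact: fin_num_measure.
have := le_trans hA (leeD2l _ hB).
rewrite -(fineK fA) -EFinN -!EFinD !lee_fin => {}hA.
by rewrite -!addrA lerDl addrC subr_ge0.
Qed.

End Loss.

(** * Null sets and small probabilities *)

Lemma null_set_integralr d (U : measurableType d) (R : realType)
    (mu : {measure set U -> \bar R}) (N : set U) (f : U -> R) :
  measurable N -> measurable_fun setT f ->
  (mu N = 0 -> \int[mu]_(x in N) (f x)%:E = 0)%E.
Proof.
move=> mN mf N0; apply: null_set_integral => //.
by apply/measurable_EFinP; apply: measurable_funTS.
Qed.

Lemma product_sections0 d d' (U : measurableType d) (V : measurableType d')
    (R : realType) (m1 : {measure set U -> \bar R}) (m2 : {measure set V -> \bar R})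
    (N : set (U * V)) :
  (forall x, m2 (xsection N x) = 0%E) -> (m1 \x m2)%E N = 0%E.
Proof.
by move=> N0; rewrite /product_measure1; apply: integral0_eq => x _; exact: N0.
Qed.

Section ProductNull.
Context d (U : measurableType d) (R : realType)
  (mu : {sigma_finite_measure set U -> \bar R}).

Lemma product_sigma_finite : sigma_finite setT (mu \x mu)%E.
Proof.
have /sigma_finiteP[F [TF ndF Foo]] := sigma_finiteT mu.
exists (fun n => F n `*` F n).
  rewrite -setXTT TF predeqE => -[x y]; split; last first.
    by move=> [n _ []/= ? ?]; split; exists n.
  move=> [/= [n _ Fnx] [k _ Fky]]; exists (maxn n k) => //; split.
    by move: x Fnx; exact/subsetPset/ndF/leq_maxl.
  by move: y Fky; exact/subsetPset/ndF/leq_maxr.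
move=> k; have [mF oo] := Foo k; split; first exact: measurableX.
by rewrite (product_measure1E _ _ mF mF) lte_mul_pinfty// ge0_fin_numE.
Qed.

Lemma product_null2 (A B : set U) : measurable A -> measurable B -> mu A = 0%E ->
  (mu \x mu)%E (A `*` B) = 0%E.
Proof. by move=> mA mB A0; rewrite (product_measure1E _ _ mA mB) [X in (X * _)%E]A0 mul0e. Qed.

End ProductNull.

Section ProductNull4.
Context d (U : measurableType d) (R : realType)
  (mu : {sigma_finite_measure set U -> \bar R}).

(* The library infers that a product measure is sigma-finite only when its
   factors are finite. *)
Let mu2 : {sigma_finite_measure set (U * U)%type -> \bar R} :=
  HB.pack (mu \x mu)%E (@Measure_isSigmaFinite.Build _ _ _ (mu \x mu)%E
    (product_sigma_finite mu)).

Lemma null_set_integralr4 (N : set ((U * U) * (U * U))) (f : (U * U) * (U * U) -> R) :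
  measurable N -> measurable_fun setT f ->
  (((mu \x mu) \x (mu \x mu)) N = 0 ->
   \int[(mu \x mu) \x (mu \x mu)]_(x in N) (f x)%:E = 0)%E.
Proof. exact: (@null_set_integralr _ _ _ (mu2 \x mu2)%E). Qed.

Lemma product_null4 (A : set U) : measurable A -> mu A = 0%E ->
  ((mu \x mu) \x (mu \x mu))%E ((A `*` A) `*` setT) = 0%E.
Proof.
move=> mA A0.
apply: (product_null2 (mu := mu2)); [exact: measurableX|exact: measurableT|].
exact: product_null2.
Qed.

(** Tonelli over sections. To see that a section is null in the plane it is enough to confine one
    real coordinate to a null set. *)
Lemma product_null_sections (N : set ((U * U) * (U * U))) :
  (forall x, exists A, [/\ measurable A, mu A = 0%E & xsection N x `<=` A `*` setT]) ->
  measurable N -> ((mu \x mu) \x (mu \x mu))%E N = 0%E.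
Proof.
move=> NA mN; apply: (@product_sections0 _ _ _ _ _ mu2 mu2) => x.
have [A [mA A0 sA]] := NA x.
apply/eqP; rewrite eq_le measure_ge0 andbT.
rewrite -[leRHS](product_null2 mA measurableT A0).
apply: le_measure; rewrite ?inE; [exact: measurable_xsection|exact: measurableX|exact: sA].
Qed.

End ProductNull4.

Section SmallProbability.
Context d (T : measurableType d) (R : realType) (Pr : probability T R).
Local Notation mu := (@lebesgue_measure R).
Local Notation mR := (measurableTypeR R).

(** Continuity from above along the thresholds 1 / (j + 1), which also gives the bound [c <= 1] that
    the losses require. *)
Lemma prob_lt_small (f : T -> R) (e : R) : measurable_fun setT f ->
  Pr [set w | f w <= 0] = 0%E -> 0 < e ->
  exists2 c, 0 < c <= 1 & (Pr [set w | (f w < c)%R] <= e%:E)%E.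
Proof.
move=> mf f0 e0.
pose A (j : nat) := [set w | f w < j.+1%:R^-1].
have mA j : measurable (A j).
  by apply: measurable_bool_set; exact: measurable_fun_ltr.
have capA : \bigcap_j A j = [set w | f w <= 0].
  apply/seteqP; split => [w Aw /=|w /= fw j _]; last first.
    by apply: le_lt_trans fw _; rewrite invr_gt0.
  rewrite leNgt; apply/negP => fw0.
  have := Aw (Num.trunc (f w)^-1) I; rewrite /A/= ltNge => /negP; apply.
  rewrite -[leRHS]invrK lef_pV2 ?posrE ?invr_gt0//.
  exact/ltW/truncnS_gt.
have cvA : (Pr \o A) n @[n --> \oo] --> (0 : \bar R)%E.
  rewrite -f0 -capA; apply: nonincreasing_cvg_mu => //.
  - by rewrite (le_lt_trans (probability_le1 _ _))// ltry.
  - exact: bigcap_measurableType.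
  - apply/nonincreasing_seqP => j; apply/subsetPset => w; rewrite /A/= => /lt_le_trans; apply.
    by rewrite lef_pV2 ?posrE// ler_nat.
have /fine_cvgP[_ /cvgr_lt/(_ _ e0)] := cvA.
move=> /filter_ex[j /= Aj]; exists j.+1%:R^-1.
  by rewrite invr_gt0 ltr0n/= invf_le1// ler1n.
by rewrite -/(A j) -(fineK (fin_num_measure Pr _ (mA j))) lee_fin ltW.
Qed.

Lemma density_null (X : {RV Pr >-> vec2 R}) (N : set ((R * R) * (R * R))) :
  has_density Pr X -> measurable N ->
  ((lebesgue_measure \x lebesgue_measure) \x
   (lebesgue_measure \x lebesgue_measure))%E N = 0%E ->
  Pr ((fun w => re_im2 (X w)) @^-1` N) = 0%E.
Proof.
move=> [f [mf f0 fX]] mN N0; rewrite (fX _ mN).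
exact: (@null_set_integralr4 _ (measurableTypeR R) R lebesgue_measure N f mN mf N0).
Qed.

Lemma density_neq0 (X : {RV Pr >-> vec2 R}) : has_density Pr X ->
  Pr [set w | sqmodC (tnth (X w) ord0) <= 0] = 0%E.
Proof.
move=> hX.
pose N : set ((R * R) * (R * R)) := ([set 0] `*` [set 0]) `*` setT.
have mN0 : measurable ([set 0] `*` [set 0] : set (R * R)) by exact: measurableX.
rewrite -[RHS](density_null hX (N := N)).
- congr (Pr _); apply/seteqP; split => w /=; rewrite /N /re_im2 /re_im /=.
    rewrite le_eqVlt ltNge sqmodC_ge0 orbF paddr_eq0 ?sqr_ge0// !sqrf_eq0.
    by move=> /andP[/eqP -> /eqP ->].
  by rewrite /sqmodC => -[[/= -> ->] _]; rewrite expr0n addr0.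
- exact: measurableX.
- exact: (@product_null4 _ (measurableTypeR R) R lebesgue_measure [set 0]
    (measurable_set1 _) (lebesgue_measure_set1 _)).
Qed.
End SmallProbability.

(** * Upper bound on rates and degrees of freedom *)

Section Converse.
Context d (T : measurableType d) (R : realType) (Pr : probability T R)
  (lam : bool -> bool -> R) (ch : jammed_bc Pr lam).

Definition unjammed_prob (k : user) : R :=
  if k == ord0 then lam false false + lam false true
  else lam false false + lam true false.

Lemma measurable_jam t k : measurable_fun setT (fun w => tnth (chS ch t w) k).
Proof. exact: measurable_tnthC. Qed.

Lemma measurable_unjammed t k : measurable [set w | ~~ tnth (chS ch t w) k].
Proof. by apply: measurable_bool_set; apply: measurable_neg; exact: measurable_jam. Qed.

Lemma measurable_jsi_set t (s : jsi) : measurable (chS ch t @^-1` [set s]).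
Proof.
rewrite -[X in measurable X]setTI; apply: measurable_funPT => //.
rewrite (_ : [set s] = \bigcap_(i in [set: 'I_2]) [set x | tnth x i == tnth s i]).
  apply: fin_bigcap_measurable => // i _.
  apply: (measurable_bool_set (T := jsi) (b := fun x => tnth x i == tnth s i)).
  have := @measurable_tnth _ bool 2 i.
  by move=> mi mT B mB; exact: (mi mT ((fun b => b == tnth s i) @^-1` B)).
apply/seteqP; split => [x -> i _ //=|x xs]; apply: eq_from_tnth => i.
exact/eqP/xs.
Qed.

Lemma jsiE (s : jsi) : s = [tuple tnth s ord0; tnth s ord_max].
Proof.
apply: eq_from_tnth => i; rewrite (tnth_nth false).
by case: s i => -[|a [|b []]]//= ? [[|[|]]]//= ?; rewrite !(tnth_nth false).
Qed.

Lemma prob_unjammed t k :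
  Pr [set w | ~~ tnth (chS ch t w) k] = (unjammed_prob k)%:E.
Proof.
pose B i j := chS ch t @^-1` [set [tuple i; j]].
have E i j i' j' : (i, j) != (i', j') -> B i j `&` B i' j' = set0.
  move=> ne; apply/seteqP; split => // w [h1 h2].
  have [ii jj] := congr1 val (etrans (esym h1) h2).
  by move: ne; rewrite ii jj eqxx.
have t0 i j : tnth [tuple i; j] (ord0 : 'I_2) = i :> bool by [].
have t1 i j : tnth [tuple i; j] (ord_max : 'I_2) = j :> bool by [].
rewrite /unjammed_prob; case: ifPn => k0.
  rewrite EFinD -(chS_law ch t) -(chS_law ch t) -measureU; last 3 first.
  - exact: measurable_jsi_set.
  - exact: measurable_jsi_set.
  - exact: E.
  congr (Pr _); apply/seteqP; split => w /=; rewrite (eqP k0).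
    move=> /negbTE s0; rewrite /B/= (jsiE (chS ch t w)) s0.
    by case: (tnth _ _); [right|left].
  by case=> ->; rewrite t0.
have -> : k = ord_max.
  by apply/val_inj; case: k k0 => -[|[|]].
rewrite EFinD -(chS_law ch t) -(chS_law ch t) -measureU; last 3 first.
- exact: measurable_jsi_set.
- exact: measurable_jsi_set.
- exact: E.
congr (Pr _); apply/seteqP; split => w /=.
  move=> /negbTE s0; rewrite /B/= (jsiE (chS ch t w)) s0.
  by case: (tnth _ ord0); [right|left].
by case=> ->; rewrite t1.
Qed.

Lemma achievable_rate_ge0 csit jsit P r k : achievable ch csit jsit P r -> 0 <= r k.
Proof.
move=> [m [cd [_ /(_ k) rk _]]]; rewrite leNgt; apply/negP => r0.
have /cvgr_lt/(_ _ r0)/filter_ex[n /=] := rk.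
by rewrite ltNge divr_ge0// ln_ge0// ler1n.
Qed.

(** The constant is chosen before [P] and [r], so it vanishes after division by [ln P]. It collects
    the moments and the threshold [c], which depends on [e] only through the law of the jammer's
    channel. *)
Lemma achievable_rate_le csit jsit k e : 0 < e -> exists C, forall P r, 1 <= P ->
  achievable ch csit jsit P r -> r k <= (unjammed_prob k + e) * ln P + C.
Proof.
move=> e0.
have [Mh HMh] := sqnorm_moment (chH_id ch k) (chH_cov ch k 0).
have [Mg HMg] := sqnorm_moment (chG_id ch k) (chG_cov ch k 0).
have mg t : measurable_fun setT (fun w => sqmodC (tnth (chG ch k t w) ord0)).
  by apply: measurable_sqmodC; exact: measurable_tnthC.
have [c /andP[c0 c1] gc] := prob_lt_small (mg 0) (density_neq0 (chG_density ch k 0)) e0.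
have gct t : (Pr [set w | (sqmodC (tnth (chG ch k t w) ord0) < c)%R] <= e%:E)%E.
  apply: le_trans gc; rewrite le_eqVlt; apply/orP; left; apply/eqP.
  apply: (chG_id ch k t (B := [set v | sqmodC (tnth v ord0) < c])).
  apply: measurable_bool_set; apply: measurable_fun_ltr => //.
  by apply: measurable_sqmodC; exact: measurable_tnth.
pose pb := unjammed_prob k + e.
have Hpb t : (Pr (~` [set w | strongly_jammed ch k c t w]) <= pb%:E)%E.
  have mgt : measurable [set w | sqmodC (tnth (chG ch k t w) ord0) < c].
    by apply: measurable_bool_set; exact: measurable_fun_ltr.
  apply: (@le_trans _ _ (Pr ([set w | ~~ tnth (chS ch t w) k] `|`
      [set w | (sqmodC (tnth (chG ch k t w) ord0) < c)%R]))).
    apply: le_measure; rewrite ?inE.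
    - apply: measurableC; apply: measurable_bool_set; apply: measurable_and.
        exact: measurable_jam.
      exact: measurable_fun_ler.
    - by apply: measurableU => //; exact: measurable_unjammed.
    - move=> w /= /negP; rewrite negb_and -ltNge => /orP[]; by [left|right].
  apply: (le_trans (measureU2 _ _ _)) => //; first exact: measurable_unjammed.
  have h : (Pr [set w | ~~ tnth (chS ch t w) k] <= (unjammed_prob k)%:E)%E.
    by rewrite prob_unjammed.
  exact: leeD h (gct t).
pose C := ln (pi / c) + ln pi * pb + 2 * (ln 3 + (Mh + 1 + (Mg + 16) + 8)).
exists C => P r P1 [m [cd [pw rk er]]].
have P0 : 0 < P by exact: lt_le_trans P1.
pose K := loss_bound P c Mh Mg pb.
have KE : K = (unjammed_prob k + e) * ln P + C.
  by rewrite /K /loss_bound (@lnM _ pi P) ?posrE ?pi_gt0// /C /pb; ring.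
rewrite -KE leNgt; apply/negP => Kr.
(* The bound on the mean loss needs a time index, which the code of length 1 provides. *)
have K0 : 0 <= K.
  exact: mean_le_ge0 (mean_loss P1 c0 c1 HMh HMg Hpb (pw 1%N) ord0).
(* An exponent strictly between the mean loss and the rate. Below the rate, exp(n g) divided by the
   number of messages tends to 0; above the mean loss, Markov's bound K / g is less than 1 by [dl].
   Error and guessing term are each brought below dl / 3, which contradicts their sum being at least
   [dl]. *)
pose g := (K + r k) / 2.
have Kg : K < g by rewrite /g; lra.
have gr : g < r k by rewrite /g; lra.
have g0 : 0 < g by exact: le_lt_trans Kg.
pose h := (r k - g) / 2.
have h0 : 0 < h by rewrite /h; lra.
pose dl := 1 - K / g.
have dl0 : 0 < dl by rewrite subr_gt0 ltr_pdivrMr// mul1r.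
have d3 : 0 < dl / 3 by rewrite divr_gt0.
have n1 : \forall n \near \oo, g + h <= ln (m n k).+1%:R / n%:R.
  by move/cvgr_ge : (rk k); apply; rewrite /h; lra.
have n2 : \forall n \near \oo, (error_prob ch P (cd n) k <= (dl / 3)%:E)%E.
  have /fine_cvgP[fe /cvgr_le/(_ _ d3) ce] := er k.
  near=> n; rewrite -(fineK (_ : error_prob ch P (cd n) k \is a fin_num)); last by near: n.
  by rewrite lee_fin; near: n.
(* Used through exp(-n h) <= 1 / (1 + n h), which is then at most dl / 3. *)
have n3 : \forall n \near \oo, (3 / dl / h <= n%:R :> R).
  near=> n; near: n; exact: nbhs_infty_ger.
have n4 : \forall n \near \oo, (0 < n)%N by exact: nbhs_infty_gt.
have /filter_ex[n [[hn1 hn2] [hn3 hn4]]] : \forall n \near \oo,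
    (g + h <= ln (m n k).+1%:R / n%:R /\ (error_prob ch P (cd n) k <= (dl / 3)%:E)%E) /\
    (3 / dl / h <= n%:R :> R /\ (0 < n)%N).
  by apply: filterI; exact: filterI.
have := error_prob_ge P1 c0 c1 HMh HMg Hpb (pw n) g0 hn4.
have n0R : 0 < n%:R :> R by rewrite ltr0n.
have M0 : 0 < (m n k).+1%:R :> R by [].
have : expR (n%:R * g) / (m n k).+1%:R <= dl / 3.
  rewrite -[X in _ / X]lnK ?posrE// -expRN -expRD.
  apply: (@le_trans _ _ (expR (- (n%:R * h)))).
    rewrite ler_expR; move: hn1; rewrite ler_pdivlMr// => hn1.
    lra.
  rewrite expRN -[leRHS]invrK lef_pV2 ?posrE ?expR_gt0 ?invr_gt0//.
  apply: le_trans (expR_ge1Dx _); move: hn3; rewrite ler_pdivrMr// => hn3.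
  by rewrite invf_div; lra.
move=> b1 b2.
have : (1 <= (dl / 3)%:E + (dl / 3)%:E + (K / g)%:E)%E.
  apply: le_trans b2 _; apply: leeD => //; apply: leeD => //.
rewrite -!EFinD lee_fin; move: dl0; rewrite /dl; lra.
Unshelve. all: by end_near. Qed.

Lemma dof_region_sub csit jsit :
  dof_region ch csit jsit `<=` [set dd : R * R |
    [/\ 0 <= dd.1, 0 <= dd.2, dd.1 <= unjammed_prob ord0 &
        dd.2 <= unjammed_prob ord_max]].
Proof.
have key (r : R -> user -> R) k (dk : R) :
    (forall P, 0 < P -> achievable ch csit jsit P (r P)) ->
    r P k / ln P @[P --> +oo] --> dk -> 0 <= dk <= unjammed_prob k.
  move=> ra rd; apply/andP; split; rewrite leNgt; apply/negP => dlt.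
    have /cvgr_lt/(_ _ dlt) n1 := rd.
    have n2 := @nbhs_pinfty_gt R 1 (num_real _).
    have /filter_ex[P [h1 h2]] : \forall P \near +oo, r P k / ln P < 0 /\ 1 < P.
      exact: filterI.
    move: h1; rewrite ltNge divr_ge0//.
      exact: achievable_rate_ge0 (ra _ (lt_trans ltr01 h2)).
    by rewrite ln_ge0// ltW.
  (* A quarter of the excess: the limit, the rate bound and the constant [C] lose [e] each once [P]
     exceeds exp(C / e), and 4 e < 3 e is absurd. *)
  pose e := (dk - unjammed_prob k) / 4.
  have e0 : 0 < e by rewrite divr_gt0// subr_gt0.
  have [C HC] := achievable_rate_le csit jsit k e0.
  have n1 : \forall P \near +oo, dk - e < r P k / ln P.
    by move/cvgr_gt : rd; apply; rewrite ltrBlDr ltrDl.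
  have n2 := @nbhs_pinfty_gt R 1 (num_real _).
  have n3 := @nbhs_pinfty_gt R (expR (C / e)) (num_real _).
  have /filter_ex[P [[h1 h2] h3]] : \forall P \near +oo,
      (dk - e < r P k / ln P /\ 1 < P) /\ expR (C / e) < P.
    by apply: filterI => //; exact: filterI.
  have P0 : 0 < P by exact: lt_trans h2.
  have l0 : 0 < ln P by rewrite ln_gt0.
  have := HC P (r P) (ltW h2) (ra _ P0).
  move: h1; rewrite ltr_pdivlMr// => h1 h4.
  have : C / e < ln P by rewrite -[X in X < _]expRK ltr_ln ?posrE ?expR_gt0.
  rewrite ltr_pdivrMr// => h5.
  have h6 : (dk - e) * ln P < (unjammed_prob k + e + e) * ln P.
    by apply: lt_trans h1 _; apply: (le_lt_trans h4); rewrite [ltRHS]mulrDl ltrD2l mulrC.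
  move: h6; rewrite ltr_pM2r// /e; lra.
move=> [d1 d2] [r [ra r1 r2]] /=.
have /andP[? ?] := key r ord0 d1 ra r1.
by have /andP[? ?] := key r ord_max d2 ra r2.
Qed.

End Converse.

(** * Weak law of large numbers *)

Section WeakLaw.
Context d (T : measurableType d) (R : realType) (Pr : probability T R).
Variables (A : nat -> set T).
Hypothesis mA : forall t, measurable (A t).
Hypothesis indA : forall s t, s != t -> (Pr (A s `&` A t) = Pr (A s) * Pr (A t))%E.

Definition occurrences (n : nat) (w : T) : R := \sum_(t < n) \1_(A t) w.

Lemma measurable_occurrences n : measurable_fun setT (occurrences n).
Proof. by apply: measurable_sum => t; exact: measurable_indic. Qed.

Let p t := fine (Pr (A t)).

Let pE t : Pr (A t) = (p t)%:E.
Proof. by rewrite /p fineK// fin_num_measure. Qed.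

Let p0 t : 0 <= p t. Proof. exact: fine_ge0. Qed.

Let p1 t : p t <= 1.
Proof. by rewrite -lee_fin -pE probability_le1. Qed.

Let int_indic (B : set T) : measurable B -> (\int[Pr]_w (\1_B w)%:E = Pr B)%E.
Proof. by move=> mB; rewrite integral_indic// setIT. Qed.

Lemma integral_occurrences n :
  (\int[Pr]_w (occurrences n w)%:E = (\sum_(t < n) p t)%:E)%E.
Proof.
rewrite /occurrences; under eq_integral do rewrite -sumEFin.
rewrite ge0_integral_sum//=.
- by rewrite -sumEFin; apply: eq_bigr => t _; rewrite int_indic.
- by move=> t; apply/measurable_EFinP; exact: measurable_indic.
Qed.

(** Off the diagonal the probabilities factor by pairwise independence; the [n] diagonal terms
    contribute at most 1 each. *)
Lemma integral_occurrences_sqr n :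
  (\int[Pr]_w (occurrences n w ^+ 2)%:E <= ((\sum_(t < n) p t) ^+ 2 + n%:R)%:E)%E.
Proof.
have E w : (occurrences n w ^+ 2)%:E =
    (\sum_(s < n) \sum_(t < n) (\1_(A s `&` A t) w)%:E)%E.
  rewrite expr2 /occurrences big_distrlr/= -sumEFin; apply: eq_bigr => s _.
  by rewrite -sumEFin; apply: eq_bigr => t _; rewrite indicI.
under eq_integral do rewrite E.
rewrite ge0_integral_sum//=; last 2 first.
- move=> s; apply: emeasurable_sum => t; apply/measurable_EFinP.
  by apply: measurable_indic; exact: measurableI.
- by move=> s w _; apply: sume_ge0 => t _; rewrite lee_fin.
have -> : ((\sum_(t < n) p t) ^+ 2 + n%:R)%:E =
    (\sum_(s < n) \sum_(t < n) (p s * p t + (s == t)%:R)%:E)%E.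
  rewrite expr2 big_distrlr/= -[n in n%:R](card_ord n) -sum1_card natr_sum -big_split/=.
  rewrite -sumEFin; apply: eq_bigr => s _; rewrite sumEFin big_split/=; congr (_ + _)%:E.
  by rewrite (bigD1 s)//= eqxx big1 ?addr0// => t /negPf; rewrite eq_sym => ->.
apply: lee_sum => s _; rewrite ge0_integral_sum//=; last first.
  by move=> t; apply/measurable_EFinP; apply: measurable_indic; exact: measurableI.
apply: lee_sum => t _; rewrite int_indic; last exact: measurableI.
have [->|st] := eqVneq s t.
  rewrite setIid pE lee_fin (le_trans (p1 t))// lerDr.
  exact: mulr_ge0.
by rewrite indA// !pE -EFinM addr0.
Qed.

Lemma mean_le_variance n :
  mean_le Pr (fun w => (occurrences n w - \sum_(t < n) p t) ^+ 2) n%:R.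
Proof.
set N := occurrences n; set mu := \sum_(t < n) p t.
have mN : measurable_fun setT N by exact: measurable_occurrences.
have N0 w : 0 <= N w by apply: sumr_ge0.
have mu0 : 0 <= mu by apply: sumr_ge0.
split; [|by move=> w; exact: sqr_ge0|].
  by apply: measurable_funX; apply: measurable_funB.
have mV : measurable_fun setT (fun w => ((N w - mu) ^+ 2)%:E).
  by apply/measurable_EFinP; apply: measurable_funX; apply: measurable_funB.
have m2 : measurable_fun setT (fun w => (2 * mu * N w)%:E).
  by apply/measurable_EFinP; apply: measurable_funM.
have mN2 : measurable_fun setT (fun w => (N w ^+ 2)%:E).
  by apply/measurable_EFinP; apply: measurable_funX.
(* The cross term is moved to the left, so that all integrands are nonnegative and no extended reals
   are subtracted. *)
have : (\int[Pr]_w ((N w - mu) ^+ 2)%:E + \int[Pr]_w (2 * mu * N w)%:E =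
    \int[Pr]_w (N w ^+ 2)%:E + (mu ^+ 2)%:E)%E.
  rewrite -ge0_integralD//=; last 2 first.
  - by move=> w _; rewrite lee_fin sqr_ge0.
  - by move=> w _; rewrite lee_fin !mulr_ge0.
  rewrite -[X in (_ + X)%E](_ : (\int[Pr]_w (mu ^+ 2)%:E = _)%E); last first.
    rewrite (integral_cst _ measurableT (mu ^+ 2)%:E).
    by rewrite [X in (_ * X)%E]probability_setT mule1.
  rewrite -ge0_integralD//=; last 2 first.
  - by move=> w _; rewrite lee_fin sqr_ge0.
  - by move=> w _; rewrite lee_fin sqr_ge0.
  by apply: eq_integral => w _; rewrite -!EFinD; congr _%:E; ring.
have -> : (\int[Pr]_w (2 * mu * N w)%:E = (2 * mu * mu)%:E)%E.
  under eq_integral do rewrite EFinM.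
  rewrite ge0_integralZl//=.
  - by rewrite integral_occurrences -EFinM.
  - exact/measurable_EFinP.
  - by move=> w _; rewrite lee_fin.
  - by rewrite lee_fin !mulr_ge0.
have := integral_occurrences_sqr n; rewrite -/N -/mu.
case: (\int[Pr]_w (N w ^+ 2)%:E)%E => [r||]//=.
  case: (\int[Pr]_w _)%E => [r'||]//=.
  rewrite -!EFinD !lee_fin => h1 [h2]; move: h1 h2; rewrite expr2 -mulrA.
  by generalize (mu * mu) => x h1 h2; lra.
by case: (\int[Pr]_w _)%E => [r'||]//= _ _; rewrite leNye.
Qed.

(** Chebyshev's inequality with variance at most [n] gives the bound 1 / (h^2 n). The probabilities
    may vary with time. *)
Lemma occurrences_cvg0 (a h : R) : (forall t, (Pr (A t) <= a%:E)%E) -> 0 < h ->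
  (Pr [set w | (n%:R * (a + h) <= occurrences n w)%R] @[n --> \oo] --> 0)%E.
Proof.
move=> Aa h0.
have pa t : p t <= a by rewrite -lee_fin -pE.
apply: (@squeeze_cvge _ _ _ _ (fun=> 0%E) _ (fun n => ((h ^+ 2)^-1 * n%:R^-1)%:E)).
- near=> n; rewrite measure_ge0/=.
  have n0 : 0 < n%:R :> R by rewrite ltr0n; near: n; exact: nbhs_infty_gt.
  have nh : 0 < (n%:R * h) ^+ 2 by rewrite exprn_gt0// mulr_gt0.
  have := mean_le_markov (mean_le_variance n) nh.
  have -> : n%:R / (n%:R * h) ^+ 2 = (h ^+ 2)^-1 * n%:R^-1.
    by field; rewrite ?gt_eqF.
  apply: le_trans; apply: le_measure; rewrite ?inE.
  - by apply: measurable_bool_set; apply: measurable_fun_ler => //; exact: measurable_occurrences.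
  - apply: measurable_bool_set; apply: measurable_fun_ler => //.
    by apply: measurable_funX; apply: measurable_funB => //; exact: measurable_occurrences.
  move=> w /= hw.
  have ma : \sum_(t < n) p t <= n%:R * a.
    by rewrite mulr_natl -[n in _ *+ n](card_ord n) -sumr_const; apply: ler_sum.
  have : n%:R * h <= occurrences n w - \sum_(t < n) p t by lra.
  have nh0 : 0 <= n%:R * h by apply: mulr_ge0 => //; exact: ltW.
  by move=> le; rewrite ler_sqr// nnegrE//; exact: le_trans le.
- exact: cvg_cst.
- apply: cvg_EFin; first by near=> n.
  rewrite -[X in _ --> X](mulr0 (h ^+ 2)^-1); apply: cvgMl_tmp.
  by rewrite gtr0_cvgV0; [exact: cvgr_idn|near=> n; rewrite ltr0n; near: n; exact: nbhs_infty_gt].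
Unshelve. all: by end_near. Qed.

End WeakLaw.

(** * Jamming, noise and fading events *)

(** Orthogonal to [h] for the bilinear [dotC], hence no conjugation. *)
Definition perp (R : realType) (h : vec2 R) : vec2 R :=
  [tuple tnth h ord_max; - tnth h ord0].

(** The determinant of the channel matrix up to sign, so its modulus is the same for both users. *)
Definition gain (R : realType) (k : user) (h : csi R) : R[i] :=
  dotC (tnth h k) (perp (tnth h (rev_ord k))).

Lemma dotC_perpE (R : realType) (h g : vec2 R) : dotC h (perp g) =
  tnth h ord0 * tnth g ord_max - tnth h ord_max * tnth g ord0.
Proof.
rewrite dotCE (_ : tnth (perp g) ord0 = tnth g ord_max)//.
by rewrite (_ : tnth (perp g) ord_max = - tnth g ord0)// mulrN.
Qed.

Lemma measurable_perp d (T : measurableType d) (R : realType) (f : T -> vec2 R) :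
  measurable_fun setT f -> measurable_fun setT (fun w => perp (f w)).
Proof.
move=> mf.
rewrite (_ : (fun w => _) = fun w => [tuple tnth (perp (f w)) i | i < 2]); last first.
  by apply/funext => w; apply: eq_from_tnth => i; rewrite tnth_mktuple.
apply: measurable_mktuple => i.
have [->|i0] := eqVneq i ord0; first exact: (measurable_tnthC ord_max mf).
have -> : i = ord_max by apply/val_inj; case: i i0 => -[|[|]].
by apply: measurable_funNC; exact: measurable_tnthC.
Qed.

Lemma measurable_gain d (T : measurableType d) (R : realType) k (f : T -> csi R) :
  measurable_fun setT f -> measurable_fun setT (fun w => gain k (f w)).
Proof.
move=> mf; apply: measurable_dotC; first exact: measurable_tnthC.
by apply: measurable_perp; exact: measurable_tnthC.
Qed.

Lemma ge0_integral_id d (T : measurableType d) (R : realType) (Pr : probability T R)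
    d' (U : measurableType d') (X : nat -> {RV Pr >-> U}) (F : U -> \bar R) t :
  identically_distributed Pr X -> measurable_fun setT F -> (forall x, 0 <= F x)%E ->
  (\int[Pr]_w F (X t w) = \int[Pr]_w F (X 0%N w))%E.
Proof.
move=> Xid mF F0.
transitivity (\int[distribution Pr (X t)]_x F x)%E.
  by rewrite ge0_integral_distribution.
rewrite -[RHS]ge0_integral_distribution//.
by apply: eq_measure_integral => A mA _; exact: Xid.
Qed.

Lemma sqmodC_le0 (R : realType) (z : R[i]) : sqmodC z <= 0 -> z = 0.
Proof.
rewrite le_eqVlt ltNge sqmodC_ge0 orbF /sqmodC paddr_eq0 ?sqr_ge0// !sqrf_eq0.
by case: z => a b /andP[/= /eqP -> /eqP ->].
Qed.

Lemma sqmodCN (R : realType) (z : R[i]) : sqmodC (- z) = sqmodC z.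
Proof. by case: z => a b; rewrite /sqmodC/= !sqrrN. Qed.

Lemma complexE (R : realType) (z : R[i]) : complex.Re z +i* complex.Im z = z.
Proof. by case: z. Qed.

Lemma integral_indic_preimage d (T : measurableType d) (R : realType)
    (Pr : probability T R) d' (U : measurableType d') (f : T -> U) (B : set U) :
  measurable_fun setT f -> measurable B ->
  (\int[Pr]_w (\1_B (f w))%:E = Pr (f @^-1` B))%E.
Proof.
move=> mf mB; rewrite -[f @^-1` B]setIT -integral_indic//.
by rewrite -[X in measurable X]setTI; exact: mf.
Qed.

Section Events.
Context d (T : measurableType d) (R : realType) (Pr : probability T R)
  (lam : bool -> bool -> R) (ch : jammed_bc Pr lam).
Variable (k : user).
(** The events below involve neither the jammer's signal nor the messages, so power 1 and trivial
    message sets serve. *)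
Local Notation known J := (known_sources ch 1 (fun=> 0%N) J).

Definition jam_event (t : nat) : set T := [set w | tnth (chS ch t w) k].

Definition noise_event (a : R) (t : nat) : set T :=
  [set w | a < sqmodC (chN ch k t w)].

Definition cross_gain (t : nat) (w : T) : R[i] :=
  dotC (chH ch k t w) (perp (chH ch (rev_ord k) t w)).

Definition fade_event (b : R) (t : nat) : set T :=
  [set w | sqmodC (cross_gain t w) < b].

Lemma independent_events (J : nat -> set source) (A : nat -> set T) :
  (forall t, measurable (A t : set (known (J t)))) ->
  (forall s t, s != t -> [disjoint J s & J t]) ->
  (forall t, measurable (A t)) /\
  forall s t, s != t -> (Pr (A s `&` A t) = Pr (A s) * Pr (A t))%E.
Proof.
move=> mA dJ; split=> [t|s t st].
  have := @measurable_known _ _ _ _ _ ch 1 (fun=> 0%N) (J t) measurableT _ (mA t).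
  by rewrite setTI.
exact: (independent_known_sources ltr01 (dJ _ _ st)).
Qed.

Lemma jam_occurrences_cvg0 (h : R) : 0 < h ->
  (Pr [set w | (n%:R * (1 - unjammed_prob lam k + h) <= occurrences R jam_event n w)%R]
    @[n --> \oo] --> 0)%E.
Proof.
move=> h0.
have [|s t st|mA indA] := @independent_events (fun t => [set SrcS t]) jam_event.
- move=> t; apply: measurable_bool_set; apply: measurable_tnthC.
  exact: measurable_known_chS.
- apply/disj_set2P/seteqP; split => // _ [-> [E]].
  by rewrite E eqxx in st.
apply: occurrences_cvg0 => // t.
rewrite (_ : jam_event t = ~` [set w | ~~ tnth (chS ch t w) k]); last first.
  apply/seteqP; split => w /=; first by move=> jw; apply/negP; rewrite negbK.
  by move/negP; rewrite negbK.
rewrite probability_setC; last exact: measurable_unjammed.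
by rewrite prob_unjammed.
Qed.

(** Markov's inequality for the second moment bound 8; the threshold depends on neither time nor
    power. *)
Lemma noise_prob_le (e : R) t : 0 < e -> (Pr (noise_event (8 / e) t) <= e%:E)%E.
Proof.
move=> e0.
have mN : mean_le Pr (fun w => sqmodC (chN ch k t w)) 8.
  split; first exact: measurable_sqmodC.
    by move=> w; exact: sqmodC_ge0.
  have := circular_gaussian_sqmod_le (chN_law ch k t) ltr01.
  by rewrite mulr1.
have := mean_le_markov mN (divr_gt0 (ltr0Sn R 7) e0).
rewrite invf_div mulrCA divff// mulr1; apply: le_trans.
apply: le_measure; rewrite ?inE.
- by apply: measurable_bool_set; apply: measurable_fun_ltr => //; exact: measurable_sqmodC.
- by apply: measurable_bool_set; apply: measurable_fun_ler => //; exact: measurable_sqmodC.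
- by move=> w /ltW.
Qed.

Lemma noise_occurrences_cvg0 (a e h : R) :
  (forall t, (Pr (noise_event a t) <= e%:E)%E) -> 0 < h ->
  (Pr [set w | (n%:R * (e + h) <= occurrences R (noise_event a) n w)%R]
    @[n --> \oo] --> 0)%E.
Proof.
move=> ae h0.
have [|s t st|mA indA] := @independent_events (fun t => [set SrcN k t]) (noise_event a).
- move=> t; apply: measurable_bool_set; apply: measurable_fun_ltr => //.
  by apply: measurable_sqmodC; exact: measurable_known_chN.
- apply/disj_set2P/seteqP; split => // _ [-> [E]].
  by rewrite E eqxx in st.
exact: occurrences_cvg0.
Qed.

Let J (t : nat) : set source := [set SrcH k t; SrcH (rev_ord k) t].

Lemma rev_ord_neq : rev_ord k != k.
Proof. by rewrite -val_eqE; case: (k) => -[|[|]]. Qed.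

Lemma measurable_known_cross_gain t :
  measurable_fun (setT : set (known (J t))) (cross_gain t).
Proof.
apply: measurable_dotC; first by apply: measurable_known_chH; left.
by apply: measurable_perp; apply: measurable_known_chH; right.
Qed.

Lemma fade_occurrences_cvg0 (b e h : R) :
  (forall t, (Pr (fade_event b t) <= e%:E)%E) -> 0 < h ->
  (Pr [set w | (n%:R * (e + h) <= occurrences R (fade_event b) n w)%R]
    @[n --> \oo] --> 0)%E.
Proof.
move=> ae h0.
have [|s t st|mA indA] := @independent_events J (fade_event b).
- move=> t; apply: measurable_bool_set; apply: measurable_fun_ltr => //.
  by apply: measurable_sqmodC; exact: measurable_known_cross_gain.
- apply/disj_set2P/seteqP; split => // x [[->|->] [|]];
    by [case=> E; rewrite E eqxx in st|case=> E _; move: rev_ord_neq; rewrite -E eqxx|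
        case=> E _; move: rev_ord_neq; rewrite E eqxx].
exact: occurrences_cvg0.
Qed.

Lemma ge0_integral_cross (F : vec2 R * vec2 R -> \bar R) t :
  measurable_fun setT F -> (forall x, 0 <= F x)%E ->
  (\int[Pr]_w F (chH ch (rev_ord k) t w, chH ch k t w) =
   \int[Pr]_w \int[Pr]_v F (chH ch (rev_ord k) t w, chH ch k t v))%E.
Proof.
move=> mF F0.
rewrite (@ge0_integral_known _ _ _ _ _ ch 1 ltr01 (fun=> 0%N) _ _ (chH ch k t)
  [set SrcH (rev_ord k) t] (SrcH k t)
  (fun p => F (chH ch (rev_ord k) t p.1, p.2)))//.
- by case=> E; move: rev_ord_neq; rewrite -E eqxx.
- apply: (measurableT_comp mF); apply: measurable_fun_pair => //.
  apply: (measurableT_comp _ (@measurable_fst _ _ _ _)).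
  by apply: (@measurable_known_chH _ _ _ _ _ ch).
Qed.


(** Identical distribution over time is given for each user alone; independence of the users lifts
    it to the pair. *)
Lemma cross_integral_id (F : vec2 R * vec2 R -> \bar R) t :
  measurable_fun setT F -> (forall x, 0 <= F x)%E ->
  (\int[Pr]_w F (chH ch (rev_ord k) t w, chH ch k t w) =
   \int[Pr]_w F (chH ch (rev_ord k) 0 w, chH ch k 0 w))%E.
Proof.
move=> mF F0; rewrite (ge0_integral_cross t mF F0) (ge0_integral_cross 0 mF F0).
have mG (g : vec2 R) : measurable_fun setT (fun x => F (g, x)).
  by apply: (measurableT_comp mF); exact: measurable_pair1.
transitivity (\int[Pr]_w \int[Pr]_v F (chH ch (rev_ord k) t w, chH ch k 0 v))%E.
  apply: eq_integral => w _.
  exact: (ge0_integral_id (F := fun x => F (_, x)) t (chH_id ch k)).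
apply: (ge0_integral_id (F := fun g => (\int[Pr]_v F (g, chH ch k 0 v))%E) t
  (chH_id ch (rev_ord k))); last by move=> x; apply: integral_ge0.
apply: (@measurable_fun_fubini_tonelli_F _ _ _ _ _ Pr
  (fun p => F (p.1, chH ch k 0 p.2))) => //.
apply: (measurableT_comp mF); apply: measurable_fun_pair => //.
by apply: measurableT_comp.
Qed.

(** The channels with zero gain against [g] form the graph of a linear map, multiplication by [z]:
    given the first entry, the second is a single point. *)
Lemma perp_null (g : vec2 R) t : 0 < sqmodC (tnth g ord0) ->
  Pr [set w | sqmodC (dotC (chH ch k t w) (perp g)) <= 0] = 0%E.
Proof.
move=> g0.
have gn0 : tnth g ord0 != 0.
  by apply/eqP => g00; move: g0; rewrite g00 /sqmodC expr0n addr0 ltxx.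
pose z := tnth g ord_max / tnth g ord0.
pose N : set ((R * R) * (R * R)) :=
  [set x | sqmodC ((x.2.1 +i* x.2.2) - (x.1.1 +i* x.1.2) * z) <= 0].
have mN : measurable N.
  apply: measurable_bool_set; apply: measurable_fun_ler => //.
  apply: measurable_sqmodC; apply: measurable_funDC.
    by apply: measurable_Complex; apply: measurableT_comp => //; apply: measurable_snd.
  apply: measurable_funNC; apply: measurable_funMC => //.
  by apply: measurable_Complex; apply: measurableT_comp => //; apply: measurable_fst.
rewrite -[RHS](density_null (chH_density ch k t) mN).
  congr (Pr _); apply/eq_set => w; rewrite /N/= !complexE dotC_perpE.
  set u := tnth (chH ch k t w) ord0; set v := tnth (chH ch k t w) ord_max.
  rewrite (_ : u * _ - _ = - tnth g ord0 * (v - u * z)); last by rewrite /z; field.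
  by rewrite sqmodCM sqmodCN pmulr_rle0.
apply: (@product_null_sections _ (measurableTypeR R) R lebesgue_measure N _ mN) => x.
exists [set complex.Re ((x.1 +i* x.2) * z)]; split.
- exact: measurable_set1.
- exact: lebesgue_measure_set1.
- move=> y; rewrite /xsection/= inE /N/= => /sqmodC_le0/subr0_eq <-.
  by split.
Qed.

Let faded (b : R) : set (vec2 R * vec2 R) := [set p | sqmodC (dotC p.2 (perp p.1)) < b].

Let zero_gain : set (vec2 R * vec2 R) := [set p | sqmodC (dotC p.2 (perp p.1)) <= 0].

Let measurable_sqmod_cross :
  measurable_fun setT (fun p : vec2 R * vec2 R => sqmodC (dotC p.2 (perp p.1))).
Proof.
apply: measurable_sqmodC; apply: measurable_dotC; first exact: measurable_snd.
by apply: measurable_perp; exact: measurable_fst.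
Qed.

Let mfaded b : measurable (faded b).
Proof. by apply: measurable_bool_set; exact: measurable_fun_ltr. Qed.

Let mzero_gain : measurable zero_gain.
Proof. by apply: measurable_bool_set; exact: measurable_fun_ler. Qed.

Let measurable_cross t :
  measurable_fun setT (fun w => (chH ch (rev_ord k) t w, chH ch k t w)).
Proof. exact: measurable_fun_pair. Qed.

Lemma cross_gain_neq0 t : Pr [set w | sqmodC (cross_gain t w) <= 0] = 0%E.
Proof.
pose F (p : vec2 R * vec2 R) : \bar R := (\1_zero_gain p)%:E.
have mF : measurable_fun setT F by apply/measurable_EFinP; exact: measurable_indic.
have F0 x : (0 <= F x)%E by rewrite lee_fin.
have mF2 : measurable_fun setT (fun w => (\int[Pr]_v F (chH ch (rev_ord k) t w, chH ch k t v))%E).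
  apply: (@measurable_fun_fubini_tonelli_F _ _ _ _ _ Pr
    (fun p => F (chH ch (rev_ord k) t p.1, chH ch k t p.2))) => //.
  apply: (measurableT_comp mF); apply: measurable_fun_pair; exact: measurableT_comp.
rewrite -[LHS](integral_indic_preimage Pr (measurable_cross t) mzero_gain).
rewrite (ge0_integral_cross t mF F0).
apply/eqP; rewrite eq_le integral_ge0 ?andbT; last by move=> w _; apply: integral_ge0.
have mg : measurable_fun setT (fun w => tnth (chH ch (rev_ord k) t w) ord0).
  exact: measurable_tnthC.
have mg0 : measurable [set z : R[i] | sqmodC z <= 0].
  by apply: measurable_bool_set; apply: measurable_fun_ler => //; exact: measurable_sqmodC.
(* The right-hand 0 is rewritten as the probability that the first entry of the other channel
   vanishes. Its indicator dominates the inner integral: where it is 0, [perp_null] applies, and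
   elsewhere a probability is at most 1. *)
rewrite -(density_neq0 (chH_density ch (rev_ord k) t)).
rewrite -(integral_indic_preimage Pr mg mg0).
apply: ge0_le_integral => //.
- by move=> w _; apply: integral_ge0.
- by apply/measurable_EFinP; apply: (measurableT_comp _ mg); exact: measurable_indic.
move=> w _; rewrite indicE; case: (ltP 0 (sqmodC (tnth (chH ch (rev_ord k) t w) ord0))) => g0.
  rewrite [leLHS](_ : _ = 0%E) ?lee_fin// -(perp_null t g0).
  apply: (integral_indic_preimage Pr (f := fun v => (chH ch (rev_ord k) t w, chH ch k t v))) => //.
  exact: measurable_fun_pair.
have mp : measurable_fun setT (fun v => (chH ch (rev_ord k) t w, chH ch k t v)).
  exact: measurable_fun_pair.
rewrite mem_set// (integral_indic_preimage Pr mp mzero_gain).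
by apply: probability_le1; rewrite -[X in measurable X]setTI; exact: mp.
Qed.

Lemma fade_prob_le (e : R) : 0 < e ->
  exists2 b, 0 < b & forall t, (Pr (fade_event b t) <= e%:E)%E.
Proof.
move=> e0.
have mc : measurable_fun setT (fun w => sqmodC (cross_gain 0 w)).
  exact: (measurableT_comp measurable_sqmod_cross (measurable_cross 0)).
have [b /andP[b0 _] be] := prob_lt_small mc (cross_gain_neq0 0) e0.
exists b => // t; apply: le_trans be.
pose F (p : vec2 R * vec2 R) : \bar R := (\1_(faded b) p)%:E.
have mF : measurable_fun setT F by apply/measurable_EFinP; exact: measurable_indic.
have F0 x : (0 <= F x)%E by rewrite lee_fin.
rewrite -[leLHS](integral_indic_preimage Pr (measurable_cross t) (mfaded b)).
by rewrite (cross_integral_id t mF F0) (integral_indic_preimage Pr (measurable_cross 0) (mfaded b)).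
Qed.

End Events.

(** * Zero-forcing codes *)

Lemma dotC_perp (R : realType) (h : vec2 R) : dotC h (perp h) = 0.
Proof. by rewrite dotC_perpE mulrC subrr. Qed.

Lemma sum_user (V : nmodType) (k : user) (f : user -> V) :
  \sum_(l < 2) f l = f k + f (rev_ord k).
Proof.
rewrite (bigD1 k)//=; congr (_ + _); rewrite (big_pred1 (rev_ord k))//.
by move=> l; apply/idP/idP; case: k l => -[|[|//]] ? [[|[|//]] ?].
Qed.

Lemma rev_ordK2 (k : user) : rev_ord (rev_ord k) = k.
Proof. exact: rev_ordK. Qed.

Section ZeroForcing.
Context (R : realType).
Implicit Types (h : csi R) (u : user -> R[i]).

(* Each user's symbol is sent orthogonally to the other user's channel. *)
Definition beamform h u : vec2 R :=
  [tuple \sum_(k < 2) u k * tnth (perp (tnth h (rev_ord k))) i | i < 2].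

Lemma dotC_beamform h u k : dotC (tnth h k) (beamform h u) = u k * gain k h.
Proof.
rewrite /dotC; under eq_bigr do rewrite tnth_mktuple mulr_sumr.
rewrite exchange_big/= (sum_user k) rev_ordK2.
rewrite [X in _ + X](_ : _ = 0) ?addr0.
  by rewrite /gain /dotC mulr_sumr; apply: eq_bigr => i _; rewrite mulrCA.
rewrite (eq_bigr (fun i => u (rev_ord k) * (tnth (tnth h k) i * tnth (perp (tnth h k)) i))).
  by rewrite -mulr_sumr -/(dotC _ _) dotC_perp mulr0.
by move=> i _; rewrite mulrCA.
Qed.

Lemma sqmodCD2 (x y : R[i]) : sqmodC (x + y) <= 2 * (sqmodC x + sqmodC y).
Proof.
rewrite /sqmodC ReD ImD -subr_ge0.
set a := complex.Re x; set b := complex.Re y; set c := complex.Im x; set e := complex.Im y.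
rewrite (_ : _ - _ = (a - b) ^+ 2 + (c - e) ^+ 2); last by ring.
by rewrite addr_ge0// sqr_ge0.
Qed.

Lemma sqnormC_perp (v : vec2 R) : sqnormC (perp v) = sqnormC v.
Proof.
rewrite !sqnormCE (_ : tnth (perp v) ord0 = tnth v ord_max)//.
by rewrite (_ : tnth (perp v) ord_max = - tnth v ord0)// sqmodCN addrC.
Qed.

Lemma sqnormC_beamform_le h u (U : R) : (forall k, sqmodC (u k) <= U) ->
  sqnormC (beamform h u) <= 2 * U * \sum_(k < 2) sqnormC (tnth h k).
Proof.
move=> uU.
apply: (@le_trans _ _ (\sum_(i < 2) 2 * \sum_(k < 2) U * sqmodC (tnth (perp (tnth h (rev_ord k))) i))).
  apply: ler_sum => i _; rewrite tnth_mktuple !(sum_user ord0).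
  apply: le_trans (sqmodCD2 _ _) _; rewrite ler_wpM2l//; apply: lerD;
    by rewrite sqmodCM ler_wpM2r// sqmodC_ge0.
rewrite -mulr_sumr -mulrA exchange_big/= ler_wpM2l// mulr_sumr.
under eq_bigr do rewrite -mulr_sumr -/(sqnormC _) sqnormC_perp.
by rewrite !(sum_user ord0) rev_ordK2 addrC.
Qed.

End ZeroForcing.

Section ZeroForcingCode.
Context (R : realType) (jsit : knowledge) (n : nat) (m : user -> nat).
Variables (Q : nat) (symbol : 'I_Q -> R[i])
  (word : forall k, 'I_(m k).+1 -> {ffun 'I_n -> 'I_Q}) (a th : R).

Definition misses (k : user) (y : n.-tuple R[i]) (h : n.-tuple (csi R))
    (s : n.-tuple jsi) (w : 'I_(m k).+1) : R :=
  \sum_(t < n) (~~ tnth (tnth s t) k &&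
    (a < sqmodC (tnth y t - symbol (word w t) * gain k (tnth h t))))%:R.

(** [known Perfect t] is [t.+1], so [ord_max] picks the current channel. The jammer state is
    ignored, so one code serves all values of [jsit]. *)
Definition zf_enc (t : 'I_n) (w : forall k, 'I_(m k).+1)
    (h : (known Perfect t).-tuple (csi R)) (_ : (known jsit t).-tuple jsi) : vec2 R :=
  beamform (tnth h ord_max) (fun k => symbol (word (w k) t)).

Definition zf_dec (k : user) (y : n.-tuple R[i]) (h : n.-tuple (csi R))
    (s : n.-tuple jsi) : 'I_(m k).+1 :=
  odflt ord0 [pick w | misses y h s w <= th].

Lemma zf_enc_measurable (t : 'I_n) w : measurable_fun setT
  (fun hs : (known Perfect t).-tuple (csi R) * (known jsit t).-tuple jsi =>
     zf_enc w hs.1 hs.2).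
Proof.
apply: measurable_mktuple => i; rewrite /zf_enc/=.
have mh : measurable_fun setT
  (fun hs : (known Perfect t).-tuple (csi R) * (known jsit t).-tuple jsi =>
     tnth hs.1 (ord_max : 'I_t.+1)).
  by apply: (measurable_tnthC (n := t.+1)); exact: measurable_fst.
under eq_fun do rewrite (sum_user ord0).
by apply: measurable_funDC; apply: measurable_funMC => //; apply: measurable_tnthC;
  apply: measurable_perp; exact: measurable_tnthC.
Qed.

(** The decoder's [pick] depends on its real data only through finitely many threshold tests, and
    any function of those is measurable. *)
Lemma measurable_finite_choice d (T : measurableType d) (I : finType) M
    (b : I -> T -> bool) (F : {ffun I -> bool} -> 'I_M.+1) :
  (forall i, measurable_fun setT (b i)) ->
  measurable_fun setT (fun x => F [ffun i => b i x]).
Proof.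
move=> mb _ B _; rewrite setTI.
rewrite (_ : _ @^-1` _ = \bigcup_(f in [set f | B (F f)])
   \bigcap_(i in [set: I]) [set x | b i x == f i]).
  apply: fin_bigcup_measurable => // f _; apply: fin_bigcap_measurable => // i _.
  apply: measurable_bool_set.
  have := mb i; move=> mi mT D mD; exact: (mi mT ((fun c => c == f i) @^-1` D)).
apply/seteqP; split=> [x Bx|x [f Bf fx]] /=.
  by exists [ffun i => b i x] => // i _ /=; rewrite ffunE.
rewrite (_ : [ffun i => b i x] = f)//.
by apply/ffunP => i; rewrite ffunE; exact/eqP/fx.
Qed.

Lemma zf_dec_measurable k : measurable_fun setT
  (fun yhs : n.-tuple R[i] * (n.-tuple (csi R) * n.-tuple jsi) =>
     zf_dec k yhs.1 yhs.2.1 yhs.2.2).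
Proof.
pose F (f : {ffun 'I_(m k).+1 -> bool}) := odflt ord0 [pick w | f w].
pose b (w : 'I_(m k).+1) (yhs : n.-tuple R[i] * (n.-tuple (csi R) * n.-tuple jsi)) :=
  misses yhs.1 yhs.2.1 yhs.2.2 w <= th.
rewrite (_ : (fun _ => _) = fun x => F [ffun w => b w x]); last first.
  apply/funext => x; rewrite /F /zf_dec; congr (odflt _ _).
  by apply: eq_pick => w; rewrite ffunE.
apply: measurable_finite_choice => w; apply: measurable_fun_ler => //.
have mh : measurable_fun setT
    (fun yhs : n.-tuple R[i] * (n.-tuple (csi R) * n.-tuple jsi) => yhs.2.1).
  exact: (measurableT_comp measurable_fst measurable_snd).
have ms : measurable_fun setT
    (fun yhs : n.-tuple R[i] * (n.-tuple (csi R) * n.-tuple jsi) => yhs.2.2).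
  exact: (measurableT_comp measurable_snd measurable_snd).
apply: measurable_sum => t.
have mc : measurable_fun setT
    (fun yhs : n.-tuple R[i] * (n.-tuple (csi R) * n.-tuple jsi) =>
    ~~ tnth (tnth yhs.2.2 t) k &&
      (a < sqmodC (tnth yhs.1 t - symbol (word w t) * gain k (tnth yhs.2.1 t)))).
  apply: measurable_and.
    by apply: measurable_neg; apply: measurable_tnthC; exact: measurable_tnthC.
  apply: measurable_fun_ltr => //; apply: measurable_sqmodC; apply: measurable_funDC.
    by apply: measurable_tnthC; exact: measurable_fst.
  apply: measurable_funNC; apply: measurable_funMC => //.
  by apply: measurable_gain; exact: measurable_tnthC.
rewrite (_ : (fun _ => _) = fun yhs => if ~~ tnth (tnth yhs.2.2 t) k &&
      (a < sqmodC (tnth yhs.1 t - symbol (word w t) * gain k (tnth yhs.2.1 t)))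
    then 1 else 0); last by apply/funext => x; case: ifP.
exact: measurable_fun_ifT.
Qed.

Definition zf_code : Defs.code R Perfect jsit n m :=
  @Code R Perfect jsit n m zf_enc zf_dec zf_enc_measurable zf_dec_measurable.

End ZeroForcingCode.

(** * Decoding errors *)

Section Decoding.
Context d (T : measurableType d) (R : realType) (Pr : probability T R)
  (lam : bool -> bool -> R) (ch : jammed_bc Pr lam).
Variables (P : R) (jsit : knowledge) (n : nat) (m : user -> nat).
Variables (Q : nat) (symbol : 'I_Q -> R[i])
  (word : forall k, 'I_(m k).+1 -> {ffun 'I_n -> 'I_Q}) (a b eta : R).
Hypothesis separation : forall i j, i != j -> 4 * a < b * sqmodC (symbol i - symbol j).

Local Notation cd := (zf_code jsit symbol word a (n%:R * eta)).
Local Notation jam k := (occurrences R (jam_event ch k) n).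
Local Notation noise k := (occurrences R (noise_event ch k a) n).
Local Notation fade k := (occurrences R (fade_event ch k b) n).

Lemma gain_cross k (t : 'I_n) w :
  gain k (tnth (Hhist ch n w) t) = cross_gain ch k t w.
Proof. by rewrite /gain !tnth_mktuple. Qed.

Lemma latest_csi (t : 'I_n) w l :
  tnth (tnth (Hhist ch (Defs.known Perfect t) w) ord_max) l = chH ch l t w.
Proof.
exact: (etrans (congr1 (fun v => tnth v l) (tnth_mktuple _ (ord_max : 'I_t.+1)))
  (tnth_mktuple _ _)).
Qed.

Lemma zf_output k (t : 'I_n) w : ~~ tnth (chS ch t w) k ->
  output ch P cd k t w =
  symbol (word (chW ch k (m k) w) t) * cross_gain ch k t w + chN ch k t w.
Proof.
move=> /negbTE Sk; rewrite /output Sk mul0r addr0; congr (_ + _).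
by rewrite /input /= /zf_enc -(latest_csi t w k) dotC_beamform /gain !latest_csi.
Qed.

Local Notation missed k w v := (misses symbol word a
  [tuple output ch P cd k t w | t < n] (Hhist ch n w) (Shist ch n w) v).

Lemma misses_correct k w : missed k w (chW ch k (m k) w) <= noise k w.
Proof.
apply: ler_sum => t _; rewrite gain_cross !tnth_mktuple indicE.
case: (boolP (tnth (chS ch t w) k)) => //= Sk.
rewrite zf_output// (addrC (_ * _)) addrK; case: (ltP a _) => //= aN.
by rewrite mem_set.
Qed.

(** Every time is jammed, noisy, faded, an agreement or a miss. At any other time the noise and the
    residual would both have squared modulus at most [a], so their difference, the gain times the
    difference of the symbols, at most 4 a, against [separation]. *)
Lemma misses_incorrect k w (v : 'I_(m k).+1) :
  n%:R <= jam k w + noise k w + fade k w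
    + (agreement (word v) (word (chW ch k (m k) w)))%:R + missed k w v.
Proof.
rewrite /agreement -sum1_card natr_sum.
rewrite (eq_bigl (fun t => word v t == word (chW ch k (m k) w) t)); last first.
  by move=> t; rewrite inE.
rewrite big_mkcond/= -!big_split/=.
apply: (@le_trans _ _ (\sum_(t < n) 1)); first by rewrite sumr_const card_ord.
apply: ler_sum => t _.
rewrite !indicE gain_cross !tnth_mktuple.
set W := chW ch k (m k) w.
have ge0 (c : bool) : 0 <= c%:R :> R by [].
have if0 (c : bool) : 0 <= (if c then 1 else 0 : R) by case: c.
case: (boolP (w \in jam_event ch k t)) => [_|/negP Sk].
  by rewrite /= -!addrA lerDl !addr_ge0.
case: (boolP (w \in noise_event ch k a t)) => [_|/negP Nk].
  by rewrite /= add0r -!addrA lerDl !addr_ge0.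
case: (boolP (w \in fade_event ch k b t)) => [_|/negP Fk].
  by rewrite /= !add0r -!addrA lerDl !addr_ge0.
have [_|vW] := eqVneq (word v t) (word W t).
  by rewrite /= !add0r lerDl.
rewrite /= !add0r.
have {}Sk : ~~ tnth (chS ch t w) k by apply/negP => Sk'; apply: Sk; rewrite inE.
rewrite Sk zf_output// -/W.
have {}Nk : sqmodC (chN ch k t w) <= a.
  by rewrite leNgt; apply/negP => N'; apply: Nk; rewrite inE.
have {}Fk : b <= sqmodC (cross_gain ch k t w).
  by rewrite leNgt; apply/negP => N'; apply: Fk; rewrite inE.
rewrite (_ : (a < _) = true)//; apply/negPn/negP; rewrite -leNgt.
set g := cross_gain ch k t w; set N := chN ch k t w; set y := _ + N - _ => ya.
have := separation vW; rewrite ltNge => /negP; apply.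
apply: (@le_trans _ _ (sqmodC g * sqmodC (symbol (word v t) - symbol (word W t)))).
  by rewrite ler_wpM2r// sqmodC_ge0.
rewrite -sqmodCM (_ : _ * _ = N + - y); last by rewrite /y; ring.
by have := sqmodCD2 N (- y); rewrite sqmodCN; move: Nk ya; rewrite -/N; lra.
Qed.

(** The budget behind 4 eta: for a wrong word that passes the test, jammed, noisy, faded and missed
    times exceed 1 - lambda_k by less than 4 eta in all, so together with the agreements they would
    not fill the [n] times. *)
Lemma zf_dec_correct k w : 
  (forall v v', v != v' -> (agreement (word (k := k) v) (word v'))%:R
      <= n%:R * (unjammed_prob lam k - 4 * eta)) ->
  jam k w < n%:R * (1 - unjammed_prob lam k + eta) ->
  noise k w < n%:R * eta -> fade k w < n%:R * eta ->
  dec cd k [tuple output ch P cd k t w | t < n] (Hhist ch n w) (Shist ch n w)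
  = chW ch k (m k) w.
Proof.
move=> agr jamw noisew fadew.
rewrite /= /zf_dec; case: pickP => [v /= vP|none].
  apply/eqP/negPn/negP => vW; have := misses_incorrect w v.
  have := agr _ _ vW; move: jamw noisew fadew vP.
  set J := jam k w; set N := noise k w; set F := fade k w; set M := missed k w v.
  set A := (agreement _ _)%:R; rewrite !mulrDr !mulrN mulr1.
  set x := n%:R * unjammed_prob lam k; set y := n%:R * eta.
  rewrite (_ : n%:R * (4 * eta) = 4 * y); last by rewrite mulrCA.
  by move=> *; lra.
have := none (chW ch k (m k) w); rewrite /= => /negP; case.
exact: le_trans (misses_correct k w) (ltW noisew).
Qed.

Lemma zf_error_prob k : 
  (forall v v', v != v' -> (agreement (word (k := k) v) (word v'))%:R
      <= n%:R * (unjammed_prob lam k - 4 * eta)) ->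
  (error_prob ch P cd k <=
   Pr [set w | (n%:R * (1 - unjammed_prob lam k + eta) <= jam k w)%R] +
   Pr [set w | (n%:R * eta <= noise k w)%R] +
   Pr [set w | (n%:R * eta <= fade k w)%R])%E.
Proof.
move=> agr.
have mset (x : R) A : (forall t, measurable (A t)) ->
    measurable [set w | x <= occurrences R A n w].
  move=> mA; apply: measurable_bool_set; apply: measurable_fun_ler => //.
  exact: measurable_occurrences.
have mj : measurable [set w | n%:R * (1 - unjammed_prob lam k + eta) <= jam k w].
  apply: mset => t; apply: measurable_bool_set; exact: measurable_jam.
have mn : measurable [set w | n%:R * eta <= noise k w].
  apply: mset => t; apply: measurable_bool_set; apply: measurable_fun_ltr => //.
  exact: measurable_sqmodC.
have mf : measurable [set w | n%:R * eta <= fade k w].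
  apply: mset => t; apply: measurable_bool_set; apply: measurable_fun_ltr => //.
  apply: measurable_sqmodC; apply: measurable_dotC => //; exact: measurable_perp.
have mc : measurable [set w | decided_correctly ch P cd k w].
  exact/measurable_bool_set/measurable_decided_correctly.
have -> : error_prob ch P cd k = Pr (~` [set w | decided_correctly ch P cd k w]).
  congr (Pr _); apply/seteqP; split => w /=.
    by move=> ne /eqP.
  by move=> ne e; apply: ne; apply/eqP.
apply: le_trans (leeD2r _ (measureU2 Pr mj mn)).
apply: le_trans (measureU2 _ (measurableU _ _ mj mn) mf).
apply: le_measure; rewrite ?inE; [exact: measurableC|by do 2?apply: measurableU|].
move=> w /= ne.
have [|jw] := leP (n%:R * (1 - unjammed_prob lam k + eta)) (jam k w); first by left; left.
have [|nw] := leP (n%:R * eta) (noise k w); first by left; right.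
have [|fw] := leP (n%:R * eta) (fade k w); first by right.
exfalso; apply: ne; apply/eqP; exact: zf_dec_correct.
Qed.

Lemma zf_power (U : R) M :
  (forall k t, mean_le Pr (fun w => sqnormC (chH ch k t w)) (M k)) ->
  (forall i, sqmodC (symbol i) <= U) -> 0 <= U ->
  2 * U * (M ord0 + M ord_max) <= P -> power_constraint ch P cd.
Proof.
move=> HM symU U0 UP t.
rewrite unlock; apply: le_trans _ (_ : ((2 * U * (M ord0 + M ord_max))%:E <= _)%E); last first.
  by rewrite lee_fin.
suff [_ _] : mean_le Pr (fun w => sqnormC (input ch cd t w))
  (2 * U * (M ord0 + M ord_max)) by [].
apply: (@mean_leW _ _ _ Pr _
  (fun w => 2 * U * (sqnormC (chH ch ord0 t w) + sqnormC (chH ch ord_max t w)))).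
- apply: (measurable_from_known (ch := ch) (P := P) (m := m) (J := transmitter_sources)).
  by apply: measurable_sqnormC; exact: measurable_input.
- move=> w; rewrite sqnormC_ge0/= /zf_enc.
  apply: le_trans (sqnormC_beamform_le _ (U := U) _) _; first by move=> k; exact: symU.
  rewrite (sum_user ord0) !(latest_csi t w).
  by rewrite (_ : rev_ord ord0 = ord_max)//; exact: val_inj.
- by apply: mean_leZ; [exact: mulr_ge0|apply: mean_leD].
Qed.

End Decoding.

Lemma agreementC n Q (v w : {ffun 'I_n -> 'I_Q}) : agreement v w = agreement w v.
Proof. by apply: eq_card => t; rewrite !inE eq_sym. Qed.

(** * Codebooks of growing length *)

Section Achievability.
Context d (T : measurableType d) (R : realType) (Pr : probability T R)
  (lam : bool -> bool -> R) (ch : jammed_bc Pr lam) (jsit : knowledge).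
Variables (P : R) (Q : nat) (Q0 : (0 < Q)%N) (symbol : 'I_Q -> R[i]).
Variables (a b eta : R) (eta0 : 0 < eta) (r : user -> R).

Let mu k := unjammed_prob lam k - 4 * eta.

Lemma unjammed_prob_le1 k : unjammed_prob lam k <= 1.
Proof.
rewrite -lee_fin -(prob_unjammed ch 0 k) probability_le1//.
exact: measurable_unjammed.
Qed.

Let agree (n : nat) k : nat := Num.trunc (n%:R * mu k).

Let agree_le n k : (agree n k <= n)%N.
Proof.
have mu1 : mu k <= 1.
  by rewrite /mu; move: (unjammed_prob_le1 k) eta0; set x := unjammed_prob lam k; lra.
rewrite /agree -(@natrK R n) le_truncn//.
by rewrite natrK -[leRHS]mulr1 ler_wpM2l.
Qed.

(** The predecessor appears because a code has [(m k).+1] values. Where Gilbert's condition fails, a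
    single message is sent, so that a code exists at every length. *)
Definition messages (n : nat) (k : user) : nat :=
  let M := Num.trunc (expR (n%:R * r k)) in
  if (M * 2 ^ n <= Q ^ agree n k)%N then M.-1 else 0.

Hypothesis r0 : forall k, 0 <= r k.

Let trunc_gt0 n k : (0 < Num.trunc (expR (n%:R * r k)))%N.
Proof. by rewrite truncn_gt0 -expR0 ler_expR mulr_ge0. Qed.

Lemma codebook n k : exists word : 'I_(messages n k).+1 -> {ffun 'I_n -> 'I_Q},
  forall v v', v != v' -> (agreement (word v) (word v'))%:R <= n%:R * mu k :> R.
Proof.
rewrite /messages; case: ifP => [MQ|_]; last first.
  exists (fun=> [ffun=> Ordinal Q0]) => v v'; rewrite -val_eqE.
  by case: v v' => [[|//] ?] [[|//] ?].
set M := Num.trunc _ in MQ *.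
have [f fP] := gilbert_code Q0 (agree_le n k) MQ.
exists (fun v => f v) => v v' vv'.
have : (agreement (f v) (f v') < agree n k)%N.
  have vM (u : 'I_M.-1.+1) : (u < M)%N by rewrite -[ltnRHS](prednK (trunc_gt0 n k)).
  move: vv'; rewrite -val_eqE neq_ltn => /orP[lt|lt]; [|rewrite agreementC]; apply: fP;
    by rewrite lt/= vM.
(* The strict bound makes [agree n k] positive, so that n mu is not negative and its truncation lies
   below it. *)
move=> /[dup] /(leq_ltn_trans (leq0n _)) K0 /ltnW; rewrite -(ler_nat R) => /le_trans; apply.
by rewrite truncn_le//; move: K0; rewrite truncn_gt0; exact/le_trans.
Qed.

Hypothesis rate : forall k, r k = 0 \/ 0 <= mu k /\ r k + ln 2 < mu k * ln Q%:R.

(** The [ln 2] in [rate] pays for the factor [2 ^ n] of Gilbert's bound, and strictness makes the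
    condition hold for large [n]. Rate 0 needs no codebook, which covers a negative [mu k]. *)
Lemma messages_rate k :
  ln ((messages n k).+1%:R) / n%:R @[n --> \oo] --> r k.
Proof.
have [rk0|[mu0 gap]] := rate k.
  have E n : ln ((messages n k).+1%:R) / n%:R = 0.
    rewrite /messages rk0 mulr0 expR0 (_ : Num.trunc 1 = 1%N)/=; last exact: (natrK 1).
    by rewrite if_same ln1 mul0r.
  by under eq_cvg do rewrite E; rewrite rk0; exact: cvg_cst.
set g := mu k * ln Q%:R - r k - ln 2.
have g0 : 0 < g by rewrite /g -addrA -opprD subr_gt0.
have Q1 : 1 <= Q%:R :> R by rewrite ler1n.
have lnQ : 0 <= ln Q%:R :> R by exact: ln_ge0.
(* Truncation loses at most a factor 2 in the number of messages, that is ln 2 / n in rate. *)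
have lim : r k - ln 2 * n%:R^-1 @[n --> \oo] --> r k.
  rewrite -[X in _ --> X]subr0; apply: cvgB; first exact: cvg_cst.
  rewrite -[X in _ --> X](mulr0 (ln 2)); apply: cvgMl_tmp.
  by rewrite gtr0_cvgV0; [exact: cvgr_idn|near=> n; rewrite ltr0n; near: n; exact: nbhs_infty_gt].
apply: squeeze_cvgr lim (cvg_cst (r k)).
near=> n.
have n0 : 0 < n%:R :> R by rewrite ltr0n; near: n; exact: nbhs_infty_gt.
have ng : ln Q%:R / g <= n%:R by near: n; exact: nbhs_infty_ger.
set M := Num.trunc (expR (n%:R * r k)).
have M0 : (0 < M)%N by exact: trunc_gt0.
have Mle : M%:R <= expR (n%:R * r k) by rewrite truncn_le ?expR_ge0.
have Mlt : expR (n%:R * r k) < M.+1%:R by exact: truncnS_gt.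
(* Truncating n mu costs up to ln Q in the exponent, which n g exceeds by the choice of [n]. *)
have fits : (M * 2 ^ n <= Q ^ agree n k)%N.
  rewrite -(ler_nat R) natrM !natrX.
  rewrite -[X in X ^+ n](@lnK R) ?posrE// -[X in X ^+ agree n k](@lnK R) ?posrE ?ltr0n//.
  rewrite -!expRM_natl; apply: (le_trans (ler_wpM2r (expR_ge0 _) Mle)).
  rewrite -expRD ler_expR.
  have Kge : n%:R * mu k - 1 <= (agree n k)%:R.
    by rewrite lerBlDr natr1; exact/ltW/truncnS_gt.
  apply: le_trans (ler_wpM2r lnQ Kge).
  move: ng; rewrite ler_pdivrMr// /g; set l := ln Q%:R; set l2 := ln 2.
  rewrite !mulrBl mul1r -mulrA; set x := mu k * l; rewrite !mulrDr !mulrN.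
  by move=> ng; lra.
rewrite /messages -/M fits prednK//.
have M0R : 0 < M%:R :> R by rewrite ltr0n.
apply/andP; split; last first.
  by rewrite ler_pdivrMr// mulrC -[leRHS]expRK ler_ln ?posrE ?expR_gt0.
rewrite ler_pdivlMr// mulrBl -mulrA mulVf ?gt_eqF// mulr1 lerBlDr.
rewrite -lnM ?posrE// -[leLHS]expRK ler_ln ?posrE ?expR_gt0 ?mulr_gt0//.
rewrite mulrC; apply: le_trans (ltW Mlt) _.
by rewrite -natrM ler_nat muln2 -addnn -addn1 leq_add2l.
Unshelve. all: by end_near. Qed.

Hypothesis separation : forall i j, i != j -> 4 * a < b * sqmodC (symbol i - symbol j).
Hypothesis noise_le : forall k t, (Pr (noise_event ch k a t) <= (eta / 2)%:E)%E.
Hypothesis fade_le : forall k t, (Pr (fade_event ch k b t) <= (eta / 2)%:E)%E.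
Hypothesis power : forall n m word,
  power_constraint ch P (@zf_code R jsit n m Q symbol word a (n%:R * eta)).

Lemma achievable_zf : achievable ch Perfect jsit P r.
Proof.
have [word wordP] : exists word : forall n k, 'I_(messages n k).+1 -> {ffun 'I_n -> 'I_Q},
    forall n k v v', v != v' -> (agreement (word n k v) (word n k v'))%:R <= n%:R * mu k :> R.
  exists (fun n k => sval (cid (codebook n k))) => n k.
  exact: (svalP (cid (codebook n k))).
exists messages, (fun n => zf_code jsit symbol (word n) a (n%:R * eta)); split.
- by move=> n; exact: power.
- exact: messages_rate.
move=> k.
have h2 : 0 < eta / 2 by rewrite divr_gt0.
(* Half of [eta] bounds the event probabilities, the other half is the deviation in the weak law. *)
have hs : eta / 2 + eta / 2 = eta by rewrite -splitr.
have cj := jam_occurrences_cvg0 ch k eta0.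
have cn := noise_occurrences_cvg0 (noise_le k) h2.
have cf := fade_occurrences_cvg0 (fade_le k) h2.
rewrite hs in cn cf.
have := cvgeD _ (cvgeD _ cj cn) cf.
rewrite !adde0 => /(_ _ erefl _ erefl) cs.
apply: squeeze_cvge (cvg_cst 0%E) cs.
near=> n; rewrite /error_prob measure_ge0/=.
exact: zf_error_prob (wordP n k).
Unshelve. all: by end_near. Qed.

End Achievability.

(** * Rates *)

Section Grid.
Context (R : realType).
Variables (q : nat) (D : R).

Definition grid (i : 'I_(q * q)) : R[i] := (D * (i %/ q)%:R) +i* (D * (i %% q)%:R).

Lemma sqr_natrB_ge1 (x y : nat) : x != y -> 1 <= (x%:R - y%:R : R) ^+ 2.
Proof.
wlog xy : x y / (x < y)%N.
  move=> h; rewrite neq_ltn => /orP[xy|yx]; first by apply: h; rewrite // neq_ltn xy.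
  by rewrite -sqrrN opprB; apply: h; rewrite // neq_ltn yx.
move=> _; rewrite -sqrrN opprB -natrB; last exact: ltnW.
by rewrite -natrX ler1n expn_gt0 subn_gt0 xy.
Qed.

Lemma grid_separation i j : i != j -> D ^+ 2 <= sqmodC (grid i - grid j).
Proof.
rewrite -val_eqE => ij.
have q0 : (0 < q)%N by case: q i {ij j} => [[]|].
have E : sqmodC (grid i - grid j) = D ^+ 2 * (((i %/ q)%:R - (j %/ q)%:R) ^+ 2
    + ((i %% q)%:R - (j %% q)%:R) ^+ 2).
  by rewrite /sqmodC ReD ImD /=; ring.
rewrite E -[leLHS]mulr1 ler_wpM2l ?sqr_ge0//.
have [eq|ne] := eqVneq (i %/ q)%N (j %/ q)%N; last first.
  by apply: le_trans (sqr_natrB_ge1 ne) _; rewrite lerDl sqr_ge0.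
apply: (@le_trans _ _ (((i %% q)%:R - (j %% q)%:R) ^+ 2)); last by rewrite lerDr sqr_ge0.
apply: sqr_natrB_ge1; apply: contra ij => /eqP eqm.
by apply/eqP; rewrite [LHS](divn_eq _ q) eq eqm -divn_eq.
Qed.

Lemma grid_sqmod_le i : sqmodC (grid i) <= 2 * D ^+ 2 * q%:R ^+ 2.
Proof.
have q0 : (0 < q)%N by case: q i => [[]|].
rewrite /sqmodC /= !exprMn -mulrDr.
rewrite (_ : 2 * _ * _ = D ^+ 2 * (2 * q%:R ^+ 2)); last by ring.
rewrite ler_wpM2l ?sqr_ge0//.
rewrite mulr_natl mulr2n lerD// ler_sqr ?nnegrE// ler_nat ltnW//.
  by rewrite ltn_divLR.
exact: ltn_pmod.
Qed.

End Grid.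

Section Rates.
Context d (T : measurableType d) (R : realType) (Pr : probability T R)
  (lam : bool -> bool -> R) (ch : jammed_bc Pr lam) (jsit : knowledge).

Lemma fade_prob_le_users (e : R) : 0 < e ->
  exists2 b, 0 < b & forall k t, (Pr (fade_event ch k b t) <= e%:E)%E.
Proof.
move=> e0.
have [b0 b0p H0] := fade_prob_le ch ord0 e0.
have [b1 b1p H1] := fade_prob_le ch ord_max e0.
have mf k b t : measurable (fade_event ch k b t).
  apply: measurable_bool_set; apply: measurable_fun_ltr => //.
  by apply: measurable_sqmodC; apply: measurable_dotC => //; exact: measurable_perp.
exists (Num.min b0 b1); first by rewrite lt_min b0p.
move=> k t; have [->|k0] := eqVneq k ord0.
  apply: le_trans (H0 t); apply: le_measure; rewrite ?inE//.
  by move=> w; rewrite /fade_event/= lt_min => /andP[].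
have -> : k = ord_max by apply/val_inj; case: k k0 => -[|[|]].
apply: le_trans (H1 t); apply: le_measure; rewrite ?inE//.
by move=> w; rewrite /fade_event/= lt_min => /andP[].
Qed.

Lemma channel_moments : exists M : user -> R,
  forall k t, mean_le Pr (fun w => sqnormC (chH ch k t w)) (M k).
Proof.
have HM k := sqnorm_moment (chH_id ch k) (chH_cov ch k 0).
by exists (fun k => sval (cid (HM k))) => k; exact: (svalP (cid (HM k))).
Qed.

(** Fills in the powers at which nothing better is at hand, since [dof_region] quantifies over all
    positive ones. The only symbol is 0, so any power constraint is met. *)
Lemma achievable_zero (P : R) : 0 < P -> achievable ch Perfect jsit P (fun=> 0).
Proof.
move=> P0; have [M HM] := channel_moments.
have h : 0 < 1 / 2 :> R by rewrite divr_gt0.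
have [b b0 fade_le] := fade_prob_le_users h.
apply: (@achievable_zf _ _ _ _ _ ch jsit P 1 isT (fun=> 0) (8 / (1 / 2)) b 1) => //.
- by move=> k; left.
- by move=> i j; rewrite (ord1 i) (ord1 j) eqxx.
- by move=> k t; exact: noise_prob_le.
move=> n m word; apply: (zf_power _ _ _ _ (U := 0) HM) => //.
  by move=> _; rewrite /sqmodC/= expr0n addr0.
by rewrite mulr0 mul0r ltW.
Qed.

(** One half of the margin [e] is spent on bad times, as 4 eta = e / 2. The other half, times
    [ln P], absorbs the constant loss in the size of the grid, Gilbert's [ln 2], and 1 for
    strictness; this is the origin of the threshold on [P]. *)
Lemma achievable_below (D : user -> R) (e : R) :
  (forall k, D k <= unjammed_prob lam k) -> 0 < e <= 1 ->
  exists P1 : R, forall P : R, P1 <= P ->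
    achievable ch Perfect jsit P (fun k => Num.max 0 ((D k - e) * ln P)).
Proof.
move=> Dle /andP[e0 e1].
have [M HM] := channel_moments.
pose eta := e / 8.
have eta0 : 0 < eta by rewrite divr_gt0.
have h : 0 < eta / 2 by rewrite divr_gt0.
have [b b0 fade_le] := fade_prob_le_users h.
pose a := 8 / (eta / 2).
have a0 : 0 < a by rewrite divr_gt0.
(* Squared spacing of the grid; 5 instead of 4 makes the separation strict. *)
pose D2 := 5 * a / b.
have D20 : 0 < D2 by rewrite divr_gt0// mulr_gt0.
have M0 k : 0 <= M k := mean_le_ge0 (HM k 0%N).
(* Grid points have squared modulus at most 2 D2 q^2, so the power used is at most q^2 (C - 1). The
   added 1 keeps [C] positive. *)
pose C := 4 * D2 * (M ord0 + M ord_max) + 1.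
have C1 : 1 <= C by rewrite lerDr; apply: mulr_ge0; [apply: mulr_ge0 => //; exact: ltW|exact: addr_ge0].
have C0 : 0 < C by exact: lt_le_trans C1.
have lnC : 0 <= ln (4 * C) by rewrite ln_ge0//; lra.
have ln20 : 0 <= ln 2 :> R by rewrite ln_ge0// ler1n.
exists (expR (2 / e * (1 + ln (4 * C) + ln 2))) => P P1P.
have P0 : 0 < P by exact: lt_le_trans (expR_gt0 _) P1P.
have lnP : 2 / e * (1 + ln (4 * C) + ln 2) <= ln P.
  by rewrite -[leLHS]expRK ler_ln ?posrE ?expR_gt0.
have e2 : 1 <= 2 / e by rewrite ler_pdivlMr// mul1r; lra.
have lnP1 : 1 + ln (4 * C) + ln 2 <= ln P.
  apply: le_trans lnP; rewrite -[leLHS]mul1r ler_wpM2r//; lra.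
have lnP0 : 0 < ln P by lra.
have CP : 4 * C <= P.
  by rewrite -ler_ln ?posrE ?mulr_gt0//; lra.
(* As P / C >= 1, truncation at most halves the side, so q^2 is at least P / (4 C). *)
pose q := Num.trunc (Num.sqrt (P / C)).
have PC0 : 0 <= P / C by rewrite divr_ge0// ltW.
have q0 : (0 < q)%N.
  by rewrite truncn_gt0 -sqrtr1 ler_wsqrtr// ler_pdivlMr// mul1r; lra.
have qle : q%:R ^+ 2 <= P / C.
  rewrite -[leRHS]sqr_sqrtr// ler_sqr ?nnegrE ?sqrtr_ge0//.
  by rewrite truncn_le// sqrtr_ge0.
have qge : P / C <= 4 * q%:R ^+ 2.
  rewrite -[leLHS]sqr_sqrtr// (_ : 4 * q%:R ^+ 2 = (2 * q%:R) ^+ 2 :> R); last by ring.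
  rewrite ler_sqr ?nnegrE ?sqrtr_ge0//; apply: le_trans (ltW (truncnS_gt _)) _.
  by rewrite -natrM ler_nat mul2n -addnn -addn1 leq_add2l.
have lnQ : ln P - ln (4 * C) <= ln (q * q)%:R.
  have qq : P <= (q * q)%:R * (4 * C).
    move: qge; rewrite ler_pdivrMr// natrM expr2; set x := _%:R * _%:R.
    by rewrite (_ : 4 * x * C = x * (4 * C))//; ring.
  rewrite lerBlDr -lnM ?posrE ?mulr_gt0 ?ltr0n ?muln_gt0 ?q0//.
  by rewrite ler_ln ?posrE ?mulr_gt0 ?ltr0n ?muln_gt0 ?q0.
have q20 : (0 < q * q)%N by rewrite muln_gt0 q0.
apply: (@achievable_zf _ _ _ _ _ ch jsit P (q * q)%N q20 (grid (Num.sqrt D2)) a b eta eta0).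
- by move=> k; rewrite le_max lexx.
- move=> k; case: (leP ((D k - e) * ln P) 0) => Dk; first by left.
  right.
  have De : 0 < D k - e by rewrite -(pmulr_lgt0 _ lnP0).
  have muE : unjammed_prob lam k - 4 * eta = unjammed_prob lam k - e / 2.
    by rewrite /eta; field.
  rewrite muE.
  have := Dle k; have := unjammed_prob_le1 ch k.
  set l := unjammed_prob lam k => l1 Dl.
  have mu0 : 0 <= l - e / 2 by lra.
  split => //; apply: lt_le_trans (ler_wpM2l mu0 lnQ).
  have h1 : (D k - e / 2) * ln P <= (l - e / 2) * ln P by rewrite ler_wpM2r// ?(ltW lnP0)//; lra.
  have h2 : (l - e / 2) * ln (4 * C) <= 1 * ln (4 * C) by rewrite ler_wpM2r//; lra.
  have h3 : 1 + ln (4 * C) + ln 2 <= e / 2 * ln P.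
    move: lnP; rewrite -ler_pdivlMl ?divr_gt0// invf_div; apply: le_trans; exact: lexx.
  have E : (D k - e / 2) * ln P = (D k - e) * ln P + e / 2 * ln P by field.
  rewrite E in h1; rewrite mulrBr; rewrite mul1r in h2.
  move: h1 h2 h3; set x1 := (D k - e) * _; set x2 := e / 2 * _; set x3 := (l - _) * ln P.
  by set x4 := (l - _) * _; set y1 := ln _; set y2 := ln _; lra.
- move=> i j ij; apply: lt_le_trans (ler_wpM2l (ltW b0) (grid_separation _ ij)).
  rewrite sqr_sqrtr ?(ltW D20)// /D2 [b * _]mulrC divfK ?gt_eqF//; lra.
- by move=> k t; exact: noise_prob_le.
- exact: fade_le.
move=> n m word; apply: (zf_power _ _ _ _ (U := 2 * D2 * q%:R ^+ 2) HM).
- by move=> i; have := grid_sqmod_le (Num.sqrt D2) i; rewrite sqr_sqrtr ?(ltW D20).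
- by rewrite mulr_ge0 ?sqr_ge0// mulr_ge0// ltW.
have := ler_wpM2r (ltW C0) qle; rewrite divfK ?gt_eqF//; apply: le_trans.
rewrite (_ : 2 * (2 * _ * _) * _ = q%:R ^+ 2 * (4 * D2 * (M ord0 + M ord_max))); last by ring.
by rewrite ler_wpM2l ?sqr_ge0// lerDl.
Qed.

(** A diagonal argument: each margin is achievable from some power on, and at each power a margin
    within 1 / P of the infimum of the achievable ones is chosen. For large [P] a prescribed margin
    is among the candidates, so the chosen one tends to 0. *)
Lemma dof_region_sup (D : user -> R) :
  (forall k, 0 <= D k <= unjammed_prob lam k) ->
  dof_region ch Perfect jsit (D ord0, D ord_max).
Proof.
move=> HD.
have Dle k : D k <= unjammed_prob lam k by case/andP: (HD k).
have D0 k : 0 <= D k by case/andP: (HD k).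
pose rate (e P : R) (k : user) : R := Num.max 0 ((D k - e) * ln P).
pose E (P : R) := [set e : R | 0 < e <= 1 /\ achievable ch Perfect jsit P (rate e P)].
have choose (P : R) : exists r : user -> R, 0 < P ->
    achievable ch Perfect jsit P r /\
    (1 < P -> forall e' k, E P e' -> `|D k - r k / ln P| <= e' + P^-1).
  have [P0|P0] := leP P 0; first by exists (fun=> 0).
  have [P1|P1] := leP P 1; first by exists (fun=> 0) => _; split => //; exact: achievable_zero.
  have [E0|/set0P[e0 Ee0]] := eqVneq (E P) set0.
    exists (fun=> 0) => _; split; first exact: achievable_zero.
    by move=> _ e' k; rewrite E0.
  have infE : has_inf (E P).
    by split; [exists e0|exists 0 => x [/andP[/ltW]]].
  have Pv0 : 0 < P^-1 by rewrite invr_gt0.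
  have [e [/andP[e_gt0 e1] ach] lte] := inf_adherent Pv0 infE.
  exists (rate e P) => _; split => // _ e' k Ee'.
  have : e <= e' + P^-1.
    apply: le_trans (ltW lte) _; rewrite lerD2r; apply: ge_inf Ee'.
    by case: infE.
  apply: le_trans.
  have lnP : 0 < ln P by rewrite ln_gt0.
  (* Where the maximum cuts the rate off at 0, [D k] itself is at most [e], so the distance bound
     still holds. *)
  rewrite /rate; case: (leP ((D k - e) * ln P) 0) => h.
    move: h; rewrite pmulr_lle0// subr_le0 => h.
    by rewrite mul0r subr0 ger0_norm.
  by rewrite mulfK ?gt_eqF// opprB addrCA subrr addr0 gtr0_norm.
have [r rP] := choice choose.
have cv k : r P k / ln P @[P --> +oo] --> D k.
  apply/cvgrPdist_le => e e0.
  have e2 : 0 < Num.min (e / 2) 1 <= 1.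
    by rewrite lt_min ltr01 divr_gt0//= ge_min lexx orbT.
  have [P1 HP1] := achievable_below Dle e2.
  near=> P.
  have P1' : 1 < P by near: P; exact: nbhs_pinfty_gt.
  have P0' : 0 < P by exact: lt_trans P1'.
  have [_ /(_ P1' (Num.min (e / 2) 1) k) le1] := rP P P0'.
  apply: le_trans (le1 _) _.
    split => //; apply: HP1; near: P; apply: nbhs_pinfty_ge; exact: num_real.
  rewrite [leRHS]splitr.
  apply: lerD; first by rewrite ge_min lexx.
  rewrite invf_ple ?posrE ?divr_gt0//; near: P; apply: nbhs_pinfty_ge; exact: num_real.
by exists r; split => //= P P0; case: (rP P P0).
Unshelve. all: by end_near. Qed.

End Rates.

Theorem theorem1 (d : measure_display) (T : measurableType d) (R : realType)
    (Pr : probability T R) (lam : bool -> bool -> R) (ch : jammed_bc Pr lam) :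
  let lam1 := lam false false + lam false true in
  let lam2 := lam false false + lam true false in
  let region := [set dd : R * R |
    [/\ 0 <= dd.1, 0 <= dd.2, dd.1 <= lam1 & dd.2 <= lam2]] in
  [/\ dof_region ch Perfect Perfect = region,
      dof_region ch Perfect Delayed = region &
      dof_region ch Perfect NoInfo = region].
Proof.
move=> lam1 lam2 region.
suff regionE jsit : dof_region ch Perfect jsit = region by split.
apply/seteqP; split=> [dd /dof_region_sub//|[d1 d2] [/= d10 d20 d1l d2l]].
apply: (@dof_region_sup _ _ _ _ _ ch jsit (fun k => if k == ord0 then d1 else d2)) => k.
by rewrite /unjammed_prob; case: ifP => _; apply/andP.
Qed.
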